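(* Let $(U,A)$ be a left bialgebroid such that ${}_\triangleright U$ is finitely generated projective as a left $A$-module, let $U_*=\mathrm{Hom}_A({}_\triangleright U,A)$ be its left dual, and let $R$ be a braided commutative monoid in ${}_U\mathbf{YD}^U$. Let $\{e_j\}\subset U$, $\{e^j\}\subset U_*$ be a dual basis. Then the map $$\eta:\mathrm{Hom}_R(R\otimes_A U,R)\to {U_*}_\blacktriangleleft\otimes_A R,\qquad f\mapsto\sum_j e^j\otimes_A f(1_R\otimes_A e_j)$$ induces an isomorphism of right bialgebroids over $R$ $$\mathrm{Hom}_R(R\#U,R)\simeq U_*\#R,$$ where the left-hand side is the left dual $(R\#U)_*$ of the left bialgebroid $R\#U$ over $R$. If $U$ is a right Hopf algebroid (over a left $A$-bialgebroid), this is therefore an isomorphism of left Hopf algebroids (over right $R$-bialgebroids).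
   Context: Let $k$ be a commutative ring; algebras are unital associative $k$-algebras. LEFT BIALGEBROIDS. A left bialgebroid $(U,A,s,t,\Delta,\varepsilon)$ over the algebra $A$ consists of an algebra $U$, algebra maps $s:A\to U$ (source) and $t:A^{op}\to U$ (target) with commuting images, and maps $\Delta,\varepsilon$ as follows. Write $a\triangleright u\triangleleft b:=s(a)t(b)u$ and $a\blacktriangleright u\blacktriangleleft b:=u\,t(a)s(b)$; triangles as subscripts indicate the module structure used. $\Delta:U\to U_\triangleleft\otimes_A{}_\triangleright U$, $u\mapsto u_{(1)}\otimes_A u_{(2)}$ (so $t(a)u\otimes_A u'=u\otimes_A s(a)u'$) and $\varepsilon:U\to A$ make ${}_\triangleright U_\triangleleft$ an $A$-coring; $\Delta$ takes values in the Takeuchi subspace of elements $\sum_i u_i\otimes_A u_i'$ with $\sum_i u_it(a)\otimes_A u'_i=\sum_i u_i\otimes_A u_i's(a)$ for all $a$, and is a unital algebra map into it; $\varepsilon(1)=1$ and $\varepsilon(uu')=\varepsilon(u\,s(\varepsilon(u')))=\varepsilon(u\,t(\varepsilon(u')))$. Each left $U$-module $M$ is an $A$-bimodule via $a\triangleright m\triangleleft b:=s(a)t(b)m$. $(U,A)$ is a right Hopf algebroid if $\alpha_r:U_\blacktriangleleft\otimes_A{}_\triangleright U\to U_\triangleleft\otimes_A{}_\triangleright U$, $u\otimes_A u'\mapsto u_{(1)}u'\otimes_A u_{(2)}$, is bijective. A right $U$-comodule is a right $A$-module $M$ with a right $A$-linear coassociative counital coaction $\rho_M:M\to M\otimes_A{}_\triangleright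 U$, $m\mapsto m_{[0]}\otimes_A m_{[1]}$; with the induced left action $am:=m_{[0]}\varepsilon(m_{[1]}s(a))$ one has $\rho_M(ama')=m_{[0]}\otimes_A t(a')m_{[1]}t(a)$ and $am_{[0]}\otimes_A m_{[1]}=m_{[0]}\otimes_A m_{[1]}s(a)$. ${}_U\mathbf{YD}^U$: objects are left $U$-modules and right $U$-comodules $M$ for which the two $A$-bimodule structures coincide and $u_{(1)}m_{[0]}\otimes_A u_{(2)}m_{[1]}=(u_{(2)}m)_{[0]}\otimes_A(u_{(2)}m)_{[1]}u_{(1)}$. A monoid in ${}_U\mathbf{YD}^U$ is an object $R$ that is a unital algebra $(R,\cdot)$ with: $u(r\cdot r')=(u_{(1)}r)\cdot(u_{(2)}r')$, $u1_R=\varepsilon(u)\triangleright 1_R$; $a(r\cdot r')=(ar)\cdot r'$, $(r\cdot r')a=r\cdot(r'a)$, $(ra)\cdot r'=r\cdot(ar')$; $(r\cdot r')_{[0]}\otimes_A(r\cdot r')_{[1]}=r_{[0]}\cdot r'_{[0]}\otimes_A r'_{[1]}r_{[1]}$, $1_{[0]}\otimes_A1_{[1]}=1_R\otimes_A1_U$. It is braided commutative if $r\cdot r'=r'_{[0]}\cdot(r'_{[1]}r)$ for all $r,r'$. LEFT SMASH PRODUCT. For such $R$, $R\#U$ denotes $R\otimes_A{}_\triangleright U$ with product $(r\otimes_A u)(r'\otimes_A u')=r\cdot(u_{(1)}r')\otimes_A u_{(2)}u'$, source $r\mapsto r\otimes_A1$, target $r\mapsto r_{[0]}\otimes_A r_{[1]}$,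 coproduct $r\otimes_A u\mapsto(r\otimes_A u_{(1)})\otimes_R(1\otimes_A u_{(2)})$ and counit $r\otimes_A u\mapsto r\varepsilon(u)$; this is a left bialgebroid over $R$ (right Hopf if $U$ is). RIGHT BIALGEBROIDS. A right bialgebroid $(V,B,s,t,\Delta,\partial)$ has algebra maps $s:B\to V$, $t:B^{op}\to V$ with commuting images; put $b\triangleright v\triangleleft b':=s(b)t(b')v$ and $b\blacktriangleright v\blacktriangleleft b':=v\,t(b)s(b')$; $\Delta:V\to V_\blacktriangleleft\otimes_B{}_\blacktriangleright V$, $v\mapsto v^{(1)}\otimes_B v^{(2)}$, and $\partial:V\to B$ form a $B$-coring on ${}_\blacktriangleright V_\blacktriangleleft$; $\Delta$ is a unital algebra map into the subspace where $\sum s(b)v_i\otimes v_i'=\sum v_i\otimes t(b)v'_i$; $\partial(1)=1$, $\partial(vv')=\partial(s(\partial v)v')=\partial(t(\partial v)v')$. $(V,B)$ is a left Hopf algebroid if $\beta_\ell:V_\blacktriangleleft\otimes_B{}_\triangleright V\to V_\blacktriangleleft\otimes_B{}_\blacktriangleright V$, $v'\otimes_B v\mapsto v^{(1)}\otimes_B v'v^{(2)}$, is bijective. LEFT DUAL. For a left bialgebroid $(U,A)$ with ${}_\triangleright U$ finitely generated projective, $U_*:=\mathrm{Hom}_A({}_\triangleright U,A)$, with $\langle\psi,u\rangle:=\psi(u)$, is a right bialgebroid over $A$ with product $(\psi\psi')(u)=\langle\psi',\,t(\langle\psi,u_{(2)}\rangle)u_{(1)}\rangle$, unit $\varepsilon$,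 source $a\mapsto\varepsilon(\cdot)a$, target $a\mapsto\varepsilon(\cdot\,t(a))$, counit $\partial(\psi)=\psi(1_U)$, and coproduct determined by $\langle\psi,uu'\rangle=\langle\psi^{(2)},\,u\,s(\langle\psi^{(1)},u'\rangle)\rangle$. It is a left Hopf algebroid if $U$ is a right Hopf algebroid. The same construction applied to the left bialgebroid $R\#U$ over $R$ gives $\mathrm{Hom}_R(R\#U,R)$. A dual basis satisfies $u=\sum_js(\langle e^j,u\rangle)e_j$ for all $u\in U$. RIGHT SMASH PRODUCT. A braided commutative monoid $R$ in ${}_U\mathbf{YD}^U$ is a braided commutative right-left Yetter-Drinfeld algebra over the right bialgebroid $U_*$ via the right action $r\psi=r_{[0]}\langle\psi,r_{[1]}\rangle$ and the left coaction $r\mapsto r^{(-1)}\otimes_A r^{(0)}=\sum_je^j\otimes_A e_jr$. Then $U_*\#R$ denotes ${U_*}_\blacktriangleleft\otimes_A R$ with product $(\psi\otimes_A r)(\tilde\psi\otimes_A r')=\psi\tilde\psi^{(1)}\otimes_A(r\tilde\psi^{(2)})\cdot r'$, source $r\mapsto1\otimes_A r$, target $r\mapsto r^{(-1)}\otimes_A r^{(0)}$, coproduct $\psi\otimes_A r\mapsto(\psi^{(1)}\otimes_A1)\otimes_R(\psi^{(2)}\otimes_A r)$ and counit $\psi\otimes_A r\mapsto\partial(\psi)r$; this is a right bialgebroid over $R$ (left Hopf if $U_*$ is). *)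

(* Defs.v *)
From HB Require Import structures.
From mathcomp Require Import all_boot all_algebra.
From mathcomp Require Import boolp classical_sets functions.

Set Implicit Arguments.
Unset Strict Implicit.
Unset Printing Implicit Defensive.

Import GRing.Theory.
Local Open Scope ring_scope.
Local Open Scope quotient_scope.

(* MathComp's [algType] rules out the zero algebra (1 != 0), which is a        *)
(* legitimate base or total algebra here; hence an own record.  A              *)
(* [preAlgebra] carries the operations only: the underlying algebras of smash  *)
(* products and duals have products that are defined before they are known to  *)
(* be associative.                                                             *)
Record preAlgebra (k : comPzRingType) := PreAlgebra {
  alg_car :> lmodType k;
  alg_mul : alg_car -> alg_car -> alg_car;
  alg_one : alg_car }.
Arguments alg_one {k _}.

Declare Scope bialg_scope.
Delimit Scope bialg_scope with B.
Notation "x ** y" := (alg_mul x y) (at level 40, left associativity) : bialg_scope.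
Notation "\1" := alg_one (at level 0) : bialg_scope.
Local Open Scope bialg_scope.

Record is_algebra (k : comPzRingType) (A : preAlgebra k) : Prop := IsAlgebra {
  alg_mulA : forall x y z : A, x ** (y ** z) = x ** y ** z;
  alg_mul1l : forall x : A, \1 ** x = x;
  alg_mul1r : forall x : A, x ** \1 = x;
  alg_linl : forall y : A, linear (fun x : A => x ** y);
  alg_linr : forall x : A, linear (fun y : A => x ** y) }.

Record algebra (k : comPzRingType) := Algebra {
  alg_pre :> preAlgebra k;
  algP : is_algebra alg_pre }.

Record is_alg_map (k : comPzRingType) (A B : preAlgebra k) (f : A -> B) : Prop :=
  IsAlgMap {
    alg_map_linear : linear f;
    alg_map1 : f \1 = \1;
    alg_mapM : forall x y, f (x ** y) = f x ** f y }.

(* algebra map from the opposite algebra of A *)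
Record is_alg_opmap (k : comPzRingType) (A B : preAlgebra k) (f : A -> B) : Prop :=
  IsAlgOpMap {
    alg_opmap_linear : linear f;
    alg_opmap1 : f \1 = \1;
    alg_opmapM : forall x y, f (x ** y) = f y ** f x }.

Lemma algType_is_algebra (k : comPzRingType) (A : algType k) :
  is_algebra (@PreAlgebra k A *%R 1).
Proof.
split=> /= [x y z|x|x|y c x z|x c y z]; rewrite ?mulrA ?mul1r ?mulr1 //.
  by rewrite mulrDl scalerAl.
by rewrite mulrDr scalerAr.
Qed.

Section Tensor.
Variables (k : comPzRingType) (A : Type) (M N : lmodType k).
Variables (ract : M -> A -> M) (lact : A -> N -> N).

(* M (x)_A N is the free k-module on M x N modulo bilinearity and              *)
(* (m a) (x) n = m (x) (a n); (c, m, n) stands for c (m (x) n), and a list for *)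
(* the sum of its entries.                                                     *)
Definition pretensor := seq (k * M * N).

Inductive tens_rel : pretensor -> pretensor -> Prop :=
| TensRefl x : tens_rel x x
| TensSym x y : tens_rel x y -> tens_rel y x
| TensTrans y x z : tens_rel x y -> tens_rel y z -> tens_rel x z
| TensCat x x' y y' :
    tens_rel x x' -> tens_rel y y' -> tens_rel (x ++ y) (x' ++ y')
| TensCatC x y : tens_rel (x ++ y) (y ++ x)
| TensCoef0 m n : tens_rel [:: (0, m, n)] [::]
| TensCoefD c d m n : tens_rel [:: (c + d, m, n)] [:: (c, m, n); (d, m, n)]
| TensDl c m m' n : tens_rel [:: (c, m + m', n)] [:: (c, m, n); (c, m', n)]
| TensDr c m n n' : tens_rel [:: (c, m, n + n')] [:: (c, m, n); (c, m, n')]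
| TensZl c d m n : tens_rel [:: (c, d *: m, n)] [:: (c * d, m, n)]
| TensZr c d m n : tens_rel [:: (c, m, d *: n)] [:: (c * d, m, n)]
| TensBal c m a n : tens_rel [:: (c, ract m a, n)] [:: (c, m, lact a n)].

Definition tens_relb (x y : pretensor) : bool := `[< tens_rel x y >].

Fact tens_relb_refl : reflexive tens_relb.
Proof. by move=> x; apply/asboolP/TensRefl. Qed.
Fact tens_relb_sym : symmetric tens_relb.
Proof. by move=> x y; apply/asboolP/asboolP; apply: TensSym. Qed.
Fact tens_relb_trans : transitive tens_relb.
Proof. by move=> y x z /asboolP xy /asboolP yz; apply/asboolP/(TensTrans xy). Qed.

Canonical tens_equiv :=
  EquivRel tens_relb tens_relb_refl tens_relb_sym tens_relb_trans.

Definition tensor := {eq_quot tens_equiv}.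
HB.instance Definition _ := Choice.on tensor.

Definition tens_class (x : pretensor) : tensor := \pi_{eq_quot tens_equiv} x.
Definition tens_repr (x : tensor) : pretensor := repr (x : {eq_quot tens_equiv}).

Lemma tens_classP x y : reflect (tens_rel x y) (tens_class x == tens_class y).
Proof. by rewrite /tens_class eqmodE; apply: asboolP. Qed.

Lemma tens_reprK x : tens_class (tens_repr x) = x.
Proof. exact: reprK. Qed.

Lemma tens_reprP x : tens_rel (tens_repr (tens_class x)) x.
Proof. by apply/tens_classP; rewrite tens_reprK. Qed.

Definition prescale (d : k) (x : pretensor) : pretensor :=
  [seq (d * p.1.1, p.1.2, p.2) | p <- x].

Lemma prescale_rel d x y : tens_rel x y -> tens_rel (prescale d x) (prescale d y).
Proof.
elim=> {x y} /= [x|x y _|y x z _ IH1 _|x x' y y' _ IH1 _ IH2|x y|m n|c e m n|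
  c m m' n|c m n n'|c e m n|c e m n|c m a n].
- exact: TensRefl.
- exact: TensSym.
- exact: TensTrans.
- by rewrite /prescale !map_cat; apply: TensCat.
- by rewrite /prescale !map_cat; apply: TensCatC.
- by rewrite mulr0; apply: TensCoef0.
- by rewrite mulrDr; apply: TensCoefD.
- exact: TensDl.
- exact: TensDr.
- by rewrite mulrA; apply: TensZl.
- by rewrite mulrA; apply: TensZr.
- exact: TensBal.
Qed.

Definition tens_add (x y : tensor) := tens_class (tens_repr x ++ tens_repr y).
Definition tens_scale (d : k) (x : tensor) := tens_class (prescale d (tens_repr x)).

Lemma tens_addE x y : tens_add (tens_class x) (tens_class y) = tens_class (x ++ y).
Proof. by apply/eqP/tens_classP/TensCat; apply: tens_reprP. Qed.

Lemma tens_scaleE d x : tens_scale d (tens_class x) = tens_class (prescale d x).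
Proof. exact/eqP/tens_classP/prescale_rel/tens_reprP. Qed.

Let tens_ind0 (P : tensor -> Prop) : (forall s, P (tens_class s)) -> forall x, P x.
Proof. by move=> H x; rewrite -[x]tens_reprK. Qed.

Fact tens_addA : associative tens_add.
Proof.
elim/tens_ind0=> x; elim/tens_ind0=> y; elim/tens_ind0=> z.
by rewrite !tens_addE catA.
Qed.

Fact tens_addC : commutative tens_add.
Proof.
elim/tens_ind0=> x; elim/tens_ind0=> y; rewrite !tens_addE.
exact/eqP/tens_classP/TensCatC.
Qed.

Fact tens_add0 : left_id (tens_class [::]) tens_add.
Proof. by elim/tens_ind0=> x; rewrite tens_addE. Qed.

Let prescale_add c d x : tens_rel (prescale (c + d) x) (prescale c x ++ prescale d x).
Proof.
elim: x => [|[[e m] n] x IH] /=; first exact: TensRefl.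
rewrite mulrDl.
pose a := (c * e, m, n); pose b := (d * e, m, n).
set P := prescale c x; set Q := prescale d x.
apply: (TensTrans (y := [:: a; b] ++ (P ++ Q))).
  exact: (TensCat (x := [:: _]) (x' := [:: a; b]) (TensCoefD _ _ _ _) IH).
apply: (@TensCat [:: a] [:: a] ([:: b] ++ P ++ Q) (P ++ [:: b] ++ Q)).
  exact: TensRefl.
by rewrite !catA; apply: TensCat; [apply: TensCatC | apply: TensRefl].
Qed.

Let prescale0 x : tens_rel (prescale 0 x) [::].
Proof.
elim: x => [|[[e m] n] x IH] /=; first exact: TensRefl.
rewrite mul0r.
exact: (@TensCat [:: _] [::] (prescale 0 x) [::] (TensCoef0 _ _) IH).
Qed.

Let prescale1 x : prescale 1 x = x.
Proof. by elim: x => [|[[e m] n] x IH] //=; rewrite mul1r IH. Qed.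

Fact tens_addN : left_inverse (tens_class [::]) (tens_scale (-1)) tens_add.
Proof.
elim/tens_ind0=> x; rewrite tens_scaleE tens_addE -{2}(prescale1 x).
apply/eqP/tens_classP/(TensTrans (TensSym (prescale_add _ _ _))).
by rewrite addNr; apply: prescale0.
Qed.

HB.instance Definition _ :=
  GRing.isZmodule.Build tensor tens_addA tens_addC tens_add0 tens_addN.

Fact tens_scaleA a b x : tens_scale a (tens_scale b x) = tens_scale (a * b) x.
Proof.
elim/tens_ind0: x => x; rewrite !tens_scaleE /prescale -map_comp; congr tens_class.
by apply: eq_map => -[[e m] n] /=; rewrite mulrA.
Qed.
Fact tens_scale1 : left_id 1 tens_scale.
Proof. by elim/tens_ind0=> x; rewrite tens_scaleE prescale1. Qed.
Fact tens_scaleDr : right_distributive tens_scale +%R.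
Proof.
move=> a; elim/tens_ind0=> x; elim/tens_ind0=> y.
by rewrite {1}[_ + _]tens_addE !tens_scaleE [RHS]tens_addE /prescale map_cat.
Qed.
Fact tens_scaleDl x : {morph tens_scale^~ x : a b / a + b}.
Proof.
move=> a b; elim/tens_ind0: x => x; rewrite !tens_scaleE [RHS]tens_addE.
exact/eqP/tens_classP/prescale_add.
Qed.

HB.instance Definition _ :=
  GRing.Zmodule_isLmodule.Build k tensor tens_scaleA tens_scale1 tens_scaleDr
    tens_scaleDl.

Definition tens (m : M) (n : N) : tensor := tens_class [:: (1, m, n)].

Lemma tens_linl n : linear (tens^~ n).
Proof.
move=> c m m'; rewrite /tens [c *: tens_class _]tens_scaleE [RHS]tens_addE /=.
apply/eqP/tens_classP/(TensTrans (TensDl _ _ _ _)).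
apply: (@TensCat [:: _] [:: _] [:: _] [:: _]); last exact: TensRefl.
by rewrite -[X in (X, _, _) :: _]mulrC; apply: TensZl.
Qed.

Lemma tens_linr m : linear (tens m).
Proof.
move=> c n n'; rewrite /tens [c *: tens_class _]tens_scaleE [RHS]tens_addE /=.
apply/eqP/tens_classP/(TensTrans (TensDr _ _ _ _)).
apply: (@TensCat [:: _] [:: _] [:: _] [:: _]); last exact: TensRefl.
by rewrite -[X in (X, _, _) :: _]mulrC; apply: TensZr.
Qed.

Lemma tens_bal m a n : tens (ract m a) n = tens m (lact a n).
Proof. exact/eqP/tens_classP/TensBal. Qed.

Lemma tensE (x : tensor) :
  x = \sum_(p <- tens_repr x) p.1.1 *: tens p.1.2 p.2.
Proof.
rewrite -{1}[x]tens_reprK; elim: (tens_repr x) => [|[[c m] n] s IH].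
  by rewrite big_nil.
rewrite big_cons -IH /= /tens [c *: tens_class _]tens_scaleE [RHS]tens_addE /=.
by rewrite mulr1.
Qed.

(* The map m (x) n |-> f m n, which is meaningful when f is k-bilinear and     *)
(* A-balanced; being total, it allows Sweedler notation in definitions:        *)
(* [tlift (fun u1 u2 => E) (lb_cop u)] is E summed over u_(1) (x) u_(2).  In   *)
(* the nested lifts below the inner one is balanced for fixed outer variables, *)
(* the outer one as a whole (sometimes only thanks to a Takeuchi condition).   *)
Definition tlift (P : lmodType k) (f : M -> N -> P) (x : tensor) : P :=
  \sum_(p <- tens_repr x) p.1.1 *: f p.1.2 p.2.

Section Lift.
Variables (P : lmodType k) (f : M -> N -> P).
Hypothesis f_linl : forall n, linear (f^~ n).
Hypothesis f_linr : forall m, linear (f m).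
Hypothesis f_bal : forall m a n, f (ract m a) n = f m (lact a n).

Let ev (s : pretensor) : P := \sum_(p <- s) p.1.1 *: f p.1.2 p.2.

Let f_Dl m m' n : f (m + m') n = f m n + f m' n.
Proof. by rewrite -[m]scale1r f_linl !scale1r. Qed.
Let f_Dr m n n' : f m (n + n') = f m n + f m n'.
Proof. by rewrite -[n]scale1r f_linr !scale1r. Qed.
Let f_0l n : f 0 n = 0.
Proof. by apply: (@addrI _ (f 0 n)); rewrite -f_Dl !addr0. Qed.
Let f_0r m : f m 0 = 0.
Proof. by apply: (@addrI _ (f m 0)); rewrite -f_Dr !addr0. Qed.
Let f_Zl c m n : f (c *: m) n = c *: f m n.
Proof. by rewrite -[c *: m]addr0 f_linl f_0l addr0. Qed.
Let f_Zr c m n : f m (c *: n) = c *: f m n.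
Proof. by rewrite -[c *: n]addr0 f_linr f_0r addr0. Qed.

Let ev_rel s t : tens_rel s t -> ev s = ev t.
Proof.
rewrite /ev; elim=> {s t} //=.
- by move=> y x z _ -> _ ->.
- by move=> x x' y y' _ IH1 _ IH2; rewrite !big_cat IH1 IH2.
- by move=> x y; rewrite !big_cat /= addrC.
- by move=> m n; rewrite big_seq1 scale0r big_nil.
- by move=> c d m n; rewrite !big_cons !big_nil !addr0 scalerDl.
- by move=> c m m' n; rewrite !big_cons !big_nil !addr0 f_Dl scalerDr.
- by move=> c m n n'; rewrite !big_cons !big_nil !addr0 f_Dr scalerDr.
- by move=> c d m n; rewrite !big_seq1 f_Zl scalerA.
- by move=> c d m n; rewrite !big_seq1 f_Zr scalerA.
- by move=> c m a n; rewrite !big_seq1 f_bal.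
Qed.

Lemma tlift_tens m n : tlift f (tens m n) = f m n.
Proof.
by rewrite /tlift -/(ev _) (ev_rel (tens_reprP _)) /ev big_seq1 scale1r.
Qed.

Lemma tlift_linear : linear (tlift f).
Proof.
move=> c x y; rewrite -[in LHS](tens_reprK x) -[in LHS](tens_reprK y).
rewrite [c *: tens_class _]tens_scaleE [_ + _]tens_addE /tlift -/(ev _) (ev_rel (tens_reprP _)).
rewrite /ev big_cat /= big_map scaler_sumr; congr (_ + _).
by apply: eq_bigr => p _; rewrite scalerA.
Qed.
End Lift.

End Tensor.

Arguments tensor {k A M N} ract lact.
Arguments tens {k A M N ract lact} m n.
Arguments tlift {k A M N ract lact P} f x.

Definition tmap (k : comPzRingType) (A B : Type) (M N M' N' : lmodType k)
    (ract : M -> A -> M) (lact : A -> N -> N)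
    (ract' : M' -> B -> M') (lact' : B -> N' -> N')
    (f : M -> M') (g : N -> N') (x : tensor ract lact) : tensor ract' lact' :=
  tlift (fun m n => tens (f m) (g n)) x.
Arguments tmap {k A B M N M' N' ract lact ract' lact'} f g x.

(* (m (x) n) b := m (x) (n b) *)
Definition tens_ract (k : comPzRingType) (A B : Type) (M N : lmodType k)
    (ract : M -> A -> M) (lact : A -> N -> N) (act : N -> B -> N)
    (x : tensor ract lact) (b : B) : tensor ract lact :=
  tmap idfun (act^~ b) x.

Section LinearHom.
Variables (k : comPzRingType) (A : algebra k) (M : lmodType k) (lact : A -> M -> M).

Definition is_lhom (f : M -> A) : Prop :=
  linear f /\ forall a m, f (lact a m) = a ** f m.

Definition lhom_pred : {pred M -> A} := fun f => `[< is_lhom f >].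

Record lhom := LHom { lhom_fun :> M -> A; _ : lhom_fun \in lhom_pred }.

HB.instance Definition _ := [isSub for lhom_fun].
HB.instance Definition _ := [Choice of lhom by <:].

Fact lhom_submod_closed : subsemimod_closed lhom_pred.
Proof.
have [_ _ _ _ Ml] := algP A.
have mulD (a x y : A) : a ** (x + y) = a ** x + a ** y.
  by rewrite -[x]scale1r Ml !scale1r.
have mul0 (a : A) : a ** 0 = 0.
  by apply: (@addrI _ (a ** 0)); rewrite -mulD !addr0.
have mulZ (a x : A) c : a ** (c *: x) = c *: (a ** x).
  by rewrite -[c *: x]addr0 Ml mul0 addr0.
split; first split.
- apply/asboolP; split=> [c x y|a m] /=; rewrite ?mul0 //.
  by rewrite -[LHS]addr0; congr (_ + _); rewrite [RHS]scaler0.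
- move=> f g /asboolP[fl fA] /asboolP[gl gA]; apply/asboolP; split=> [c x y|a m].
    change (f (c *: x + y) + g (c *: x + y) = c *: (f x + g x) + (f y + g y)).
    by rewrite fl gl scalerDr addrACA.
  change (f (lact a m) + g (lact a m) = a ** (f m + g m)).
  by rewrite fA gA mulD.
- move=> d f /asboolP[fl fA]; apply/asboolP; split=> [c x y|a m].
    change (d *: f (c *: x + y) = c *: (d *: f x) + d *: f y).
    by rewrite fl scalerDr !scalerA mulrC.
  change (d *: f (lact a m) = a ** (d *: f m)).
  by rewrite fA mulZ.
Qed.

HB.instance Definition _ :=
  GRing.isSubSemiModClosed.Build k (M -> A) lhom_pred lhom_submod_closed.
HB.instance Definition _ := [SubChoice_isSubLmodule of lhom by <:].

(* f as an element of Hom_A(M, A), when f is A-linear (0 otherwise) *)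
Definition to_lhom (f : M -> A) : lhom := insubd 0 f.

Lemma to_lhomE f : is_lhom f -> to_lhom f = f :> (M -> A).
Proof. by move=> fP; apply: insubdK; apply/asboolP. Qed.

(* M is a direct summand of some A^n *)
Definition fg_projective : Prop :=
  exists (n : nat) (i : M -> 'I_n -> A) (p : ('I_n -> A) -> M),
    [/\ forall m m' j, i (m + m') j = i m j + i m' j,
        forall a m j, i (lact a m) j = a ** i m j,
        forall v w, p (fun j => v j + w j) = p v + p w,
        forall a v, p (fun j => a ** v j) = lact a (p v)
      & forall m, p (i m) = m].

End LinearHom.

(* Algebra with source and target maps, common to left and right bialgebroids. *)
Record aering (k : comPzRingType) (A : algebra k) := AeRing {
  ae_alg :> preAlgebra k;
  src : A -> ae_alg;
  tgt : A -> ae_alg }.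
Arguments src {k A _} a.
Arguments tgt {k A _} a.

Section Triangles.
Variables (k : comPzRingType) (A : algebra k) (U : aering A).

(* White triangles  a |> u <| b = s(a) t(b) u,  black triangles                *)
(* a |> u <| b = u t(a) s(b).                                                  *)
Definition wtl (a : A) (u : U) : U := src a ** u.
Definition wtr (u : U) (a : A) : U := tgt a ** u.
Definition btl (a : A) (u : U) : U := u ** tgt a.
Definition btr (u : U) (a : A) : U := u ** src a.

Record is_aering : Prop := IsAeRing {
  ae_algebra : is_algebra U;
  ae_src : is_alg_map (@src k A U);
  ae_tgt : is_alg_opmap (@tgt k A U);
  ae_comm : forall a b : A, src a ** tgt b = tgt b ** src a :> U }.
End Triangles.
Arguments wtl {k A U} a u.
Arguments wtr {k A U} u a.
Arguments btl {k A U} a u.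
Arguments btr {k A U} u a.

Record left_bialgebroid_data (k : comPzRingType) (A : algebra k) := LeftBialgebroid {
  lb_base :> aering A;
  lb_cop : lb_base -> tensor (@wtr k A lb_base) (@wtl k A lb_base);
  lb_eps : lb_base -> A }.

Section LeftBialgebroid.
Variables (k : comPzRingType) (A : algebra k) (U : left_bialgebroid_data A).

Notation UU := (tensor (@wtr k A U) (@wtl k A U)).
Notation UUU := (tensor (@tens_ract k A A U U wtr wtl wtr) (@wtl k A U)).
Notation Delta := (@lb_cop k A U).
Notation eps := (@lb_eps k A U).

Record is_left_bialgebroid : Prop := IsLeftBialgebroid {
  lb_aering : is_aering U;
  lb_cop_linear : linear Delta;
  lb_cop_l : forall a u, Delta (wtl a u) = tmap (wtl a) idfun (Delta u);
  lb_cop_r : forall a u, Delta (wtr u a) = tmap idfun (wtr^~ a) (Delta u);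
  lb_eps_linear : linear eps;
  lb_eps_l : forall a u, eps (wtl a u) = a ** eps u;
  lb_eps_r : forall a u, eps (wtr u a) = eps u ** a;
  lb_coassoc : forall u,
    tlift (fun u1 u2 => tens (Delta u1) u2 : UUU) (Delta u) =
    tlift (fun u1 u2 => tlift (fun u2' u2'' => tens (tens u1 u2') u2'' : UUU)
                              (Delta u2)) (Delta u);
  lb_counitl : forall u, tlift (fun u1 u2 => wtl (eps u1) u2) (Delta u) = u;
  lb_counitr : forall u, tlift (fun u1 u2 => wtr u1 (eps u2)) (Delta u) = u;
  lb_takeuchi : forall a u,
    tmap (btl a) idfun (Delta u) = tmap idfun (btr^~ a) (Delta u) :> UU;
  lb_cop1 : Delta \1 = tens \1 \1;
  lb_copM : forall u v,
    Delta (u ** v) =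
    tlift (fun v1 v2 => tlift (fun u1 u2 => tens (u1 ** v1) (u2 ** v2) : UU)
                              (Delta u)) (Delta v);
  lb_eps1 : eps \1 = \1;
  lb_epsM_src : forall u v, eps (u ** v) = eps (u ** src (eps v));
  lb_epsM_tgt : forall u v, eps (u ** v) = eps (u ** tgt (eps v)) }.

Definition alpha_r (x : tensor (@btr k A U) (@wtl k A U)) : UU :=
  tlift (fun u v => tlift (fun u1 u2 => tens (u1 ** v) u2 : UU) (Delta u)) x.

Definition is_right_hopf_algebroid : Prop :=
  is_left_bialgebroid /\ bijective alpha_r.

End LeftBialgebroid.

Record right_bialgebroid_data (k : comPzRingType) (B : algebra k) :=
  RightBialgebroid {
    rb_base :> aering B;
    rb_cop : rb_base -> tensor (@btr k B rb_base) (@btl k B rb_base);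
    rb_eps : rb_base -> B }.

Section RightBialgebroid.
Variables (k : comPzRingType) (B : algebra k) (V : right_bialgebroid_data B).

Notation VV := (tensor (@btr k B V) (@btl k B V)).
Notation VVV := (tensor (@tens_ract k B B V V btr btl btr) (@btl k B V)).
Notation Delta := (@rb_cop k B V).
Notation eps := (@rb_eps k B V).

Record is_right_bialgebroid : Prop := IsRightBialgebroid {
  rb_aering : is_aering V;
  rb_cop_linear : linear Delta;
  rb_cop_l : forall b v, Delta (btl b v) = tmap (btl b) idfun (Delta v);
  rb_cop_r : forall b v, Delta (btr v b) = tmap idfun (btr^~ b) (Delta v);
  rb_eps_linear : linear eps;
  rb_eps_l : forall b v, eps (btl b v) = b ** eps v;
  rb_eps_r : forall b v, eps (btr v b) = eps v ** b;
  rb_coassoc : forall v,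
    tlift (fun v1 v2 => tens (Delta v1) v2 : VVV) (Delta v) =
    tlift (fun v1 v2 => tlift (fun v2' v2'' => tens (tens v1 v2') v2'' : VVV)
                              (Delta v2)) (Delta v);
  rb_counitl : forall v, tlift (fun v1 v2 => btl (eps v1) v2) (Delta v) = v;
  rb_counitr : forall v, tlift (fun v1 v2 => btr v1 (eps v2)) (Delta v) = v;
  rb_takeuchi : forall b v,
    tmap (wtl b) idfun (Delta v) = tmap idfun (wtr^~ b) (Delta v) :> VV;
  rb_cop1 : Delta \1 = tens \1 \1;
  rb_copM : forall v w,
    Delta (v ** w) =
    tlift (fun v1 v2 => tlift (fun w1 w2 => tens (v1 ** w1) (v2 ** w2) : VV)
                              (Delta w)) (Delta v);
  rb_eps1 : eps \1 = \1;
  rb_epsM_src : forall v w, eps (v ** w) = eps (src (eps v) ** w);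
  rb_epsM_tgt : forall v w, eps (v ** w) = eps (tgt (eps v) ** w) }.

Definition beta_l (x : tensor (@btr k B V) (@wtl k B V)) : VV :=
  tlift (fun w v => tlift (fun v1 v2 => tens v1 (w ** v2) : VV) (Delta v)) x.

Definition is_left_hopf_algebroid : Prop :=
  is_right_bialgebroid /\ bijective beta_l.

End RightBialgebroid.

Record is_right_bialgebroid_iso (k : comPzRingType) (B : algebra k)
    (V W : right_bialgebroid_data B) (f : V -> W) : Prop :=
  IsRightBialgebroidIso {
    rbi_bij : bijective f;
    rbi_alg : is_alg_map f;
    rbi_src : forall b, f (src b) = src b;
    rbi_tgt : forall b, f (tgt b) = tgt b;
    rbi_cop : forall v, rb_cop (f v) = tmap f f (rb_cop v);
    rbi_eps : forall v, rb_eps (f v) = rb_eps v }.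

Section YetterDrinfeld.
Variables (k : comPzRingType) (A : algebra k) (U : left_bialgebroid_data A).

Record is_left_module (M : lmodType k) (act : U -> M -> M) : Prop := IsLeftModule {
  lm_linl : forall m, linear (act^~ m);
  lm_linr : forall u, linear (act u);
  lm_act1 : forall m, act \1 m = m;
  lm_actM : forall u v m, act (u ** v) m = act u (act v m) }.

Record is_right_comodule (M : lmodType k) (ract : M -> A -> M)
    (rho : M -> tensor ract (@wtl k A U)) : Prop := IsRightComodule {
  rc_linl : forall a, linear (ract^~ a);
  rc_linr : forall m, linear (ract m);
  rc_ract1 : forall m, ract m \1 = m;
  rc_ractM : forall m a b, ract m (a ** b) = ract (ract m a) b;
  rc_linear : linear rho;
  rc_rho_r : forall m a, rho (ract m a) = tmap idfun (wtr^~ a) (rho m);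
  rc_coassoc : forall m,
    tlift (fun m0 m1 => tens (rho m0) m1 : tensor (tens_ract wtr) wtl) (rho m) =
    tlift (fun m0 m1 => tlift (fun u1 u2 => tens (tens m0 u1) u2) (lb_cop m1))
          (rho m);
  rc_counit : forall m, tlift (fun m0 m1 => ract m0 (lb_eps m1)) (rho m) = m }.

Definition comodule_lact (M : lmodType k) (ract : M -> A -> M)
    (rho : M -> tensor ract (@wtl k A U)) (a : A) (m : M) : M :=
  tlift (fun m0 m1 => ract m0 (lb_eps (m1 ** src a))) (rho m).

Record is_yd_module (M : lmodType k) (act : U -> M -> M) (ract : M -> A -> M)
    (rho : M -> tensor ract (@wtl k A U)) : Prop := IsYDModule {
  yd_module : is_left_module act;
  yd_comodule : is_right_comodule rho;
  yd_lact_eq : forall a m, act (src a) m = comodule_lact rho a m;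
  yd_ract_eq : forall a m, act (tgt a) m = ract m a;
  yd_compat : forall u m,
    tlift (fun m0 m1 => tlift (fun u1 u2 => tens (act u1 m0) (u2 ** m1))
                              (lb_cop u)) (rho m) =
    tlift (fun u1 u2 => tlift (fun m0 m1 => tens m0 (m1 ** u1)) (rho (act u2 m)))
          (lb_cop u) :> tensor ract (@wtl k A U) }.

Record yd_monoid_data := YDMonoid {
  yd_alg :> algebra k;
  yd_act : U -> yd_alg -> yd_alg;
  yd_ract : yd_alg -> A -> yd_alg;
  yd_coact : yd_alg -> tensor yd_ract (@wtl k A U) }.

Variable R : yd_monoid_data.

(* by yd_lact_eq, also the left A-action induced by the coaction *)
Definition yd_lact (a : A) (r : R) : R := yd_act (src a) r.

Record is_yd_monoid : Prop := IsYDMonoid {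
  ydm_yd : is_yd_module (@yd_act R) (@yd_coact R);
  ydm_actM : forall u (r r' : R),
    yd_act u (r ** r') = tlift (fun u1 u2 => yd_act u1 r ** yd_act u2 r') (lb_cop u);
  ydm_act1 : forall u, yd_act u \1 = yd_lact (lb_eps u) \1;
  ydm_lact : forall a (r r' : R), yd_lact a (r ** r') = yd_lact a r ** r';
  ydm_ract : forall a (r r' : R), yd_ract (r ** r') a = r ** yd_ract r' a;
  ydm_mid : forall a (r r' : R), yd_ract r a ** r' = r ** yd_lact a r';
  ydm_coactM : forall r r' : R,
    yd_coact (r ** r') =
    tlift (fun r0 r1 => tlift (fun r0' r1' => tens (r0 ** r0') (r1' ** r1))
                              (yd_coact r')) (yd_coact r);
  ydm_coact1 : yd_coact (\1 : R) = tens \1 \1 }.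

Definition braided_commutative : Prop :=
  forall r r' : R, r ** r' = tlift (fun r0 r1 => r0 ** yd_act r1 r) (yd_coact r').

End YetterDrinfeld.
Arguments yd_act {k A U R} u r : rename.
Arguments yd_ract {k A U R} r a : rename.
Arguments yd_coact {k A U R} r : rename.
Arguments yd_lact {k A U R} a r.

Section LeftSmash.
Variables (k : comPzRingType) (A : algebra k) (U : left_bialgebroid_data A).
Variable R : yd_monoid_data U.

Notation RU := (tensor (@yd_ract k A U R) (@wtl k A U)).

Definition lsmash_mul (x y : RU) : RU :=
  tlift (fun r u => tlift (fun r' u' =>
    tlift (fun u1 u2 => tens (r ** yd_act u1 r') (u2 ** u')) (lb_cop u)) y) x.

Definition lsmash_alg : preAlgebra k := PreAlgebra lsmash_mul (tens \1 \1).

Definition lsmash_aering : aering R :=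
  @AeRing k R lsmash_alg (fun r => tens r \1) yd_coact.

Definition lsmash_cop (x : lsmash_aering) :
    tensor (@wtr k R lsmash_aering) (@wtl k R lsmash_aering) :=
  tlift (fun r u => tlift (fun u1 u2 =>
    tens (tens r u1 : lsmash_aering) (tens \1 u2 : lsmash_aering)) (lb_cop u)) x.

Definition lsmash_eps (x : lsmash_aering) : R :=
  tlift (fun r u => yd_ract r (lb_eps u)) x.

Definition lsmash : left_bialgebroid_data R :=
  @LeftBialgebroid k R lsmash_aering lsmash_cop lsmash_eps.

End LeftSmash.

Section LeftDual.
Variables (k : comPzRingType) (A : algebra k) (U : left_bialgebroid_data A).

Notation U_ := (lhom (@wtl k A U)).

Definition ldual_mul (psi psi' : U_) : U_ :=
  to_lhom _ (fun u => tlift (fun u1 u2 => psi' (tgt (psi u2) ** u1)) (lb_cop u)).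

Definition ldual_alg : preAlgebra k :=
  PreAlgebra ldual_mul (to_lhom _ (@lb_eps k A U)).

Definition ldual_aering : aering A :=
  @AeRing k A ldual_alg
    (fun a => to_lhom _ (fun u => lb_eps u ** a))
    (fun a => to_lhom _ (fun u => lb_eps (u ** tgt a))).

(* the element psi_(1) (x) psi_(2) determined by                               *)
(* <psi, u u'> = <psi_(2), u s(<psi_(1), u'>)>; existence and uniqueness hold  *)
(* when U is finitely generated projective for wtl (default value 0).          *)
Definition ldual_cop (psi : ldual_aering) :
    tensor (@btr k A ldual_aering) (@btl k A ldual_aering) :=
  xget 0 [set x | forall u u' : U,
    psi (u ** u') =
    tlift (fun (psi1 psi2 : ldual_aering) => psi2 (u ** src (psi1 u'))) x].

Definition ldual_eps (psi : ldual_aering) : A := psi \1.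

Definition ldual : right_bialgebroid_data A :=
  @RightBialgebroid k A ldual_aering ldual_cop ldual_eps.

Definition dual_basis (I : finType) (e : I -> U) (e' : I -> ldual) : Prop :=
  forall u : U, u = \sum_(j : I) src (e' j u) ** e j.

End LeftDual.

Section RightSmash.
Variables (k : comPzRingType) (B : algebra k) (V : right_bialgebroid_data B).
Variables (R : algebra k) (lact : B -> R -> R) (ract : R -> V -> R).
Variable lcoact : R -> tensor (@btr k B V) lact.

(* V # R for a right-left Yetter-Drinfeld algebra R over V: B acts on R from   *)
(* the left by lact, V acts from the right by ract and coacts by lcoact.       *)
Notation VR := (tensor (@btr k B V) lact).

Definition rsmash_mul (x y : VR) : VR :=
  tlift (fun v r => tlift (fun w r' =>
    tlift (fun w1 w2 => tens (v ** w1) (ract r w2 ** r')) (rb_cop w)) y) x.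

Definition rsmash_alg : preAlgebra k := PreAlgebra rsmash_mul (tens \1 \1).

Definition rsmash_aering : aering R :=
  @AeRing k R rsmash_alg (fun r => tens \1 r) lcoact.

Definition rsmash_cop (x : rsmash_aering) :
    tensor (@btr k R rsmash_aering) (@btl k R rsmash_aering) :=
  tlift (fun v r => tlift (fun v1 v2 =>
    tens (tens v1 \1 : rsmash_aering) (tens v2 r : rsmash_aering)) (rb_cop v)) x.

Definition rsmash_eps (x : rsmash_aering) : R :=
  tlift (fun v r => lact (rb_eps v) r) x.

Definition rsmash : right_bialgebroid_data R :=
  @RightBialgebroid k R rsmash_aering rsmash_cop rsmash_eps.

End RightSmash.

Section DualSmash.
Variables (k : comPzRingType) (A : algebra k) (U : left_bialgebroid_data A).
Variables (R : yd_monoid_data U) (I : finType) (e : I -> U) (e' : I -> ldual U).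

Definition dual_ract (r : R) (psi : ldual U) : R :=
  tlift (fun r0 r1 => yd_ract r0 (psi r1)) (yd_coact r).

Definition dual_lcoact (r : R) : tensor (@btr k A (ldual U)) (@yd_lact k A U R) :=
  \sum_(j : I) tens (e' j) (yd_act (e j) r).

Definition dual_rsmash : right_bialgebroid_data R := rsmash dual_ract dual_lcoact.

Definition eta (f : ldual (lsmash R)) : dual_rsmash :=
  \sum_(j : I) tens (e' j) (f (tens \1 (e j))).

End DualSmash.
Arguments eta {k A U} R {I} e e' f.

(* Main.v *)
Require Import Defs.
From mathcomp Require Import all_boot all_algebra.
From mathcomp Require Import boolp classical_sets.

(** Write [V] for the left dual of [U] and [e_j], [e^j] for the dual basis.
    A tensor [x] in [V (x)_A N] is determined by the [A]-linear map
    [u |-> x(u)] it induces from [U] to [N], since [x = sum_j e^j (x) x(e_j)].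
    This turns all identities between elements of [V (x) V] or [V # R] into
    identities between values on [U].  In particular the coproduct of [psi] in
    [V] is [sum_j e^j (x) psi(- e_j)], and the Galois map of [V] is the
    transpose of the Galois map of [U].  So the dual of a left bialgebroid with
    a dual basis is a right bialgebroid, and is left Hopf if [U] is right Hopf.
    The smash product [R # U] is a left bialgebroid with dual basis
    [1 (x) e_j], [r (x) u |-> r e^j(u)], and its Galois map is [R (x)_A] the one
    of [U].  The inverse of [eta] sends [x] to [r (x) u |-> r x(u)]; evaluating
    at [1 (x) u] shows that it preserves the structure maps.  The axioms for
    [V # R] then hold because they can be transported along [eta]. *)

Set Implicit Arguments.
Unset Strict Implicit.
Unset Printing Implicit Defensive.

Import GRing.Theory.
Local Open Scope ring_scope.
Local Open Scope bialg_scope.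

(** * Linear and balanced maps *)

(* [tlift] is total: on a family that is not balanced it returns a value that depends on a chosen
   representative. Hence every Sweedler computation carries obligations [Lin] and [Bal], and much of
   the structure is consumed there: linearity of a coproduct makes one of two nested lifts balanced,
   and a Takeuchi condition the other.

   The two smash products are not treated alike. For [R # U] the axioms are checked directly, and
   each Yetter-Drinfeld axiom has its place: braided commutativity turns the target into right
   multiplication in [R], and the compatibility of action and coaction yields the Takeuchi
   condition. For [V # R] no axiom is known while the inverse [theta] of [eta] is studied; on the
   contrary, injectivity and multiplicativity of [theta] serve to prove that the coproduct of
   [V # R] is well defined. So the Yetter-Drinfeld axioms of [R] over [V] never have to be verified
   in full. *)
Create HintDb lin.

(* A wrapper around [linear]: being a product, [linear f] would be unfolded by
   proof search. *)
Record Lin (k : comPzRingType) (M N : lmodType k) (f : M -> N) : Prop :=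
  MkLin { linP : linear f }.

Section Linearity.
Variables (k : comPzRingType).
Implicit Types (M N P : lmodType k).

Lemma LinD M N (f : M -> N) : Lin f -> {morph f : x y / x + y}.
Proof. by case=> fl x y; rewrite -[x in LHS]scale1r fl scale1r. Qed.

Lemma Lin0 M N (f : M -> N) : Lin f -> f 0 = 0.
Proof. by move=> fl; apply: (@addrI _ (f 0)); rewrite -LinD // !addr0. Qed.

Lemma LinZ M N (f : M -> N) c x : Lin f -> f (c *: x) = c *: f x.
Proof. by move=> fl; rewrite -[c *: x]addr0 (linP fl) Lin0 // addr0. Qed.

Lemma Lin_sum M N (f : M -> N) (I : Type) (r : seq I) (F : I -> M) :
  Lin f -> f (\sum_(i <- r) F i) = \sum_(i <- r) f (F i).
Proof. by move=> fl; apply: (big_morph f (LinD fl) (Lin0 fl)). Qed.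

Lemma lin_id M : Lin (fun x : M => x).
Proof. by split. Qed.

Lemma lin_comp M N P (f : M -> N) (g : N -> P) :
  Lin g -> Lin f -> Lin (fun x => g (f x)).
Proof. by move=> [gl] [fl]; split=> c x y; rewrite fl gl. Qed.

Lemma lin_bigsum M N (I : Type) (r : seq I) (F : M -> I -> N) :
  (forall i, Lin (F^~ i)) -> Lin (fun x => \sum_(i <- r) F x i).
Proof.
move=> Fl; split=> c x y; rewrite scaler_sumr -big_split /=.
by apply: eq_bigr => i _; rewrite (linP (Fl i)).
Qed.

Lemma lin_scale M N (d : k) (f : M -> N) : Lin f -> Lin (fun x => d *: f x).
Proof.
by case=> fl; split=> c x y; rewrite fl scalerDr !scalerA mulrC.
Qed.

Lemma lin_can M N (f : M -> N) (g : N -> M) :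
  cancel f g -> cancel g f -> Lin f -> Lin g.
Proof.
move=> fK gK fl; split=> c x y; apply: (can_inj fK).
by rewrite (linP fl) !gK.
Qed.

End Linearity.

#[local] Hint Resolve lin_id lin_bigsum : lin.

(** These are the conditions that [tlift_tens] and [tlift_linear] put on a family: under them the
    value of [tlift f] does not depend on the representative of the tensor. *)
Record Bal (k : comPzRingType) (A : Type) (M N P : lmodType k)
    (ract : M -> A -> M) (lact : A -> N -> N) (f : M -> N -> P) : Prop := MkBal {
  bal_linl : forall n, Lin (f^~ n);
  bal_linr : forall m, Lin (f m);
  bal_act : forall m a n, f (ract m a) n = f m (lact a n) }.

Section Lifting.
Variables (k : comPzRingType) (A : Type) (M N : lmodType k).
Variables (ract : M -> A -> M) (lact : A -> N -> N).
Notation MN := (tensor ract lact).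
Implicit Types (P Q : lmodType k).

Lemma lift_tens P (f : M -> N -> P) m n :
  Bal ract lact f -> tlift f (tens m n : MN) = f m n.
Proof.
by case=> fl fr fb; apply: tlift_tens => // x;
  [exact: (linP (fl x)) | exact: (linP (fr x))].
Qed.

Lemma lin_lift P Q (f : M -> N -> P) (g : Q -> MN) :
  Bal ract lact f -> Lin g -> Lin (fun x => tlift f (g x)).
Proof.
case=> fl fr fb gl; apply: lin_comp gl; split; apply: tlift_linear => // x.
  exact: (linP (fl x)).
exact: (linP (fr x)).
Qed.

(** [tlift] is a finite sum over one chosen representative of [x], so a parameter passes through it
    termwise, whether or not the family is balanced in [m] and [n]. *)
Lemma lin_lift_fun P Q (f : Q -> M -> N -> P) (x : MN) :
  (forall m n, Lin (fun q => f q m n)) -> Lin (fun q => tlift (f q) x).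
Proof.
by move=> fl; rewrite /tlift; apply: lin_bigsum => i; apply: lin_scale.
Qed.

Lemma lin_tensl P (n : N) (f : P -> M) : Lin f -> Lin (fun x => tens (f x) n : MN).
Proof. by apply: (lin_comp (g := fun m => tens m n)); split; apply: tens_linl. Qed.

Lemma lin_tensr P (m : M) (f : P -> N) : Lin f -> Lin (fun x => tens m (f x) : MN).
Proof. by apply: lin_comp; split; apply: tens_linr. Qed.

Lemma bal_tens : Bal ract lact (fun m n => tens m n : MN).
Proof.
split=> [n|m|m a n]; last exact: tens_bal.
  exact: (lin_tensl n (lin_id _)).
exact: (lin_tensr m (lin_id _)).
Qed.

Lemma eq_lift P (f g : M -> N -> P) (x : MN) :
  (forall m n, f m n = g m n) -> tlift f x = tlift g x.
Proof. by move=> fg; apply: eq_bigr => p _; rewrite fg. Qed.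

Lemma lift_lin P Q (h : P -> Q) (f : M -> N -> P) (x : MN) :
  Lin h -> h (tlift f x) = tlift (fun m n => h (f m n)) x.
Proof.
by move=> hl; rewrite /tlift (Lin_sum _ _ hl); apply: eq_bigr => p _; rewrite LinZ.
Qed.

Lemma lift_id (x : MN) : tlift (fun m n => tens m n : MN) x = x.
Proof. by rewrite {2}[x]tensE. Qed.

(** Both lifts are finite sums over chosen representatives, so they commute for arbitrary [f].
    Sweedler sums can thus be reordered without checking that the reordered lifts are balanced. *)
Lemma lift_exch (B : Type) (M' N' : lmodType k) (ract' : M' -> B -> M')
    (lact' : B -> N' -> N') P (f : M -> N -> M' -> N' -> P) (x : MN)
    (y : tensor ract' lact') :
  tlift (fun m n => tlift (fun m' n' => f m n m' n') y) x =
  tlift (fun m' n' => tlift (fun m n => f m n m' n') x) y.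
Proof.
rewrite /tlift; under eq_bigr do rewrite scaler_sumr.
rewrite exchange_big; apply: eq_bigr => p _; rewrite scaler_sumr.
by apply: eq_bigr => q _; rewrite !scalerA mulrC.
Qed.

End Lifting.

Section Lifting2.
Variables (k : comPzRingType) (A : Type) (M N : lmodType k).
Variables (ract : M -> A -> M) (lact : A -> N -> N).
Notation MN := (tensor ract lact).
Implicit Types (P Q : lmodType k).

Lemma lift_lift (B : Type) (M' N' : lmodType k) (ract' : M' -> B -> M')
    (lact' : B -> N' -> N') P (f : M -> N -> P) (g : M' -> N' -> MN)
    (y : tensor ract' lact') :
  Bal ract lact f ->
  tlift f (tlift g y) = tlift (fun m n => tlift f (g m n)) y.
Proof. by move=> fB; apply: (lift_lin (h := tlift f)); apply: lin_lift (lin_id _). Qed.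

Lemma lift_lift_tens (B : Type) (M' N' : lmodType k) (ract' : M' -> B -> M')
    (lact' : B -> N' -> N') P (f : M -> N -> P) (g : M' -> N' -> M)
    (h : M' -> N' -> N) (y : tensor ract' lact') :
  Bal ract lact f ->
  tlift f (tlift (fun m n => tens (g m n) (h m n) : MN) y) =
  tlift (fun m n => f (g m n) (h m n)) y.
Proof.
by move=> fB; rewrite lift_lift //; apply: eq_lift => m n; rewrite lift_tens.
Qed.

Lemma lift_map (B : Type) (M' N' : lmodType k) (ract' : M' -> B -> M')
    (lact' : B -> N' -> N') P (f : M -> N -> P) (g : M' -> M)
    (h : N' -> N) (y : tensor ract' lact') :
  Bal ract lact f ->
  tlift f (tmap g h y : MN) = tlift (fun m n => f (g m) (h n)) y.
Proof. exact: lift_lift_tens. Qed.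

Lemma tens_ext P (F G : MN -> P) :
  Lin F -> Lin G -> (forall m n, F (tens m n) = G (tens m n)) -> forall x, F x = G x.
Proof.
move=> Fl Gl FG x; rewrite -[x]lift_id !(lift_lin _ _ Fl, lift_lin _ _ Gl).
exact: eq_lift.
Qed.

End Lifting2.

#[local] Hint Resolve lin_lift lin_lift_fun lin_tensl lin_tensr bal_tens : lin.

Lemma lin_map (k : comPzRingType) (A B : Type) (M N M' N' P : lmodType k)
    (ract : M -> A -> M) (lact : A -> N -> N)
    (ract' : M' -> B -> M') (lact' : B -> N' -> N')
    (f : M -> M') (g : N -> N') (F : P -> tensor ract lact) :
  Bal ract lact (fun m n => tens (f m) (g n) : tensor ract' lact') -> Lin F ->
  Lin (fun x => tmap f g (F x) : tensor ract' lact').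
Proof. by move=> fgB; apply: lin_lift. Qed.
#[local] Hint Resolve lin_map : lin.

Section Algebras.
Variables (k : comPzRingType) (A : preAlgebra k) (hA : is_algebra A).

Lemma lin_mull (M : lmodType k) (y : A) (f : M -> A) :
  Lin f -> Lin (fun x => f x ** y).
Proof. by apply: (lin_comp (g := fun x => x ** y)); split; apply: alg_linl. Qed.

Lemma lin_mulr (M : lmodType k) (y : A) (f : M -> A) :
  Lin f -> Lin (fun x => y ** f x).
Proof. by apply: lin_comp; split; apply: alg_linr. Qed.
End Algebras.

#[local] Hint Resolve algP lin_mull lin_mulr : lin.

#[local] Hint Opaque tens tlift tmap tens_ract lhom_fun alg_mul src tgt wtl wtr btl btr
  lb_cop lb_eps rb_cop rb_eps tensor : lin.

Ltac lin_eta :=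
  cbv beta;
  lazymatch goal with
  | |- Lin (fun _ => _) => fail
  | |- @Lin ?k ?M ?N ?f => change (@Lin k M N (fun x => f x))
  end.
#[local] Hint Extern 1 (Lin _) => lin_eta : lin.

Ltac lin := cbv beta; solve [typeclasses eauto 20 with lin nocore].

(** * Left bialgebroids *)

Section AeringLin.
Variables (k : comPzRingType) (A : algebra k) (U : aering A) (hU : is_aering U).
Variable M : lmodType k.

Lemma lin_src (f : M -> A) : Lin f -> Lin (fun x => src (f x) : U).
Proof. by apply: lin_comp; split; exact: alg_map_linear (ae_src hU). Qed.

Lemma lin_tgt (f : M -> A) : Lin f -> Lin (fun x => tgt (f x) : U).
Proof. by apply: lin_comp; split; exact: alg_opmap_linear (ae_tgt hU). Qed.

Let ha := ae_algebra hU.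

Lemma lin_wtl a (f : M -> U) : Lin f -> Lin (fun x => wtl a (f x)).
Proof. exact: lin_mulr. Qed.
Lemma lin_btr a (f : M -> U) : Lin f -> Lin (fun x => btr (f x) a).
Proof. exact: lin_mull. Qed.
Lemma lin_wtr a (f : M -> U) : Lin f -> Lin (fun x => wtr (f x) a).
Proof. exact: lin_mulr. Qed.
Lemma lin_btl a (f : M -> U) : Lin f -> Lin (fun x => btl a (f x)).
Proof. exact: lin_mull. Qed.

Lemma lin_wtl_a (f : M -> A) u : Lin f -> Lin (fun x => wtl (f x) u : U).
Proof. by move=> fl; apply: lin_mull => //; apply: lin_src. Qed.
Lemma lin_wtr_a (f : M -> A) u : Lin f -> Lin (fun x => wtr u (f x) : U).
Proof. by move=> fl; apply: lin_mull => //; apply: lin_tgt. Qed.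
End AeringLin.

Section AeringIdentities.
Variables (k : comPzRingType) (A : algebra k) (U : aering A) (hU : is_aering U).

Lemma wtlE a (u : U) : wtl a u = src a ** u. Proof. by []. Qed.
Lemma wtrE a (u : U) : wtr u a = tgt a ** u. Proof. by []. Qed.
Lemma btlE a (u : U) : btl a u = u ** tgt a. Proof. by []. Qed.
Lemma btrE a (u : U) : btr u a = u ** src a. Proof. by []. Qed.

Lemma amulA (x y z : A) : x ** (y ** z) = x ** y ** z.
Proof. exact: alg_mulA (algP A) _ _ _. Qed.
Lemma amul1l (x : A) : \1 ** x = x. Proof. exact: alg_mul1l (algP A) _. Qed.
Lemma amul1r (x : A) : x ** \1 = x. Proof. exact: alg_mul1r (algP A) _. Qed.
Lemma umulA (x y z : U) : x ** (y ** z) = x ** y ** z.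
Proof. exact: alg_mulA (ae_algebra hU) _ _ _. Qed.
Lemma umul1l (x : U) : \1 ** x = x. Proof. exact: alg_mul1l (ae_algebra hU) _. Qed.
Lemma umul1r (x : U) : x ** \1 = x. Proof. exact: alg_mul1r (ae_algebra hU) _. Qed.
Lemma srcM (a b : A) : src (a ** b) = src a ** src b :> U.
Proof. exact: alg_mapM (ae_src hU) _ _. Qed.
Lemma src1 : src \1 = \1 :> U. Proof. exact: alg_map1 (ae_src hU). Qed.
Lemma tgtM (a b : A) : tgt (a ** b) = tgt b ** tgt a :> U.
Proof. exact: alg_opmapM (ae_tgt hU) _ _. Qed.
Lemma tgt1 : tgt \1 = \1 :> U. Proof. exact: alg_opmap1 (ae_tgt hU). Qed.
Lemma src_tgt (a b : A) : src a ** tgt b = tgt b ** src a :> U.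
Proof. exact: ae_comm hU _ _. Qed.
End AeringIdentities.

Coercion lb_aering : is_left_bialgebroid >-> is_aering.

Section LeftBialgebroid.
Variables (k : comPzRingType) (A : algebra k) (U : left_bialgebroid_data A).
Hypothesis hU : is_left_bialgebroid U.

Let hae := lb_aering hU.
Definition lb_is_algebra : is_algebra U := ae_algebra (lb_aering hU).
Let ha := lb_is_algebra.

Lemma lin_cop (M : lmodType k) (f : M -> U) : Lin f -> Lin (fun x => lb_cop (f x)).
Proof. by apply: lin_comp; split; exact: lb_cop_linear hU. Qed.

Lemma lin_eps (M : lmodType k) (f : M -> U) : Lin f -> Lin (fun x => lb_eps (f x)).
Proof. by apply: lin_comp; split; exact: lb_eps_linear hU. Qed.

Lemma eps_src_mul a (u : U) : lb_eps (src a ** u) = a ** lb_eps u.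
Proof. exact: (lb_eps_l hU). Qed.
Lemma eps_tgt_mul a (u : U) : lb_eps (tgt a ** u) = lb_eps u ** a.
Proof. exact: (lb_eps_r hU). Qed.
Lemma eps_tgt a : lb_eps (tgt a : U) = a.
Proof. by rewrite -[tgt a]umul1r // eps_tgt_mul (lb_eps1 hU) amul1l. Qed.
(** The counit of a product sees the right factor only through the counit of that factor, and
    [tgt a] has counit [a]. *)
Lemma eps_mul_tgt a (u : U) : lb_eps (u ** tgt a) = lb_eps (u ** src a).
Proof. by rewrite (lb_epsM_src hU) eps_tgt. Qed.

Section Lift.
Variables (P : lmodType k) (f : U -> U -> P).
Hypothesis fB : Bal wtr wtl f.

Lemma cop_src a u :
  tlift f (lb_cop (src a ** u)) = tlift (fun u1 u2 => f (src a ** u1) u2) (lb_cop u).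
Proof. by rewrite (lb_cop_l hU a) lift_map. Qed.

Lemma cop_tgt a u :
  tlift f (lb_cop (tgt a ** u)) = tlift (fun u1 u2 => f u1 (tgt a ** u2)) (lb_cop u).
Proof. by rewrite (lb_cop_r hU a) lift_map. Qed.

Lemma cop_one : tlift f (lb_cop \1) = f \1 \1.
Proof. by rewrite (lb_cop1 hU) lift_tens. Qed.

Lemma cop_mul u v : tlift f (lb_cop (u ** v)) =
  tlift (fun u1 u2 => tlift (fun v1 v2 => f (u1 ** v1) (u2 ** v2)) (lb_cop v)) (lb_cop u).
Proof.
rewrite (lb_copM hU) lift_lift // lift_exch; apply: eq_lift => v1 v2.
exact: lift_lift_tens.
Qed.

Lemma cop_tak a u : tlift (fun u1 u2 => f (u1 ** tgt a) u2) (lb_cop u) =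
  tlift (fun u1 u2 => f u1 (u2 ** src a)) (lb_cop u).
Proof. by have := congr1 (tlift f) (lb_takeuchi hU a u); rewrite !lift_map. Qed.

Lemma fbal a u v : f (tgt a ** u) v = f u (src a ** v).
Proof. exact: (bal_act fB). Qed.
End Lift.

Lemma bal_mul (P : lmodType k) (f : U -> U -> P) v1 v2 : Bal wtr wtl f ->
  Bal wtr wtl (fun u1 u2 => f (u1 ** v1) (u2 ** v2)).
Proof.
move=> fB; split=> [u2|u1|u1 a u2].
- by apply: (lin_comp (bal_linl fB _)); lin.
- by apply: (lin_comp (bal_linr fB _)); lin.
by rewrite -!umulA //; exact: fbal.
Qed.

(** This is what makes the product of two coproducts meaningful. A factor [tgt a] in front of [v1]
    stands behind [u1], and the Takeuchi condition of [u] carries it to [src a] behind [u2], in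
    front of [v2]. *)
Lemma bal_mul_cop (P : lmodType k) (f : U -> U -> P) u : Bal wtr wtl f ->
  Bal wtr wtl (fun v1 v2 => tlift (fun u1 u2 => f (u1 ** v1) (u2 ** v2)) (lb_cop u)).
Proof.
move=> fB; split=> [v2|v1|v1 a v2].
- apply: lin_lift_fun => u1 u2; apply: (lin_comp (bal_linl fB _)); lin.
- apply: lin_lift_fun => u1 u2; apply: (lin_comp (bal_linr fB _)); lin.
have := cop_tak (bal_mul v1 v2 fB) a u; rewrite /wtr /wtl.
by under eq_lift do rewrite -umulA //; under [RHS]eq_lift do rewrite -umulA //.
Qed.

Lemma cop_of_src a : lb_cop (src a : U) = tens (src a) \1.
Proof.
rewrite -[src a]umul1r // -[LHS]lift_id cop_src; last exact: bal_tens.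
rewrite cop_one //; split=> [v|v|v b w] //; try lin.
by rewrite /wtr /wtl umulA // src_tgt // -umulA //; exact: tens_bal.
Qed.

Lemma cop_of_tgt a : lb_cop (tgt a : U) = tens \1 (tgt a).
Proof.
rewrite -[tgt a]umul1r // -[LHS]lift_id cop_tgt; last exact: bal_tens.
rewrite cop_one //; split=> [v|v|v b w] //; try lin.
by rewrite /wtr /wtl umulA // -src_tgt // -umulA //; exact: tens_bal.
Qed.

Lemma cop_mul_src (P : lmodType k) (f : U -> U -> P) u a : Bal wtr wtl f ->
  tlift f (lb_cop (u ** src a)) = tlift (fun u1 u2 => f (u1 ** src a) u2) (lb_cop u).
Proof.
move=> fB; rewrite cop_mul // lift_exch cop_of_src lift_tens; last exact: bal_mul_cop.
by apply: eq_lift => u1 u2; rewrite umul1r.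
Qed.

Lemma cop_mul_tgt (P : lmodType k) (f : U -> U -> P) u a : Bal wtr wtl f ->
  tlift f (lb_cop (u ** tgt a)) = tlift (fun u1 u2 => f u1 (u2 ** tgt a)) (lb_cop u).
Proof.
move=> fB; rewrite cop_mul // lift_exch cop_of_tgt lift_tens; last exact: bal_mul_cop.
by apply: eq_lift => u1 u2; rewrite umul1r.
Qed.

(** Coassociativity for an expression in three Sweedler legs. The two hypotheses let [f] descend to
    the threefold tensor product: the first handles the inner tensor, the second the outer one,
    where [A] acts on the middle leg. *)
Lemma cop_assoc (P : lmodType k) (f : U -> U -> U -> P) u :
  (forall w, Bal wtr wtl (fun u v => f u v w)) -> (forall w, Bal wtr wtl (f w)) ->
  tlift (fun u1 u2 => tlift (fun v1 v2 => f v1 v2 u2) (lb_cop u1)) (lb_cop u) =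
  tlift (fun u1 u2 => tlift (fun v1 v2 => f u1 v1 v2) (lb_cop u2)) (lb_cop u).
Proof.
move=> f1 f2.
pose F (x : tensor (@wtr k A U) (@wtl k A U)) w := tlift (fun u v => f u v w) x.
have FB : Bal (tens_ract wtr) wtl F.
  split=> [w|x|x a w]; rewrite /F; last first.
  - rewrite /tens_ract lift_map //; apply: eq_lift => m n.
    exact: (bal_act (f2 m)).
  - by apply: lin_lift_fun => v w; exact: (bal_linr (f2 _)).
  - exact: lin_lift (f1 w) (lin_id _).
have := congr1 (tlift F) (lb_coassoc hU u).
rewrite lift_lift_tens // lift_lift // => ->.
apply: eq_lift => m n; rewrite lift_lift_tens //; apply: eq_lift => v w.
by rewrite /F lift_tens.
Qed.

Lemma counitl (P : lmodType k) (h : U -> P) u : Lin h ->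
  tlift (fun u1 u2 => h (src (lb_eps u1) ** u2)) (lb_cop u) = h u.
Proof. by move=> hl; rewrite -[in RHS](lb_counitl hU u) lift_lin. Qed.

Lemma counitr (P : lmodType k) (h : U -> P) u : Lin h ->
  tlift (fun u1 u2 => h (tgt (lb_eps u2) ** u1)) (lb_cop u) = h u.
Proof. by move=> hl; rewrite -[in RHS](lb_counitr hU u) lift_lin. Qed.

End LeftBialgebroid.

#[local] Hint Resolve lin_wtl_a lin_wtr_a lin_src lin_tgt lin_wtl lin_wtr lin_btl lin_btr
  : lin.
#[local] Hint Resolve lb_is_algebra lb_aering lin_cop lin_eps : lin.

(** * The left dual as a right bialgebroid *)

Section LHom.
Variables (k : comPzRingType) (A : algebra k) (M : lmodType k) (lact : A -> M -> M).

Lemma lhomP (f : lhom lact) : is_lhom lact f.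
Proof. by case: f => f /= /asboolP. Qed.

Lemma lin_lhom (N : lmodType k) (f : lhom lact) (g : N -> M) :
  Lin g -> Lin (fun x => f (g x)).
Proof. by apply: lin_comp; split; case: (lhomP f). Qed.

Lemma lin_lhom_eval (N : lmodType k) (g : N -> lhom lact) m :
  Lin g -> Lin (fun x => g x m).
Proof. by apply: (lin_comp (g := fun f : lhom lact => f m)). Qed.

Lemma lhom_ext (f g : lhom lact) : (forall m, f m = g m) -> f = g.
Proof. by move=> fg; apply/val_inj/funext. Qed.

Lemma lhom_act (f : lhom lact) a m : f (lact a m) = a ** f m.
Proof. by case: (lhomP f) => _; apply. Qed.

Lemma lhom_sumE (I : Type) (r : seq I) (F : I -> lhom lact) m :
  (\sum_(i <- r) F i) m = \sum_(i <- r) F i m.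
Proof. exact: (Lin_sum _ _ (lin_lhom_eval m (lin_id _))). Qed.

Lemma lin_to_lhom (N : lmodType k) (F : N -> M -> A) :
  (forall x, is_lhom lact (F x)) -> (forall m, Lin (F^~ m)) ->
  Lin (fun x => to_lhom lact (F x)).
Proof.
move=> Fh Fl; split=> c x y; apply: lhom_ext => m.
have -> : (c *: to_lhom lact (F x) + to_lhom lact (F y)) m =
   c *: to_lhom lact (F x) m + to_lhom lact (F y) m by [].
by rewrite !to_lhomE // (linP (Fl m)).
Qed.

Lemma lhomI (f : M -> A) : Lin f -> (forall a m, f (lact a m) = a ** f m) -> is_lhom lact f.
Proof. by move=> [fl] fa. Qed.
End LHom.
#[local] Hint Resolve lin_lhom lin_lhom_eval : lin.

Section Dual.
Variables (k : comPzRingType) (A : algebra k) (U : left_bialgebroid_data A).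
Hypothesis hU : is_left_bialgebroid U.
Let hae : is_aering U := hU.
Notation V := (ldual U).

Lemma ldualP (psi : V) a u : psi (src a ** u) = a ** psi u.
Proof. exact: (lhom_act psi). Qed.

Lemma ldual_mul_bal1 (psi phi : V) :
  Bal wtr wtl (fun u1 u2 : U => phi (tgt (psi u2) ** u1)).
Proof.
split=> [u2|u1|u1 a u2]; try lin.
by rewrite /wtr /wtl ldualP (tgtM hU) !(umulA hU).
Qed.

Lemma ldual_mulE (psi phi : V) u :
  (psi ** phi : V) u = tlift (fun u1 u2 => phi (tgt (psi u2) ** u1)) (lb_cop u).
Proof.
rewrite [psi ** phi]/(ldual_mul _ _) to_lhomE //.
apply: lhomI => [|a {}u].
  by apply: lin_lift; [exact: ldual_mul_bal1 | lin].
rewrite (cop_src hU (ldual_mul_bal1 _ _)) lift_lin; last by lin.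
by apply: eq_lift => u1 u2; rewrite umulA // -src_tgt // -umulA // ldualP.
Qed.

Lemma ldual_oneE u : (\1 : V) u = lb_eps u.
Proof.
rewrite [\1]/(to_lhom _ _) to_lhomE //; apply: lhomI; first by lin.
exact: (lb_eps_l hU).
Qed.

Lemma ldual_srcE a u : (src a : V) u = lb_eps u ** a.
Proof.
rewrite [src a]/(to_lhom _ _) to_lhomE //; apply: lhomI; first by lin.
by move=> b m; rewrite (lb_eps_l hU) amulA.
Qed.

Lemma ldual_tgtE a u : (tgt a : V) u = lb_eps (u ** tgt a).
Proof.
rewrite [tgt a]/(to_lhom _ _) to_lhomE //; apply: lhomI; first by lin.
by move=> b m; rewrite -umulA // eps_src_mul.
Qed.

Opaque ldual_mul to_lhom tlift tens tensor ldual_cop.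

(** With the next three lemmas: the actions of [A] on [V] are the pointwise right multiplication and
    the transposes of multiplication in [U] by a source from the right, a target from the left, a
    target from the right. Afterwards no product with a source or target of [V] needs the coproduct
    of [U]. *)
Lemma ldual_btrE (psi : V) a u : (psi ** src a : V) u = psi u ** a.
Proof.
rewrite ldual_mulE; under eq_lift do rewrite ldual_srcE eps_tgt_mul // -ldualP.
by apply: (counitl hU (h := fun u => psi u ** a)) => //; lin.
Qed.

Lemma ldual_btlE (psi : V) a u : (psi ** tgt a : V) u = psi (u ** src a).
Proof.
rewrite ldual_mulE; under eq_lift do rewrite ldual_tgtE -umulA // eps_tgt_mul // -ldualP.
(* The Takeuchi condition takes [tgt a] off the leg inside the counit and puts [src a] on the other
   leg, so that the counit axiom applies. *)
rewrite (cop_tak hU (f := fun u1 u2 => psi (src (lb_eps u1) ** u2))); last first.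
  split=> [u2|u1|u1 b u2]; try lin.
  by rewrite /wtr /wtl eps_tgt_mul // srcM // umulA.
under eq_lift do rewrite umulA //.
by apply: (counitl hU (h := fun u => psi (u ** src a))); lin.
Qed.

Lemma ldual_wtlE (psi : V) a u : (src a ** psi : V) u = psi (tgt a ** u).
Proof.
rewrite ldual_mulE; under eq_lift do rewrite ldual_srcE tgtM // -umulA //.
by apply: (counitr hU (h := fun u => psi (tgt a ** u))); lin.
Qed.

Lemma ldual_wtrE (psi : V) a u : (tgt a ** psi : V) u = psi (u ** tgt a).
Proof.
rewrite ldual_mulE; under eq_lift do rewrite ldual_tgtE eps_mul_tgt //.
(* Only the form with [src a], just obtained from [eps_mul_tgt], fits the Takeuchi condition; it
   frees the leg inside the counit. *)
rewrite -(cop_tak hU (f := fun u1 u2 => psi (tgt (lb_eps u2) ** u1))); last first.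
  split=> [u2|u1|u1 b u2]; try lin.
  by rewrite /wtr /wtl eps_src_mul // tgtM // umulA.
under eq_lift do rewrite umulA //.
by apply: (counitr hU (h := fun u => psi (u ** tgt a))); lin.
Qed.

Lemma ldual_is_algebra : is_algebra V.
Proof.
split=> [x y z|x|x|y c x z|x c y z]; apply: (@lhom_ext k A U wtl) => u.
- rewrite !ldual_mulE.
  (* Both products take the value z(t(y(t(x(u_3)) u_2)) u_1) at [u], so associativity of [V] is
     coassociativity of [U]. *)
  transitivity (tlift (fun u1 u2 => tlift (fun v1 v2 =>
      z (tgt (y (tgt (x v2) ** v1)) ** u1)) (lb_cop u2)) (lb_cop u)).
    rewrite -(cop_assoc hU (f := fun u1 v1 v2 => z (tgt (y (tgt (x v2) ** v1)) ** u1))).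
    + apply: eq_lift => u1 u2; rewrite ldual_mulE.
      by rewrite (cop_tgt hU (ldual_mul_bal1 _ _)).
    + move=> w; split=> [v|v|v b v']; try lin.
      by rewrite /wtr /wtl [tgt (x w) ** (_ ** _)]umulA // -src_tgt //
        -[src b ** _ ** v']umulA // ldualP tgtM // umulA.
    + move=> w; split=> [v|v|v b v']; try lin.
      by rewrite /wtr /wtl ldualP tgtM // umulA.
  apply: eq_lift => u1 u2; rewrite ldual_mulE.
  rewrite (lift_lin _ _ (h := fun a => z (tgt a ** u1))) //; lin.
- rewrite ldual_mulE; under eq_lift do rewrite ldual_oneE.
  by apply: (counitr hU); lin.
- rewrite ldual_mulE; under eq_lift do rewrite ldual_oneE // eps_tgt_mul // -ldualP.
  by apply: (counitl hU); lin.
- rewrite [RHS]/(c *: (x ** y : V) u + (z ** y : V) u) !ldual_mulE.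
  by apply: (linP (f := fun x : V => tlift (fun u1 u2 => y (tgt (x u2) ** u1)) (lb_cop
    u))); lin.
- rewrite [RHS]/(c *: (x ** y : V) u + (x ** z : V) u) !ldual_mulE.
  by apply: (linP (f := fun y : V => tlift (fun u1 u2 => y (tgt (x u2) ** u1)) (lb_cop
    u))); lin.
Qed.

Lemma ldual_is_aering : is_aering V.
Proof.
have Vsrc : is_alg_map (src : A -> V).
  split=> [c x y||x y]; apply: (@lhom_ext k A U wtl) => u.
  - rewrite [RHS]/(c *: (src x : V) u + (src y : V) u) !ldual_srcE.
    by apply: (linP (f := fun x => lb_eps u ** x)); lin.
  - by rewrite ldual_srcE ldual_oneE amul1r.
  - by rewrite ldual_btrE !ldual_srcE amulA.
split=> //; first exact: ldual_is_algebra.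
  split=> [c x y||x y]; apply: (@lhom_ext k A U wtl) => u.
  - rewrite [RHS]/(c *: (tgt x : V) u + (tgt y : V) u) !ldual_tgtE.
    by apply: (linP (f := fun x => lb_eps (u ** tgt x))); lin.
  - by rewrite ldual_tgtE ldual_oneE tgt1 // umul1r.
  - by rewrite ldual_btlE !ldual_tgtE !eps_mul_tgt // srcM // umulA //
    [in RHS](lb_epsM_src hU) eps_mul_tgt // -(lb_epsM_src hU).
move=> a b; apply: (@lhom_ext k A U wtl) => u.
by rewrite ldual_btlE ldual_btrE ldual_srcE ldual_tgtE eps_mul_tgt.
Qed.

(** * Tensors over [V] as linear maps on [U] *)

Section Expansion.
Variables (N : lmodType k) (lact : A -> N -> N).
Hypothesis lact_linl : forall n, Lin (lact^~ n).
Hypothesis lact_linr : forall a, Lin (lact a).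
Hypothesis lactM : forall a b n, lact (a ** b) n = lact a (lact b n).

(** The canonical map from V (x)_A N to Hom_A(U, N). It is used for three left actions: [btl] on
    [V], which gives [pairing]; [wtl] on [V], which gives [copairing]; and [yd_lact] on [R], which
    gives [ev]. *)
Definition hom_of_tensor (x : tensor (@btr k A V) lact) (u : U) : N :=
  tlift (fun (psi : V) n => lact (psi u) n) x.

Lemma hom_of_tensor_bal u : Bal (@btr k A V) lact (fun (psi : V) n => lact (psi u) n).
Proof.
split=> [n|psi //|psi a n]; last by rewrite /btr ldual_btrE lactM.
by apply: (lin_comp (lact_linl n)); lin.
Qed.

Lemma hom_of_tensorE psi n u : hom_of_tensor (tens psi n) u = lact (psi u) n.
Proof. by rewrite /hom_of_tensor lift_tens //; exact: hom_of_tensor_bal. Qed.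

Lemma lin_hom_of_tensor (M : lmodType k) (g : M -> tensor (@btr k A V) lact) u :
  Lin g -> Lin (fun x => hom_of_tensor (g x) u).
Proof. by apply: lin_lift; exact: hom_of_tensor_bal. Qed.

Lemma hom_of_tensor_src x a u : hom_of_tensor x (src a ** u) = lact a (hom_of_tensor x u).
Proof.
rewrite /hom_of_tensor (lift_lin _ _ (lact_linr a)).
by apply: eq_lift => psi n; rewrite ldualP lactM.
Qed.

Lemma lin_hom_of_tensorr (M : lmodType k) x (g : M -> U) :
  Lin g -> Lin (fun m => hom_of_tensor x (g m)).
Proof.
move=> gl; apply: lin_lift_fun => psi n.
by apply: (lin_comp (lact_linl n)); lin.
Qed.

Variables (I : finType) (e : I -> U) (e' : I -> V).
Hypothesis hdb : dual_basis e e'.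

(** The dual basis read in [V]: the [e' j] generate it for the right action [btr], whose
    coefficients can then be moved across the tensor sign. *)
Lemma dual_basis_hom (psi : V) : psi = \sum_(j : I) e' j ** src (psi (e j)).
Proof.
apply: (@lhom_ext k A U wtl) => u; rewrite lhom_sumE {1}[u]hdb Lin_sum; last by lin.
by apply: eq_bigr => j _; rewrite ldualP ldual_btrE.
Qed.

Lemma tensor_expand x : x = \sum_(j : I) tens (e' j) (hom_of_tensor x (e j)).
Proof.
move: x; apply: tens_ext => [||psi n]; first by lin.
  apply: lin_bigsum => j; apply: lin_tensr; apply: lin_hom_of_tensor; lin.
rewrite {1}[psi]dual_basis_hom (Lin_sum (f := fun p => tens p n)); last by lin.
by apply: eq_bigr => j _; rewrite hom_of_tensorE tens_bal.
Qed.

Lemma hom_of_tensor_inj x y : (forall u, hom_of_tensor x u = hom_of_tensor y u) -> x = y.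
Proof. by move=> xy; rewrite [x]tensor_expand [y]tensor_expand;
  under eq_bigr do rewrite xy. Qed.

(** Surjectivity of the canonical map onto Hom_A(U, N). It supplies the coproduct of [V], the
    inverse of its Galois map, and the evaluation of [eta] and of the target of [V # R]. *)
Lemma hom_of_tensor_sum (F : U -> N) u : Lin F ->
  (forall a u, F (src a ** u) = lact a (F u)) ->
  hom_of_tensor (\sum_(j : I) tens (e' j) (F (e j))) u = F u.
Proof.
move=> Fl Fa; rewrite {2}[u]hdb Lin_sum // (Lin_sum (f := fun x => hom_of_tensor x u)).
  by apply: eq_bigr => j _; rewrite hom_of_tensorE Fa.
by apply: lin_hom_of_tensor; lin.
Qed.
End Expansion.

End Dual.

#[local] Hint Resolve ldual_is_algebra ldual_is_aering : lin.

(** * The coproduct of the left dual and the right bialgebroid axioms *)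

Section DualCop.
Variables (k : comPzRingType) (A : algebra k) (U : left_bialgebroid_data A).
Hypothesis hU : is_left_bialgebroid U.
Let hae : is_aering U := hU.
Notation V := (ldual U).
Notation VV := (tensor (@btr k A V) (@btl k A V)).

(* The form on [U (x) U] that determines elements of [V (x) V]: it sends
   [psi (x) phi] to [phi(u s(psi(u')))], as in the defining property of the
   coproduct of the dual. *)
Definition pairing (x : VV) (u u' : U) : A :=
  tlift (fun psi1 psi2 : V => psi2 (u ** src (psi1 u'))) x.

Lemma pairing_bal u u' :
  Bal (@btr k A V) (@btl k A V) (fun psi1 psi2 : V => psi2 (u ** src (psi1 u'))).
Proof.
split=> [phi|psi|psi a phi]; try lin.
by rewrite /btr /btl ldual_btlE // ldual_btrE // srcM // umulA.
Qed.

Lemma pairingE psi phi u u' : pairing (tens psi phi) u u' = phi (u ** src (psi u')).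
Proof. by rewrite /pairing lift_tens //; exact: pairing_bal. Qed.

Lemma lin_pairing (M : lmodType k) (g : M -> VV) u u' :
  Lin g -> Lin (fun x => pairing (g x) u u').
Proof. by apply: lin_lift; exact: pairing_bal. Qed.

Lemma lin_pairing_l (M : lmodType k) x (g : M -> U) u' :
  Lin g -> Lin (fun m => pairing x (g m) u').
Proof. by move=> gl; apply: lin_lift_fun => psi n; lin. Qed.

Lemma lin_pairing_r (M : lmodType k) x u (g : M -> U) :
  Lin g -> Lin (fun m => pairing x u (g m)).
Proof. by move=> gl; apply: lin_lift_fun => psi n; lin. Qed.

#[local] Hint Opaque pairing : lin.
#[local] Hint Resolve lin_pairing lin_pairing_l lin_pairing_r : lin.

Let btl_linl (n : V) : Lin (fun a => btl a n : V).
Proof. by rewrite /btl; lin. Qed.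
Let btl_linr a : Lin (btl a : V -> V).
Proof. by lin. Qed.
Let btlM (a b : A) (n : V) : btl (a ** b) n = btl a (btl b n).
Proof.
by rewrite /btl (tgtM (ldual_is_aering hU)) (umulA (ldual_is_aering hU)).
Qed.

(** Acting with psi(u') on phi through [btl] and evaluating at u gives phi(u s(psi(u'))); so the
    pairing is evaluation in two stages and inherits its nondegeneracy from [hom_of_tensor_inj]. *)
Lemma pairing_hom (x : VV) u u' : (hom_of_tensor x u' : V) u = pairing x u u'.
Proof.
rewrite /hom_of_tensor (lift_lin _ _ (h := fun f : V => f u)); last by lin.
by apply: eq_lift => psi phi; rewrite /btl ldual_btlE.
Qed.

Variables (I : finType) (e : I -> U) (e' : I -> V).
Hypothesis hdb : dual_basis e e'.

Lemma pairing_inj (x y : VV) : (forall u u', pairing x u u' = pairing y u u') -> x = y.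
Proof.
move=> xy; apply: (hom_of_tensor_inj hU btl_linl btl_linr btlM hdb) => u'.
by apply: (@lhom_ext k A U wtl) => u; rewrite !pairing_hom.
Qed.

Lemma ldual_copE (psi : V) u u' : pairing (rb_cop psi) u u' = psi (u ** u').
Proof.
(* [ldual_cop] chooses an element of the set of solutions, with default 0, so its defining property
   holds as soon as that set is inhabited. *)
suff [x xP] : exists x : VV, forall u u', psi (u ** u') = pairing x u u'.
  pose Q := [set x : VV | forall u u' : U, psi (u ** u') = pairing x u u']%classic.
  have : Q (xget 0 Q) by apply: (@xgetI _ 0 Q x).
  by rewrite /Q /= => /(_ u u') ->.
pose F v : V := to_lhom _ (fun u => psi (u ** v)).
have Fh v : is_lhom wtl (fun u => psi (u ** v)).
  by apply: lhomI => [|a m]; [lin | rewrite -umulA // ldualP].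
have FE v w : F v w = psi (w ** v) by rewrite /F to_lhomE.
exists (\sum_(j : I) tens (e' j) (F (e j))) => v v'.
rewrite -pairing_hom (hom_of_tensor_sum hU btl_linl btl_linr btlM hdb) ?FE //.
  by apply: lin_to_lhom => // m; lin.
move=> a w; apply: (@lhom_ext k A U wtl) => u0.
by rewrite /btl ldual_btlE // !FE umulA.
Qed.

Let haeV : is_aering V := ldual_is_aering hU.

Lemma tens_ract_bal a :
  Bal (@btr k A V) (@btl k A V) (fun phi psi => tens phi (btr psi a) : VV).
Proof.
split=> [phi|phi|phi b psi]; try lin.
by rewrite tens_bal /btl /btr -!umulA // src_tgt.
Qed.

Notation VVV := (tensor (@tens_ract k A A V V btr btl btr) (@btl k A V)).

Lemma pairing_tens_ract (x : VV) a u u' :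
  pairing (tens_ract btr x a) u u' = pairing x u u' ** a.
Proof.
move: x; apply: tens_ext => [||phi psi].
- apply: lin_pairing; apply: lin_lift; [exact: tens_ract_bal | lin].
- apply: lin_mull; [lin | apply: lin_pairing; lin].
- rewrite /tens_ract /tmap lift_tens; last exact: tens_ract_bal.
  by rewrite !pairingE /btr ldual_btrE.
Qed.

(** On a pure tensor this is psi_3(u s(psi_2(u' s(psi_1(u''))))). Tested with it, coassociativity of
    [V] becomes associativity of the product of [u], [u'], [u'']. *)
Definition pairing3 (x : VVV) (u u' u'' : U) : A :=
  tlift (fun xx (psi : V) => psi (u ** src (pairing xx u' u''))) x.

Lemma pairing3_bal u u' u'' : Bal (@tens_ract k A A V V btr btl btr) (@btl k A V)
  (fun xx (psi : V) => psi (u ** src (pairing xx u' u''))).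
Proof.
split=> [psi|xx|xx a psi]; try lin.
by rewrite pairing_tens_ract /btl ldual_btlE // srcM // umulA.
Qed.

(** The dual basis is applied in both legs. The coefficients stand on the right of the second leg,
    from where the tensor over [A] passes them to a third one in [pairing3_inj]. *)
Lemma pairing_expand (x : VV) : x =
  \sum_(j : I) \sum_(i : I) tens_ract btr (tens (e' j) (e' i)) (pairing x (e i) (e j)).
Proof.
rewrite {1}[x](tensor_expand hU btl_linl btl_linr btlM hdb); apply: eq_bigr => j _.
rewrite {1}[hom_of_tensor x (e j)](dual_basis_hom hU hdb).
rewrite (Lin_sum (f := fun p => tens (e' j) p)); last by lin.
apply: eq_bigr => i _; rewrite pairing_hom /tens_ract /tmap lift_tens //.
exact: tens_ract_bal.
Qed.

Lemma pairing3_inj (x y : VVV) :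
  (forall u u' u'', pairing3 x u u' u'' = pairing3 y u u' u'') -> x = y.
Proof.
pose G (x : VVV) w v : V :=
  tlift (fun xx (psi : V) => btl (pairing xx w v) psi) x.
have GB w v : Bal (@tens_ract k A A V V btr btl btr) (@btl k A V)
    (fun xx (psi : V) => btl (pairing xx w v) psi).
  split=> [psi|xx|xx a psi]; last by rewrite pairing_tens_ract btlM.
    by apply: (lin_comp (btl_linl psi)); apply: lin_pairing; lin.
  by lin.
have GE z w v u : G z w v u = pairing3 z u w v.
  rewrite /G (lift_lin _ _ (h := fun f : V => f u)); last by lin.
  by apply: eq_lift => xx psi; rewrite /btl ldual_btlE.
have exp (z : VVV) : z = \sum_(j : I) \sum_(i : I) tens (tens (e' j) (e' i)) (G z (e i)
  (e j)).
  move: z; apply: tens_ext => [||xx psi]; first by lin.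
    apply: lin_bigsum => j; apply: lin_bigsum => i; apply: lin_tensr.
    by apply: lin_lift; [exact: GB|lin].
  rewrite {1}[xx]pairing_expand (Lin_sum (f := fun p => tens p psi)); last by lin.
  apply: eq_bigr => j _; rewrite (Lin_sum (f := fun p => tens p psi)); last by lin.
  by apply: eq_bigr => i _; rewrite tens_bal /G lift_tens.
move=> xy; rewrite [x]exp [y]exp; apply: eq_bigr => j _; apply: eq_bigr => i _.
by congr tens; apply: (@lhom_ext k A U wtl) => u; rewrite !GE.
Qed.

Lemma pairing_map (f g : V -> V) (x : VV) u u' :
  Bal (@btr k A V) (@btl k A V) (fun phi psi => tens (f phi) (g psi) : VV) ->
  pairing (tmap f g x) u u' =
  tlift (fun psi1 psi2 : V => (g psi2) (u ** src ((f psi1) u'))) x.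
Proof. by move=> fgB; rewrite /pairing lift_map //; exact: pairing_bal. Qed.

(** Paired with u and u', the right-hand side is w_2(t(v_2(u_2)) u_1 s(w_1(t(v_1(u'_2)) u'_1))). The
    defining property of the coproduct of [w] contracts this to w(t(v_2(u_2)) u_1 t(v_1(u'_2))
    u'_1), the Takeuchi condition and the coproduct of [v] to w(t(v(u_2 u'_2)) u_1 u'_1), which is
    the value of v w at u u'. *)
Lemma ldual_copM (v w : V) : rb_cop (v ** w) =
  tlift (fun v1 v2 => tlift (fun w1 w2 => tens (v1 ** w1) (v2 ** w2) : VV)
                            (rb_cop w)) (rb_cop v).
Proof.
apply: pairing_inj => u u'; rewrite ldual_copE ldual_mulE // cop_mul //; last first.
  exact: ldual_mul_bal1.
rewrite [RHS](lift_lin _ _ (h := fun x : VV => pairing x u u')); last by lin.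
under [RHS]eq_lift => v1 v2.
  rewrite (lift_lin _ _ (h := fun x : VV => pairing x u u')); last by lin.
  under eq_lift => w1 w2.
    rewrite pairingE ldual_mulE // cop_mul_src //; last exact: ldual_mul_bal1.
    rewrite ldual_mulE //; under eq_lift => u1 u2.
      rewrite (lift_lin _ _ (h := fun b : A => w2 (tgt (v2 u2) ** (u1 ** src b))));
        last by lin.
      over.
    over.
  rewrite lift_exch; under eq_lift => u1 u2.
    rewrite lift_exch; under eq_lift => x1 x2.
      under eq_lift do rewrite umulA //.
      rewrite -/(pairing _ _ _) ldual_copE -umulA // [u1 ** _]umulA //.
      over.
    over.
  (* The factor [tgt (v1 x2)] behind [u1] becomes [src (v1 x2)] behind [u2], inside [v2]: the shape
     of the pairing with the coproduct of [v]. *)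
  rewrite lift_exch; under eq_lift => x1 x2.
    rewrite (cop_tak hU (f := fun u1 u2 => w (tgt (v2 u2) ** (u1 ** x1)))).
      over.
    split=> [y|y|y a y']; try lin.
    by rewrite /wtr /wtl ldualP tgtM // -!umulA.
  over.
rewrite [RHS]lift_exch; under [RHS]eq_lift => x1 x2.
  rewrite lift_exch; under eq_lift => u1 u2.
    rewrite -(lift_lin _ _ (h := fun b : A => w (tgt b ** (u1 ** x1)))); last by lin.
    rewrite -/(pairing _ _ _) ldual_copE.
    over.
  over.
by rewrite lift_exch.
Qed.

(** Under the pairings the axioms are exchanged with those of [U]: coassociativity comes from
    associativity, the counit laws from the unit laws, the Takeuchi condition from u (t(b) u') = (u
    t(b)) u', the coproduct of 1 from the counit of a product, and the counit of a product from the
    coproduct of 1. *)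
Lemma ldual_right_bialgebroid : is_right_bialgebroid V.
Proof.
have bl a : Bal (@btr k A V) (@btl k A V) (fun phi psi => tens (btl a phi) psi : VV).
  split=> [phi|phi|phi b psi]; try lin.
  by rewrite -tens_bal /btl /btr -!umulA // src_tgt.
have br := tens_ract_bal.
have linc : Lin (@rb_cop k A V).
  split=> c x y; apply: pairing_inj => u u'.
  rewrite ldual_copE (linP (f := fun x => pairing x u u')); last by apply: lin_pairing; lin.
  by rewrite !ldual_copE.
have bl' b : Bal (@btr k A V) (@btl k A V) (fun phi psi => tens (wtl b phi) psi : VV).
  split=> [phi|phi|phi a psi]; try lin.
  by rewrite -tens_bal /wtl /btr -!umulA.
have br' b : Bal (@btr k A V) (@btl k A V) (fun phi psi => tens phi (wtr psi b) : VV).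
  split=> [phi|phi|phi a psi]; try lin.
  by rewrite tens_bal /wtr /btl -!umulA.
split.
- exact: haeV.
- exact: linP linc.
- move=> a psi; apply: pairing_inj => u u'.
  rewrite pairing_map // ldual_copE /btl ldual_btlE // -umulA //.
  rewrite -ldual_copE; apply: eq_lift => p q; by rewrite ldual_btlE.
- move=> a psi; apply: pairing_inj => u u'.
  rewrite pairing_map // ldual_copE /btr ldual_btrE // -ldual_copE.
  rewrite (lift_lin _ _ (h := fun x => x ** a)); last by lin.
  by apply: eq_lift => p q; rewrite ldual_btrE.
- by apply: (linP (f := fun psi : V => psi \1)); lin.
- move=> a psi; rewrite /rb_eps /= /ldual_eps /btl ldual_btlE // umul1l //.
  by rewrite -[src a]umul1r // ldualP.
- by move=> a psi; rewrite /rb_eps /= /ldual_eps /btr ldual_btrE.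
- move=> psi; apply: pairing3_inj => u u' u''.
  rewrite /pairing3 lift_lift_tens; last exact: pairing3_bal.
  rewrite lift_lift; last exact: pairing3_bal.
  under eq_lift do rewrite ldual_copE.
  transitivity (psi (u ** (u' ** u''))); first by rewrite -ldual_copE.
  rewrite umulA // -ldual_copE; apply: eq_lift => p q.
  rewrite lift_lift_tens; last exact: pairing3_bal.
  under eq_lift do rewrite pairingE.
  by rewrite -umulA // -ldual_copE.
- move=> psi; apply: (@lhom_ext k A U wtl) => u.
  rewrite (lift_lin _ _ (h := fun f : V => f u)); last by lin.
  under eq_lift do rewrite /btl ldual_btlE //.
  by rewrite -[in RHS](umul1r hae u) -ldual_copE.
- move=> psi; apply: (@lhom_ext k A U wtl) => u.
  rewrite (lift_lin _ _ (h := fun f : V => f u)); last by lin.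
  under eq_lift do rewrite /btr ldual_btrE // -ldualP -[src _]umul1l //.
  rewrite -[in RHS](umul1l hae u) -ldual_copE.
  by apply: eq_lift => p q; rewrite umul1r.
- move=> b psi; apply: pairing_inj => u u'.
  rewrite !pairing_map //.
  transitivity (psi (u ** (tgt b ** u'))).
    by rewrite -ldual_copE; apply: eq_lift => p q; rewrite /wtl ldual_wtlE.
  rewrite umulA // -ldual_copE; apply: eq_lift => p q.
  by rewrite /wtr ldual_wtrE // -umulA // -src_tgt // umulA.
- apply: pairing_inj => u u'.
  by rewrite ldual_copE pairingE !ldual_oneE // (lb_epsM_src hU).
- exact: ldual_copM.
- by rewrite /rb_eps /= /ldual_eps ldual_oneE // (lb_eps1 hU).
- move=> v w.
  rewrite /rb_eps /= /ldual_eps ldual_mulE // cop_one //; last exact: ldual_mul_bal1.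
  by rewrite ldual_wtlE.
- move=> v w.
  rewrite /rb_eps /= /ldual_eps ldual_mulE // cop_one //; last exact: ldual_mul_bal1.
  by rewrite ldual_wtrE // umul1r // umul1l.
Qed.

End DualCop.

(** * The Galois map of the left dual *)

Section DualHopf.
Variables (k : comPzRingType) (A : algebra k) (U : left_bialgebroid_data A).
Hypothesis hU : is_left_bialgebroid U.
Let hae : is_aering U := hU.
Notation V := (ldual U).
Let haeV : is_aering V := ldual_is_aering hU.
Notation VV := (tensor (@btr k A V) (@btl k A V)).
Notation VW := (tensor (@btr k A V) (@wtl k A V)).
Notation UW := (tensor (@btr k A U) (@wtl k A U)).
Notation UU := (tensor (@wtr k A U) (@wtl k A U)).

#[local] Hint Opaque pairing : lin.
#[local] Hint Resolve lin_pairing lin_pairing_l lin_pairing_r : lin.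

Let ha : is_algebra U := lb_is_algebra hU.
Let haV : is_algebra V := ldual_is_algebra hU.

Lemma alpha_r_inner_bal v : Bal (@wtr k A U) (@wtl k A U) (fun u1 u2 => tens (u1 ** v) u2
  : UU).
Proof.
split=> [u|u|u a u']; try lin.
by rewrite -tens_bal /wtr -umulA.
Qed.

Lemma alpha_r_bal : Bal (@btr k A U) (@wtl k A U)
  (fun u v => tlift (fun u1 u2 => tens (u1 ** v) u2 : UU) (lb_cop u)).
Proof.
split=> [v|u|u a v].
- by apply: lin_lift; [exact: alpha_r_inner_bal | lin].
- lin.
rewrite /btr cop_mul_src //; last exact: alpha_r_inner_bal.
by apply: eq_lift => u1 u2; rewrite -umulA.
Qed.

Lemma alpha_rE u v :
  alpha_r (tens u v : UW) = tlift (fun u1 u2 => tens (u1 ** v) u2 : UU) (lb_cop u).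
Proof. by rewrite /alpha_r lift_tens //; exact: alpha_r_bal. Qed.

Lemma lin_alpha_r (M : lmodType k) (f : M -> UW) : Lin f -> Lin (fun x => alpha_r (f x)).
Proof. by apply: lin_lift; exact: alpha_r_bal. Qed.

Lemma btr_wtl_mull_bal a :
  Bal (@btr k A U) (@wtl k A U) (fun u v => tens (wtl a u) v : UW).
Proof.
split=> [u|u|u b u']; try lin.
by rewrite -tens_bal /btr /wtl umulA.
Qed.

Lemma wtr_wtl_mull_bal a :
  Bal (@wtr k A U) (@wtl k A U) (fun u v => tens (wtl a u) v : UU).
Proof.
split=> [u|u|u b u']; try lin.
by rewrite -tens_bal /wtr /wtl !umulA // src_tgt.
Qed.

(** The inverse of the Galois map inherits this linearity, which is what turns functions built from
    that inverse into elements of [V], or into balanced families on [R # U]. *)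
Lemma alpha_r_wtl a (x : UW) : alpha_r (tmap (wtl a) idfun x) =
  tmap (wtl a) idfun (alpha_r x) :> UU.
Proof.
move: x; apply: tens_ext => [||u v].
- apply: lin_alpha_r; apply: lin_map; [exact: btr_wtl_mull_bal | lin].
- apply: lin_map; [exact: wtr_wtl_mull_bal | apply: lin_alpha_r; lin].
rewrite /tmap lift_tens; last exact: btr_wtl_mull_bal.
rewrite !alpha_rE cop_src //; last exact: alpha_r_inner_bal.
rewrite lift_lift_tens; last exact: wtr_wtl_mull_bal.
by apply: eq_lift => u1 u2; rewrite /wtl umulA.
Qed.

(* The analogue of [pairing] for the domain of the Galois map of [V]. *)
Definition copairing (x : VW) (u u' : U) : A :=
  tlift (fun phi psi : V => psi (tgt (phi u') ** u)) x.

Lemma copairing_bal u u' :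
  Bal (@btr k A V) (@wtl k A V) (fun phi psi : V => psi (tgt (phi u') ** u)).
Proof.
split=> [phi|psi|phi a psi]; try lin.
by rewrite /btr /wtl ldual_btrE // ldual_wtlE // tgtM // umulA.
Qed.

Lemma copairingE phi psi u u' : copairing (tens phi psi) u u' = psi (tgt (phi u') ** u).
Proof. by rewrite /copairing lift_tens //; exact: copairing_bal. Qed.

Lemma lin_copairing (M : lmodType k) (g : M -> VW) u u' :
  Lin g -> Lin (fun x => copairing (g x) u u').
Proof. by apply: lin_lift; exact: copairing_bal. Qed.

(** [copairing] descends to the codomain of [alpha_r], and [pairing] (next lemma) to its domain. So
    the domain of [beta_l] is paired with the codomain of [alpha_r] and conversely, as a transpose
    requires. *)
Lemma copairing_arg_bal x : Bal (@wtr k A U) (@wtl k A U) (copairing x).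
Proof.
split=> [u|u|u a u']; rewrite /copairing; try lin.
by apply: eq_lift => phi psi; rewrite /wtr /wtl ldualP tgtM // umulA.
Qed.

Lemma pairing_arg_bal (x : VV) : Bal (@btr k A U) (@wtl k A U) (pairing x).
Proof.
split=> [u|u|u a u']; try lin.
by apply: eq_lift => phi psi; rewrite /btr /wtl ldualP srcM // umulA.
Qed.

Lemma beta_l_inner_bal (phi : V) :
  Bal (@btr k A V) (@btl k A V) (fun v1 v2 => tens v1 (phi ** v2) : VV).
Proof.
split=> [v|v|v a v']; try lin.
by rewrite tens_bal /btl umulA.
Qed.

Variables (I : finType) (e : I -> U) (e' : I -> V).
Hypothesis hdb : dual_basis e e'.

Lemma lin_ldual_cop (M : lmodType k) (f : M -> V) : Lin f -> Lin (fun x => rb_cop (f x)).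
Proof.
by apply: lin_comp; split; exact: rb_cop_linear (ldual_right_bialgebroid hU hdb).
Qed.

Lemma ldual_cop_src a (psi : V) :
  rb_cop (src a ** psi) = tmap idfun (wtl a) (rb_cop psi).
Proof.
apply: (pairing_inj hU hdb) => u u'; rewrite (ldual_copE hU hdb) ldual_wtlE // umulA //.
rewrite pairing_map //; last exact: (beta_l_inner_bal (src a)).
by rewrite -(ldual_copE hU hdb); apply: eq_lift => p q; rewrite /wtl ldual_wtlE // umulA.
Qed.

Lemma beta_l_bal : Bal (@btr k A V) (@wtl k A V)
  (fun phi psi : V => tlift (fun v1 v2 => tens v1 (phi ** v2) : VV) (rb_cop psi)).
Proof.
split=> [psi|phi|phi a psi].
- lin.
- by apply: lin_lift; [exact: beta_l_inner_bal | apply: lin_ldual_cop; lin].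
rewrite /wtl ldual_cop_src lift_map; last exact: beta_l_inner_bal.
by apply: eq_lift => p q; rewrite /btr /wtl umulA.
Qed.

(** For x = phi (x) psi, the left side is psi_2(t(phi(u_2)) u_1 s(psi_1(u'))), which the coproduct
    of psi contracts to psi(t(phi(u_2)) u_1 u'); this is the copairing at u_1 u' and u_2, the legs
    of [alpha_r]. *)
Lemma pairing_beta_l (x : VW) u u' :
  pairing (beta_l x) u u' = tlift (copairing x) (alpha_r (tens u u' : UW)).
Proof.
rewrite alpha_rE lift_lift_tens; last exact: copairing_arg_bal.
move: x; apply: tens_ext => [||phi psi].
- by apply: lin_pairing => //; apply: lin_lift; [exact: beta_l_bal|lin].
- by apply: lin_lift_fun => u1 u2; apply: lin_copairing; lin.
rewrite /beta_l lift_tens; last exact: beta_l_bal.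
rewrite (lift_lin _ _ (h := fun x : VV => pairing x u u')); last by lin.
under eq_lift => v1 v2.
  rewrite pairingE // ldual_mulE // cop_mul_src //; last exact: ldual_mul_bal1.
  under eq_lift do rewrite umulA //.
  over.
rewrite lift_exch; apply: eq_lift => u1 u2.
by rewrite -/(pairing _ _ _) (ldual_copE hU hdb) copairingE umulA.
Qed.

Lemma lift_pairing_beta_l (x : VW) (z : UW) :
  tlift (pairing (beta_l x)) z = tlift (copairing x) (alpha_r z).
Proof.
move: z; apply: tens_ext => [||u u'].
- by apply: lin_lift; [exact: pairing_arg_bal | lin].
- by apply: lin_lift; [exact: copairing_arg_bal | apply: lin_alpha_r; lin].
by rewrite lift_tens ?pairing_beta_l //; exact: pairing_arg_bal.
Qed.

Let wtl_linl (n : V) : Lin (fun a => wtl a n : V).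
Proof. by rewrite /wtl; lin. Qed.
Let wtl_linr a : Lin (wtl a : V -> V).
Proof. by lin. Qed.
Let wtlM (a b : A) (n : V) : wtl (a ** b) n = wtl a (wtl b n).
Proof. by rewrite /wtl (srcM haeV) (umulA haeV). Qed.

Lemma copairing_hom (x : VW) u u' : (hom_of_tensor x u' : V) u = copairing x u u'.
Proof.
rewrite /hom_of_tensor (lift_lin _ _ (h := fun f : V => f u)); last by lin.
by apply: eq_lift => psi phi; rewrite /wtl ldual_wtlE.
Qed.

Lemma copairing_inj (x y : VW) : (forall u u', copairing x u u' = copairing y u u') -> x
  = y.
Proof.
move=> xy; apply: (hom_of_tensor_inj hU wtl_linl wtl_linr wtlM hdb) => u'.
by apply: (@lhom_ext k A U wtl) => u; rewrite !copairing_hom.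
Qed.

Lemma lift_pairing_wtl (y : VV) a (z : UW) :
  tlift (pairing y) (tmap (wtl a) idfun z : UW) = a ** tlift (pairing y) z.
Proof.
rewrite lift_map; last exact: pairing_arg_bal.
rewrite (lift_lin _ _ (h := fun b : A => a ** b)); last by lin.
apply: eq_lift => u u'; rewrite /pairing (lift_lin _ _ (h := fun b : A => a ** b));
  last by lin.
by apply: eq_lift => phi psi; rewrite /wtl -umulA // ldualP.
Qed.

Lemma ldual_left_hopf : bijective (@alpha_r k A U) -> bijective (@beta_l k A V).
Proof.
case=> g alphaK gK.
have gl : Lin g by apply: lin_can alphaK gK _; apply: lin_alpha_r; lin.
have gs a x : g (tmap (wtl a) idfun x) = tmap (wtl a) idfun (g x).
  by apply: (can_inj alphaK); rewrite gK alpha_r_wtl gK.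
(* By the transposition formula the preimage of [y] must have copairing with [u], [u'] equal to the
   pairing of [y] with [g (tens u u')]. [F y u'] is this function of [u], and [gs] makes it
   [A]-linear. *)
pose F (y : VV) u' : V := to_lhom _ (fun u => tlift (pairing y) (g (tens u u'))).
have gtl u' : Lin (fun u => g (tens u u')) by apply: (lin_comp gl); lin.
have gtr u : Lin (fun u' => g (tens u u')) by apply: (lin_comp gl); lin.
have FE y u u' : F y u' u = tlift (pairing y) (g (tens u u')).
  rewrite /F to_lhomE //; apply: lhomI => [|a {}u].
    by apply: lin_lift => //; exact: pairing_arg_bal.
  rewrite -lift_pairing_wtl -gs /tmap lift_tens //; exact: wtr_wtl_mull_bal.
pose h (y : VV) : VW := \sum_(j : I) tens (e' j) (F y (e j)).
have hE y u u' : copairing (h y) u u' = tlift (pairing y) (g (tens u u')).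
  rewrite -copairing_hom (hom_of_tensor_sum hU wtl_linl wtl_linr wtlM hdb) ?FE //.
    split=> c v w; apply: (@lhom_ext k A U wtl) => x.
    have -> : (c *: F y v + F y w) x = c *: F y v x + F y w x by [].
    rewrite !FE; apply: (linP (f := fun v => tlift (pairing y) (g (tens x v)))).
    by apply: lin_lift => //; exact: pairing_arg_bal.
  move=> a v; apply: (@lhom_ext k A U wtl) => x; rewrite /wtl ldual_wtlE // !FE.
  by rewrite -tens_bal.
exists h => [x|y].
- apply: copairing_inj => u u'; rewrite hE lift_pairing_beta_l gK lift_tens //.
  exact: copairing_arg_bal.
- apply: (pairing_inj hU hdb) => u u'; rewrite pairing_beta_l.
  transitivity (tlift (fun u u' => tlift (pairing y) (g (tens u u'))) (alpha_r (tens u u'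
    : UW))).
    by apply: eq_lift => v v'; rewrite hE.
  have -> (z : UU) : tlift (fun u u' => tlift (pairing y) (g (tens u u'))) z =
      tlift (pairing y) (g z).
    have Pl : Lin (fun z => tlift (pairing y) (g z)).
      by apply: lin_lift => //; exact: pairing_arg_bal.
    by rewrite -[in RHS](lift_id z) (lift_lin _ _ Pl).
  by rewrite alphaK lift_tens //; exact: pairing_arg_bal.
Qed.

Lemma ldual_left_hopf_algebroid :
  is_right_hopf_algebroid U -> is_left_hopf_algebroid V.
Proof.
case=> _ /ldual_left_hopf bb; split=> //; exact: ldual_right_bialgebroid hdb.
Qed.

End DualHopf.

(** * Monoids in Yetter-Drinfeld modules *)

Section YDLin.
Variables (k : comPzRingType) (A : algebra k) (U : left_bialgebroid_data A).
Variables (R : yd_monoid_data U) (hR : is_yd_monoid R) (M : lmodType k).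

Lemma lin_act_l (f : M -> U) (r : R) : Lin f -> Lin (fun x => yd_act (f x) r).
Proof.
by apply: (lin_comp (g := fun u => yd_act u r)); split;
  exact: lm_linl (yd_module (ydm_yd hR)) _.
Qed.

Lemma lin_act_r (f : M -> R) u : Lin f -> Lin (fun x => yd_act u (f x)).
Proof. by apply: lin_comp; split; exact: lm_linr (yd_module (ydm_yd hR)) _. Qed.

Lemma lin_ract_l (f : M -> R) a : Lin f -> Lin (fun x => yd_ract (f x) a).
Proof.
by apply: (lin_comp (g := fun r => yd_ract r a)); split;
  exact: rc_linl (yd_comodule (ydm_yd hR)) _.
Qed.

Lemma lin_ract_r (f : M -> A) (r : R) : Lin f -> Lin (fun x => yd_ract r (f x)).
Proof. by apply: lin_comp; split; exact: rc_linr (yd_comodule (ydm_yd hR)) _. Qed.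

Lemma lin_coact (f : M -> R) : Lin f -> Lin (fun x => yd_coact (f x)).
Proof. by apply: lin_comp; split; exact: rc_linear (yd_comodule (ydm_yd hR)). Qed.

Lemma lin_lact_r (f : M -> R) a : Lin f -> Lin (fun x => yd_lact a (f x)).
Proof. exact: lin_act_r. Qed.
End YDLin.

#[local] Hint Opaque yd_act yd_ract yd_coact yd_lact : lin.
#[local] Hint Resolve lin_act_l lin_act_r lin_ract_l lin_ract_r lin_coact lin_lact_r : lin.

Section YD.
Variables (k : comPzRingType) (A : algebra k) (U : left_bialgebroid_data A).
Variables (R : yd_monoid_data U).
Hypotheses (hU : is_left_bialgebroid U) (hR : is_yd_monoid R) (hbc : braided_commutative R).
Let hae : is_aering U := hU.
Let ha : is_algebra U := lb_is_algebra hU.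
Notation RU := (tensor (@yd_ract k A U R) (@wtl k A U)).
Implicit Types (r : R) (u v : U) (a b : A).

Let hcom := yd_comodule (ydm_yd hR).
Let hmod := yd_module (ydm_yd hR).

Lemma act1 r : yd_act \1 r = r.
Proof. exact: lm_act1 hmod _. Qed.
Lemma actM u v r : yd_act (u ** v) r = yd_act u (yd_act v r).
Proof. exact: lm_actM hmod _ _ _. Qed.
Lemma act_tgt a r : yd_act (tgt a) r = yd_ract r a.
Proof. exact: yd_ract_eq (ydm_yd hR) _ _. Qed.
Lemma act_mul u r r' :
  yd_act u (r ** r') = tlift (fun u1 u2 => yd_act u1 r ** yd_act u2 r') (lb_cop u).
Proof. exact: ydm_actM hR _ _ _. Qed.
Lemma act_one u : yd_act u (\1 : R) = yd_act (src (lb_eps u)) \1.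
Proof. exact: ydm_act1 hR _. Qed.
Lemma lact_mul a r r' : yd_act (src a) (r ** r') = yd_act (src a) r ** r'.
Proof. exact: ydm_lact hR _ _ _. Qed.
Lemma ract_mul a r r' : yd_ract (r ** r') a = r ** yd_ract r' a.
Proof. exact: ydm_ract hR _ _ _. Qed.
Lemma mul_ract a r r' : yd_ract r a ** r' = r ** yd_act (src a) r'.
Proof. exact: ydm_mid hR _ _ _. Qed.
Lemma ractM r a b : yd_ract r (a ** b) = yd_ract (yd_ract r a) b.
Proof. exact: rc_ractM hcom _ _ _. Qed.
Lemma ract1 r : yd_ract r \1 = r.
Proof. exact: rc_ract1 hcom _. Qed.
Lemma ract_one a : yd_ract (\1 : R) a = yd_act (src a) \1.
Proof. by rewrite -[LHS](amul1r (A := R)) mul_ract (amul1l (A := R)). Qed.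

Section Lift.
Variables (P : lmodType k) (f : R -> U -> P).
Hypothesis fB : Bal (@yd_ract k A U R) (@wtl k A U) f.

Lemma coact_mul r r' : tlift f (yd_coact (r ** r')) =
  tlift (fun x0 x1 => tlift (fun x0' x1' => f (x0 ** x0') (x1' ** x1)) (yd_coact r'))
        (yd_coact r).
Proof.
rewrite (ydm_coactM hR) lift_lift //; apply: eq_lift => x0 x1.
exact: lift_lift_tens.
Qed.

Lemma coact_one : tlift f (yd_coact (\1 : R)) = f \1 \1.
Proof. by rewrite (ydm_coact1 hR) lift_tens. Qed.

Lemma coact_ract r a : tlift f (yd_coact (yd_ract r a)) =
  tlift (fun x0 x1 => f x0 (tgt a ** x1)) (yd_coact r).
Proof. by rewrite (rc_rho_r hcom) lift_map. Qed.

Lemma coact_compat u r :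
  tlift (fun x0 x1 => tlift (fun u1 u2 => f (yd_act u1 x0) (u2 ** x1)) (lb_cop u))
        (yd_coact r) =
  tlift (fun u1 u2 => tlift (fun x0 x1 => f x0 (x1 ** u1)) (yd_coact (yd_act u2 r)))
        (lb_cop u).
Proof.
have := congr1 (tlift f) (yd_compat (ydm_yd hR) u r).
rewrite !lift_lift //.
under eq_lift do rewrite lift_lift_tens //.
by under [X in _ = X -> _]eq_lift do rewrite lift_lift_tens //.
Qed.
End Lift.

Lemma bal_coact_mull (P : lmodType k) (f : R -> U -> P) v :
  Bal (@yd_ract k A U R) wtl f -> Bal (@yd_ract k A U R) wtl (fun r u => f r (u ** v)).
Proof.
move=> fB; split=> [u|r|r a u].
- exact: (bal_linl fB).
- by apply: (lin_comp (bal_linr fB r)); lin.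
by rewrite (bal_act fB) /wtl umulA.
Qed.

Lemma coact_assoc (P : lmodType k) (f : R -> U -> U -> P) r :
  (forall w, Bal (@yd_ract k A U R) wtl (fun r u => f r u w)) ->
  (forall r, Bal wtr wtl (f r)) ->
  tlift (fun x0 x1 => tlift (fun x00 x01 => f x00 x01 x1) (yd_coact x0)) (yd_coact r) =
  tlift (fun x0 x1 => tlift (fun u1 u2 => f x0 u1 u2) (lb_cop x1)) (yd_coact r).
Proof.
move=> f1 f2.
pose F (x : RU) w := tlift (fun r u => f r u w) x.
have FB : Bal (tens_ract wtr) wtl F.
  split=> [w|x|x a w]; rewrite /F; last first.
  - rewrite /tens_ract lift_map //; apply: eq_lift => m n.
    exact: (bal_act (f2 m)).
  - by apply: lin_lift_fun => v w; exact: (bal_linr (f2 _)).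
  - exact: lin_lift (f1 w) (lin_id _).
have := congr1 (tlift F) (rc_coassoc hcom r).
rewrite lift_lift_tens // lift_lift // => ->.
apply: eq_lift => m n; rewrite lift_lift_tens //; apply: eq_lift => v w.
by rewrite /F lift_tens.
Qed.

(** The left action is r_0 eps(r_1 s(a)), so the coaction gives r_0 (x) t(eps(r_2 s(a))) r_1.
    Replacing s(a) by t(a) under the counit exhibits the coproduct of r_1 t(a), and the counit law
    finishes. *)
Lemma coact_lact (P : lmodType k) (f : R -> U -> P) a r :
  Bal (@yd_ract k A U R) wtl f ->
  tlift f (yd_coact (yd_act (src a) r)) = tlift (fun x0 x1 => f x0 (x1 ** tgt a))
    (yd_coact r).
Proof.
move=> fB; rewrite (yd_lact_eq (ydm_yd hR)) /comodule_lact.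
rewrite (lift_lin _ _ (h := fun x => tlift f (yd_coact x))); last by lin.
under eq_lift do rewrite coact_ract //.
rewrite (coact_assoc (f := fun x y z => f x (tgt (lb_eps (z ** src a)) ** y))).
- apply: eq_lift => x0 x1.
  rewrite -[RHS](counitr hU (h := fun u => f x0 u)); last exact: (bal_linr fB).
  rewrite cop_mul_tgt //.
    by apply: eq_lift => u1 u2; rewrite eps_mul_tgt.
  split=> [u|u|u b v].
  + by apply: (lin_comp (bal_linr fB _)); lin.
  + by apply: (lin_comp (bal_linr fB _)); lin.
  + by rewrite /wtr /wtl eps_src_mul // tgtM // -umulA.
- move=> w; split=> [u|x|x b u].
  + exact: (bal_linl fB).
  + by apply: (lin_comp (bal_linr fB _)); lin.
  + by rewrite (bal_act fB) /wtl !umulA // src_tgt.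
- move=> x; split=> [u|u|u b v].
  + by apply: (lin_comp (bal_linr fB _)); lin.
  + by apply: (lin_comp (bal_linr fB _)); lin.
  + by rewrite /wtr /wtl -(umulA hae (src b)) // eps_src_mul // tgtM // -umulA.
Qed.

Lemma bal_act_mul (P : lmodType k) (f : R -> U -> P) r v :
  Bal (@yd_ract k A U R) wtl f ->
  Bal (@wtr k A U) wtl (fun u1 u2 => f (yd_act u1 r) (u2 ** v)).
Proof.
move=> fB; split=> [u|u|u a w].
- by apply: (lin_comp (bal_linl fB _)); lin.
- by apply: (lin_comp (bal_linr fB _)); lin.
by rewrite /wtr actM act_tgt (bal_act fB) /wtl umulA.
Qed.

(** The Yetter-Drinfeld compatibility at u = s(a), whose coproduct is s(a) (x) 1. *)
Lemma coact_src (P : lmodType k) (f : R -> U -> P) a r :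
  Bal (@yd_ract k A U R) wtl f ->
  tlift (fun x0 x1 => f (yd_act (src a) x0) x1) (yd_coact r) =
  tlift (fun x0 x1 => f x0 (x1 ** src a)) (yd_coact r).
Proof.
move=> fB; have := coact_compat fB (src a) r.
rewrite cop_of_src // lift_tens; last first.
  split=> [u|u|u b v].
  - by apply: lin_lift_fun => x0 x1; apply: (lin_comp (bal_linr fB _)); lin.
  - by apply: lin_lift; [exact: bal_coact_mull | lin].
  rewrite /wtl actM coact_lact; last exact: bal_coact_mull.
  by apply: eq_lift => x0 x1; rewrite /wtr umulA.
rewrite act1 => <-; apply: eq_lift => x0 x1.
by rewrite lift_tens ?umul1l //; exact: bal_act_mul.
Qed.

End YD.

(** * The left smash product *)

Section LeftSmash.
Variables (k : comPzRingType) (A : algebra k) (U : left_bialgebroid_data A).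
Variables (R : yd_monoid_data U).
Hypotheses (hU : is_left_bialgebroid U) (hR : is_yd_monoid R) (hbc : braided_commutative R).
Let hae : is_aering U := hU.
Let ha : is_algebra U := lb_is_algebra hU.
Notation RU := (tensor (@yd_ract k A U R) (@wtl k A U)).
Notation H := (lsmash R).

Lemma smash_inner_bal (r r' : R) v :
  Bal (@wtr k A U) wtl (fun u1 u2 => tens (r ** yd_act u1 r') (u2 ** v) : RU).
Proof.
split=> [u|u|u a w]; try lin.
by rewrite /wtr actM // act_tgt // -ract_mul // tens_bal /wtl umulA.
Qed.

(** Since r' a = t(a) r', moving [a] from [r'] to [v] is the Takeuchi condition of [u]. *)
Lemma smash_mid_bal (r : R) u : Bal (@yd_ract k A U R) wtl
  (fun r' v => tlift (fun u1 u2 => tens (r ** yd_act u1 r') (u2 ** v) : RU) (lb_cop u)).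
Proof.
split=> [v|r'|r' a v]; try lin.
have := cop_tak hU (smash_inner_bal r r' v) a u.
under eq_lift do rewrite actM // act_tgt //.
by under [X in _ = X -> _]eq_lift do rewrite -umulA //.
Qed.

Lemma smash_outer_bal (y : RU) : Bal (@yd_ract k A U R) wtl
  (fun r u => tlift (fun r' v =>
     tlift (fun u1 u2 => tens (r ** yd_act u1 r') (u2 ** v) : RU) (lb_cop u)) y).
Proof.
split=> [u|r|r a u].
- lin.
- apply: lin_lift_fun => r' v; apply: lin_lift; [exact: smash_inner_bal | lin].
apply: eq_lift => r' v; rewrite /wtl cop_src //; last exact: smash_inner_bal.
by apply: eq_lift => u1 u2; rewrite mul_ract // actM.
Qed.

Lemma smash_mulE r u r' v : (tens r u : H) ** (tens r' v : H) =
  tlift (fun u1 u2 => tens (r ** yd_act u1 r') (u2 ** v) : RU) (lb_cop u).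
Proof.
rewrite [LHS]/(lsmash_mul _ _) /lsmash_mul lift_tens; last exact: smash_outer_bal.
by rewrite lift_tens //; exact: smash_mid_bal.
Qed.

Lemma lin_smash_mull (M : lmodType k) (f : M -> H) (y : H) :
  Lin f -> Lin (fun x => f x ** y).
Proof. by apply: lin_lift; exact: smash_outer_bal. Qed.

Lemma lin_smash_mulr (M : lmodType k) (f : M -> H) (x : H) :
  Lin f -> Lin (fun m => x ** f m).
Proof.
by move=> fl; apply: lin_lift_fun => r u; apply: lin_lift fl; exact: smash_mid_bal.
Qed.

Opaque lsmash_mul.
#[local] Hint Resolve lin_smash_mull lin_smash_mulr : lin.

Lemma smash_mul1 r r' v : (tens r \1 : H) ** (tens r' v : H) = tens (r ** r') v.
Proof.
rewrite smash_mulE cop_one //; last exact: smash_inner_bal.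
by rewrite act1 // umul1l.
Qed.

Lemma smash_mul_tens1 r u r' :
  (tens r u : H) ** (tens r' \1 : H) = tlift (fun u1 u2 => tens (r ** yd_act u1 r') u2 :
    RU) (lb_cop u).
Proof. by rewrite smash_mulE; apply: eq_lift => u1 u2; rewrite umul1r. Qed.

Lemma smash_mulA (x y z : H) : x ** (y ** z) = x ** y ** z.
Proof.
move: x; apply: tens_ext => [||r u]; try lin.
move: y; apply: tens_ext => [||r' v]; try lin.
move: z; apply: tens_ext => [||r'' w]; try lin.
rewrite !smash_mulE.
rewrite (lift_lin _ _ (h := fun y : RU => (tens r u : H) ** (y : H))); last by lin.
rewrite (lift_lin _ _ (h := fun y : RU => (y : H) ** (tens r'' w : H))); last by lin.
under eq_lift do rewrite smash_mulE.
under [RHS]eq_lift => u1 u2.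
  rewrite smash_mulE cop_mul //; last exact: smash_inner_bal.
  rewrite lift_exch; over.
rewrite [RHS]lift_exch; apply: eq_lift => v1 v2.
(* Both bracketings equal r (u_1 r') (u_2 v_1 r'') (x) u_3 v_2 w; what remains is coassociativity at
   [u]. *)
rewrite -(cop_assoc hU (f := fun u1 u2 u3 =>
  tens (r ** yd_act u1 r' ** yd_act (u2 ** v1) r'') (u3 ** v2 ** w) : RU)).
- apply: eq_lift => u1 u2; rewrite act_mul //.
  rewrite (lift_lin _ _ (h := fun x : R => tens (r ** x) (u2 ** (v2 ** w)) : RU));
    last by lin.
  by apply: eq_lift => u11 u12; rewrite actM // (amulA (A := R)) umulA.
- move=> u3; split=> [x|x|x a y]; try lin.
  by rewrite /wtr /wtl !actM // act_tgt // -ract_mul // mul_ract.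
- move=> u1; split=> [x|x|x a y]; try lin.
  by rewrite /wtr /wtl !actM // act_tgt // -ract_mul // tens_bal /wtl !umulA.
Qed.

Lemma smash_is_algebra : is_algebra H.
Proof.
split=> [x y z|x|x|y|x].
- exact: smash_mulA.
- move: x; apply: tens_ext => [||r u]; try lin.
  by rewrite smash_mul1 (amul1l (A := R)).
- move: x; apply: tens_ext => [||r u]; try lin.
  rewrite smash_mul_tens1; under eq_lift do rewrite act_one // -ract_one // -ract_mul //
    (amul1r (A := R)) tens_bal.
  by rewrite (counitl hU (h := fun v => tens r v : RU)) //; lin.
- by apply: (linP (f := fun x : RU => (x : H) ** y)); lin.
- by apply: (linP (f := fun y : RU => x ** (y : H))); lin.
Qed.

(* Braided commutativity makes the target act on the right of the first leg. *)
Lemma smash_tgt_mul r r' v : (yd_coact r : H) ** (tens r' v : H) =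
  tlift (fun x0 x1 => tens (r' ** x0) (x1 ** v) : RU) (yd_coact r).
Proof.
rewrite -{1}[yd_coact r]lift_id.
rewrite (lift_lin _ _ (h := fun x : RU => (x : H) ** (tens r' v : H))); last by lin.
under eq_lift do rewrite smash_mulE.
rewrite -(coact_assoc hR (f := fun x0 x1 x2 => tens (x0 ** yd_act x1 r') (x2 ** v) : RU)).
- apply: eq_lift => x0 x1.
  rewrite -(lift_lin _ _ (h := fun x : R => tens x (x1 ** v) : RU)); last by lin.
  by rewrite -hbc.
- move=> w; split=> [x|x|x a y]; try lin.
  by rewrite mul_ract // -actM.
- by move=> x; exact: smash_inner_bal.
Qed.

(** The source multiplies on the left in [R] and, by [smash_tgt_mul], the target on the right, so
    the images commute. That the target reverses products is the formula for the coaction of a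
    product, which also reverses the [U] legs. *)
Lemma smash_is_aering : is_aering H.
Proof.
split.
- exact: smash_is_algebra.
- split=> [c x y||x y].
  + by apply: (linP (f := fun x : R => tens x \1 : RU)); lin.
  + by [].
  + by rewrite smash_mul1.
- split=> [c x y||x y].
  + by apply: (linP (f := fun x : R => yd_coact x : RU)); lin.
  + exact: (ydm_coact1 hR).
  + change (yd_coact (x ** y) = (yd_coact y : H) ** (yd_coact x : H)).
    rewrite -[yd_coact x]lift_id -[yd_coact (x ** y)]lift_id.
    rewrite (lift_lin _ _ (h := fun z : RU => (yd_coact y : H) ** (z : H))); last by lin.
    rewrite coact_mul //; last exact: bal_tens.
    by apply: eq_lift => x0 x1; rewrite smash_tgt_mul.
- move=> x y; change ((tens x \1 : H) ** (yd_coact y : H) = (yd_coact y : H) ** (tens x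
  \1 : H)).
  rewrite smash_tgt_mul -[yd_coact y]lift_id.
  rewrite (lift_lin _ _ (h := fun z : RU => (tens x \1 : H) ** (z : H))); last by lin.
  rewrite lift_id; apply: eq_lift => x0 x1.
  by rewrite smash_mul1 umul1r.
Qed.

End LeftSmash.

(** * Coproduct of the smash product: linearity, Takeuchi condition, multiplicativity *)

Section LeftSmashCop.
Variables (k : comPzRingType) (A : algebra k) (U : left_bialgebroid_data A).
Variables (R : yd_monoid_data U).
Hypotheses (hU : is_left_bialgebroid U) (hR : is_yd_monoid R) (hbc : braided_commutative R).
Let hae : is_aering U := hU.
Let ha : is_algebra U := lb_is_algebra hU.
Notation RU := (tensor (@yd_ract k A U R) (@wtl k A U)).
Notation H := (lsmash R).
Let haeH : is_aering H := smash_is_aering hU hR hbc.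
Let haH : is_algebra H := smash_is_algebra hU hR.
Notation HH := (tensor (@wtr k R H) (@wtl k R H)).

#[local] Hint Resolve lin_smash_mull lin_smash_mulr : lin.

Lemma smash_src_mul r r' v : (src r : H) ** (tens r' v : H) = tens (r ** r') v.
Proof. exact: smash_mul1. Qed.

Lemma smash_tgtE r r' v : (tgt r : H) ** (tens r' v : H) =
  tlift (fun x0 x1 => tens (r' ** x0) (x1 ** v) : RU) (yd_coact r).
Proof. exact: smash_tgt_mul. Qed.

Lemma smash_tgt_ract r a r' v : (tgt (yd_ract r a) : H) ** (tens r' v : H) =
  tlift (fun x0 x1 => tens (r' ** x0) (tgt a ** x1 ** v) : RU) (yd_coact r).
Proof.
rewrite smash_tgtE coact_ract //; split=> [u|x|x b u]; try lin.
by rewrite -ract_mul // tens_bal /wtl umulA.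
Qed.

(** The elements 1_R a represent [A] inside [R]: the coaction sends them to 1 (x) t(a), so on them
    the target of [R # U] is the target of [U]. *)
Lemma smash_tgt_one a r u :
  (tgt (yd_ract \1 a) : H) ** (tens r u : H) = tens r (tgt a ** u).
Proof.
rewrite smash_tgt_ract coact_one // ?(amul1r (A := R)) ?umul1r //.
split=> [v|x|x b v]; try lin.
by rewrite -ract_mul // tens_bal /wtl !umulA // src_tgt.
Qed.

Lemma smash_tens_src a r u : (tens r (src a ** u) : H) = src (yd_ract r a) ** (tens \1 u
  : H).
Proof. by rewrite smash_src_mul (amul1r (A := R)) tens_bal. Qed.

(** A scalar [a] of [A] crosses a tensor over [R] in the form of the element 1_R a. This reduces
    tensors over [R] to tensors over [A]. *)
Lemma smash_bal_comp (P : lmodType k) (f : H -> H -> P) r : Bal wtr wtl f ->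
  Bal wtr wtl (fun u v : U => f (tens r u) (tens \1 v)).
Proof.
move=> fB; split=> [u|u|u a v].
- by apply: (lin_comp (bal_linl fB _)); lin.
- by apply: (lin_comp (bal_linr fB _)); lin.
by rewrite /wtl smash_tens_src -(bal_act fB) /wtr smash_tgt_one.
Qed.

Lemma smash_cop_bal : Bal (@yd_ract k A U R) wtl (fun r u => tlift (fun u1 u2 =>
    tens (tens r u1 : H) (tens \1 u2 : H) : HH) (lb_cop u)).
Proof.
have inB r := smash_bal_comp r (bal_tens (@wtr k R H) (@wtl k R H)).
split=> [u|r|r a u]; try lin.
rewrite /wtl cop_src //.
by apply: eq_lift => u1 u2; rewrite tens_bal.
Qed.

Lemma smash_copE r u : lb_cop (l := H) (tens r u) = tlift (fun u1 u2 =>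
    tens (tens r u1 : H) (tens \1 u2 : H) : HH) (lb_cop u).
Proof. by rewrite [LHS]/(lsmash_cop _) /lsmash_cop lift_tens //; exact: smash_cop_bal. Qed.

Lemma lift_smash_cop (P : lmodType k) (f : H -> H -> P) r u : Bal wtr wtl f ->
  tlift f (lb_cop (l := H) (tens r u)) =
  tlift (fun u1 u2 => f (tens r u1) (tens \1 u2)) (lb_cop u).
Proof. by move=> fB; rewrite smash_copE lift_lift_tens. Qed.

Lemma lin_smash_cop (M : lmodType k) (f : M -> H) :
  Lin f -> Lin (fun x => lb_cop (f x)).
Proof. by apply: lin_lift; exact: smash_cop_bal. Qed.

Lemma smash_eps_bal : Bal (@yd_ract k A U R) wtl (fun r (u : U) => yd_ract r (lb_eps u)).
Proof.
split=> [u|r|r a u]; try lin.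
by rewrite /wtl eps_src_mul // ractM.
Qed.

Lemma smash_epsE r u : lb_eps (l := H) (tens r u) = yd_ract r (lb_eps u).
Proof. by rewrite [LHS]/(lsmash_eps _) /lsmash_eps lift_tens //; exact: smash_eps_bal. Qed.

Lemma lin_smash_eps (M : lmodType k) (f : M -> H) :
  Lin f -> Lin (fun x => lb_eps (f x)).
Proof. by apply: lin_lift; exact: smash_eps_bal. Qed.

#[local] Hint Resolve lin_smash_cop lin_smash_eps : lin.

Lemma smash_bal_wtl (r : R) : Bal wtr wtl (fun x y : H => tens (wtl r x) y : HH).
Proof.
split=> [x|x|x r' y]; try lin.
by rewrite -tens_bal /wtl /wtr !umulA // src_tgt.
Qed.

Lemma smash_bal_wtr (r : R) : Bal wtr wtl (fun x y : H => tens x (wtr y r) : HH).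
Proof.
split=> [x|x|x r' y]; try lin.
by rewrite tens_bal /wtl /wtr !umulA // src_tgt.
Qed.

Lemma smash_cop_l (r : R) (x : H) : lb_cop (wtl r x) = tmap (wtl r) idfun (lb_cop x).
Proof.
move: x; apply: tens_ext => [||r' u].
- by lin.
- by apply: lin_map; [exact: smash_bal_wtl | lin].
rewrite wtlE smash_src_mul !smash_copE /tmap lift_lift_tens; last exact: smash_bal_wtl.
by apply: eq_lift => u1 u2; rewrite wtlE smash_src_mul.
Qed.

(** Coassociativity of the coaction shapes the left leg into t(r_0) applied to r' (x) u_1. The
    tensor over [R] turns this into s(r_0) on the right leg, where r_0 and r_1 recombine to t(r). *)
Lemma smash_cop_r (r : R) (x : H) : lb_cop (wtr x r) = tmap idfun (wtr^~ r) (lb_cop x).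
Proof.
move: x; apply: tens_ext => [||r' u].
- by lin.
- by apply: lin_map; [exact: smash_bal_wtr | lin].
rewrite wtrE smash_tgtE smash_copE /tmap lift_lift_tens; last exact: smash_bal_wtr.
rewrite (lift_lin _ _ (h := fun x : RU => lb_cop (l := H) x)); last by lin.
under eq_lift => x0 x1.
  rewrite smash_copE cop_mul //; last exact: (smash_bal_comp _ (bal_tens _ _)).
  rewrite lift_exch; over.
rewrite lift_exch; apply: eq_lift => u1 u2.
rewrite -(coact_assoc hR (f := fun x0 v1 v2 =>
   tens (tens (r' ** x0) (v1 ** u1) : H) (tens \1 (v2 ** u2) : H) : HH)); first last.
- move=> x0; have fB := smash_bal_comp (r' ** x0) (bal_tens (@wtr k R H) (@wtl k R H)).
  split=> [v|v|v a w]; try lin.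
  by rewrite (wtrE a) (wtlE a) -!umulA // (bal_act fB).
- move=> w; split=> [v|v|v a v']; try lin.
  by rewrite (wtlE a) -ract_mul // tens_bal (wtlE a) umulA.
rewrite wtrE smash_tgtE.
rewrite [RHS](lift_lin _ _ (h := fun x : H => tens (tens r' u1 : H) x : HH)); last by lin.
apply: eq_lift => x0 x1; rewrite (amul1l (A := R)).
rewrite -(lift_lin _ _ (h := fun x : H => tens x (tens \1 (x1 ** u2) : H) : HH));
  last by lin.
rewrite -smash_tgtE (tens_bal (@wtr k R H) (@wtl k R H)) wtlE smash_src_mul.
by rewrite (amul1r (A := R)).
Qed.

Lemma smash_bal_btl (r : R) : Bal wtr wtl (fun x y : H => tens (btl r x) y : HH).
Proof.
split=> [x|x|x r' y]; try lin.
by rewrite -tens_bal !btlE !wtrE -umulA.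
Qed.

Lemma smash_bal_btr (r : R) : Bal wtr wtl (fun x y : H => tens x (btr y r) : HH).
Proof.
split=> [x|x|x r' y]; try lin.
by rewrite tens_bal !btrE !wtlE -umulA.
Qed.

(** Here the Yetter-Drinfeld compatibility enters. The left leg (r' (x) u_1) t(r) is r' (u_1 r_0)
    (x) u_2 r_1, which the compatibility rewrites as t(u_2 r) (r' (x) u_1). Across the tensor over
    [R] this becomes s(u_2 r) on 1 (x) u_3, that is (1 (x) u_2) s(r) by coassociativity. *)
Lemma smash_takeuchi (r : R) (x : H) :
  tmap (btl r) idfun (lb_cop x) = tmap idfun (btr^~ r) (lb_cop x) :> HH.
Proof.
move: x; apply: tens_ext => [||r' u].
- by apply: lin_map; [exact: smash_bal_btl | lin].
- by apply: lin_map; [exact: smash_bal_btr | lin].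
rewrite !smash_copE /tmap !lift_lift_tens; [|exact: smash_bal_btr|exact: smash_bal_btl].
under eq_lift => u1 u2.
  rewrite btlE -[tgt r]lift_id.
  rewrite (lift_lin _ _ (h := fun x : H => tens ((tens r' u1 : H) ** x) (tens \1 u2 : H)
    : HH)); last by lin.
  under eq_lift => x0 x1.
    rewrite smash_mulE // (lift_lin _ _ (h :=
      fun x : H => tens x (tens \1 u2 : H) : HH)); last by lin.
    over.
  rewrite (coact_compat hR (f :=
    fun x v => tens (tens (r' ** x) v : H) (tens \1 u2 : H) : HH)); last first.
    split=> [w|w|w a w']; try lin.
    by rewrite -ract_mul // tens_bal.
  under eq_lift => u11 u12.
    rewrite -(lift_lin _ _ (h := fun x : H => tens x (tens \1 u2 : H) : HH)); last by lin.
    rewrite -smash_tgtE (tens_bal (@wtr k R H) (@wtl k R H)) wtlE smash_src_mul (amul1r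
      (A := R)).
    over.
  over.
rewrite (cop_assoc hU (f := fun u1 u2 u3 => tens (tens r' u1 : H) (tens (yd_act u2 r) u3
  : H) : HH)).
- apply: eq_lift => u1 u2; rewrite btrE smash_mul_tens1 //.
  rewrite [RHS](lift_lin _ _ (h := fun x : H => tens (tens r' u1 : H) x : HH)); last by lin.
  by apply: eq_lift => u21 u22; rewrite (amul1l (A := R)).
- move=> v; split=> [w|w|w a w']; try lin.
  rewrite wtrE wtlE actM // -[X in yd_act (src a) X](amul1l (A := R)) lact_mul //
    -ract_one //.
  by rewrite -smash_src_mul -(tens_bal (@wtr k R H) (@wtl k R H)) wtrE smash_tgt_one.
- move=> v; split=> [w|w|w a w']; try lin.
  by rewrite wtrE actM // act_tgt // tens_bal.
Qed.

Lemma smash_mul_one u v : (tens \1 u : H) ** (tens \1 v : H) = tens \1 (u ** v).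
Proof.
rewrite smash_mulE //; under eq_lift do rewrite act_one // -ract_one //
  (amul1l (A := R)) tens_bal wtlE umulA //.
by rewrite (counitl hU (h := fun w => tens \1 (w ** v) : RU)) //; lin.
Qed.

Lemma smash_copM (x y : H) : lb_cop (x ** y) =
  tlift (fun y1 y2 => tlift (fun x1 x2 => tens (x1 ** y1) (x2 ** y2) : HH)
                            (lb_cop x)) (lb_cop y).
Proof.
have B1 (y1 y2 : H) : Bal wtr wtl (fun x1 x2 : H => tens (x1 ** y1) (x2 ** y2) : HH).
  split=> [z|z|z r z']; try lin.
  by rewrite wtrE wtlE -!umulA // (tens_bal (@wtr k R H) (@wtl k R H)).
(* Balancedness of the outer lift is the Takeuchi condition of [R # U]. *)
have B2 (z0 : H) : Bal wtr wtl (fun y1 y2 => tlift (fun x1 x2 : H => tens (x1 ** y1) (x2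
  ** y2) : HH)
                            (lb_cop z0)).
  split=> [z|z|z r z']; try lin.
  have := congr1 (tlift (fun x1 x2 : H => tens (x1 ** z) (x2 ** z') : HH))
    (smash_takeuchi r z0).
  rewrite !lift_map // wtrE wtlE.
  under eq_lift do rewrite btlE -umulA //.
  by under [X in _ = X -> _]eq_lift do rewrite btrE -umulA //.
move: x; apply: tens_ext => [||r u]; try lin.
move: y; apply: tens_ext => [||r' v]; try lin.
rewrite (lift_smash_cop _ _ (B2 _)).
under [RHS]eq_lift do rewrite (lift_smash_cop _ _ (B1 _ _)).
rewrite smash_mulE //.
rewrite (lift_lin _ _ (h := fun x : H => lb_cop x)); last by lin.
under eq_lift => u1 u2.
  rewrite smash_copE cop_mul //; last exact: (smash_bal_comp _ (bal_tens _ _)).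
  rewrite lift_exch.
  over.
rewrite lift_exch; apply: eq_lift => v1 v2.
rewrite -(cop_assoc hU (f := fun u1 u2 u3 => 
  tens (tens (r ** yd_act u1 r') (u2 ** v1) : H) (tens \1 (u3 ** v2) : H) : HH)).
- apply: eq_lift => u1 u2; rewrite smash_mul_one smash_mulE //.
  by rewrite -(lift_lin _ _ (h := fun x : H => tens x (tens \1 (u2 ** v2) : H) : HH));
    last by lin.
- move=> w; split=> [z|z|z a z']; try lin.
  by rewrite wtrE actM // act_tgt // -ract_mul // tens_bal (wtlE a) (wtlE a) umulA.
- move=> w; have := smash_bal_comp (r ** yd_act w r') (bal_tens (@wtr k R H) (@wtl k R H)).
  exact: bal_mul.
Qed.

End LeftSmashCop.

(** * Coring and counit axioms of the smash product, and its dual basis *)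

Section LeftSmashBialgebroid.
Variables (k : comPzRingType) (A : algebra k) (U : left_bialgebroid_data A).
Variables (R : yd_monoid_data U).
Hypotheses (hU : is_left_bialgebroid U) (hR : is_yd_monoid R) (hbc : braided_commutative R).
Let hae : is_aering U := hU.
Let ha : is_algebra U := lb_is_algebra hU.
Notation RU := (tensor (@yd_ract k A U R) (@wtl k A U)).
Notation H := (lsmash R).
Let haeH : is_aering H := smash_is_aering hU hR hbc.
Let haH : is_algebra H := smash_is_algebra hU hR.
Notation HH := (tensor (@wtr k R H) (@wtl k R H)).
Notation HHH := (tensor (@tens_ract k R R H H wtr wtl wtr) (@wtl k R H)).

#[local] Hint Resolve lin_smash_mull lin_smash_mulr lin_smash_cop lin_smash_eps : lin.

Lemma smash_coassoc (x : H) :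
  tlift (fun x1 x2 => tens (lb_cop x1) x2 : HHH) (lb_cop x) =
  tlift (fun x1 x2 => tlift (fun y1 y2 => tens (tens x1 y1) y2 : HHH) (lb_cop x2))
    (lb_cop x).
Proof.
have B1 : Bal (@wtr k R H) (@wtl k R H) (fun x1 x2 => tens (lb_cop x1) x2 : HHH).
  split=> [z|z|z r z']; try lin.
  by rewrite smash_cop_r // (tens_bal (@tens_ract k R R H H wtr wtl wtr) (@wtl k R H)).
have B2 z : Bal (@wtr k R H) (@wtl k R H) (fun y1 y2 => tens (tens z y1) y2 : HHH).
  split=> [y|y|y r y']; try lin.
  rewrite -(tens_bal (@tens_ract k R R H H wtr wtl wtr) (@wtl k R H)) /tens_ract /tmap
    lift_tens //.
  exact: (smash_bal_wtr hU hR hbc).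
have B3 z : Bal (@wtr k R H) (@wtl k R H) (fun y1 y2 => tens (tens y1 y2) z : HHH).
  split=> [y|y|y r y']; try lin.
  by rewrite (tens_bal (@wtr k R H) (@wtl k R H)).
have B4 : Bal (@wtr k R H) (@wtl k R H)
   (fun x1 x2 => tlift (fun y1 y2 => tens (tens x1 y1) y2 : HHH) (lb_cop x2)).
  split=> [y|y|y r y']; try lin.
  rewrite smash_cop_l // lift_map //.
  by apply: eq_lift => y1 y2; rewrite (tens_bal (@wtr k R H) (@wtl k R H)).
move: x; apply: tens_ext => [||r u]; try lin.
rewrite !(lift_smash_cop hU hR hbc) //.
under [RHS]eq_lift do rewrite (lift_smash_cop hU hR hbc) //.
rewrite -(cop_assoc hU (f := fun u1 u2 u3 =>
  tens (tens (tens r u1 : H) (tens \1 u2 : H) : HH) (tens \1 u3 : H) : HHH)).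
- apply: eq_lift => u1 u2; rewrite (smash_copE hU hR hbc).
  by rewrite (lift_lin _ _ (h := fun x : HH => tens x (tens \1 u2 : H) : HHH)); last by lin.
- move=> w; exact: (smash_bal_comp hU hR hbc r (B3 (tens \1 w))).
- move=> w; exact: (smash_bal_comp hU hR hbc \1 (B2 (tens r w))).
Qed.

Lemma smash_eps_l (r : R) (x : H) : lb_eps (wtl r x) = r ** lb_eps x.
Proof.
move: x; apply: tens_ext => [||r' u]; try lin.
by rewrite wtlE smash_src_mul // !(smash_epsE hU hR) ract_mul.
Qed.

(** The counit of t(r) (r' (x) u) is r' r_0 eps(r_1 u), and r_0 eps(r_1 s(eps u)) is the left action
    induced by the coaction. Its agreement with the action of s(eps u) gives the result. *)
Lemma smash_eps_r (r : R) (x : H) : lb_eps (wtr x r) = lb_eps x ** r.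
Proof.
move: x; apply: tens_ext => [||r' u]; try lin.
rewrite wtrE smash_tgtE // (smash_epsE hU hR) mul_ract // (yd_lact_eq (ydm_yd hR)).
rewrite (lift_lin _ _ (h := fun x : H => lb_eps x)); last by lin.
rewrite (lift_lin _ _ (h := fun x : R => r' ** x)); last by lin.
by apply: eq_lift => x0 x1; rewrite (smash_epsE hU hR) ract_mul // (lb_epsM_src hU).
Qed.

Lemma smash_counitl (x : H) : tlift (fun x1 x2 => wtl (lb_eps x1) x2) (lb_cop x) = x.
Proof.
have B : Bal (@wtr k R H) (@wtl k R H) (fun x1 x2 => wtl (lb_eps x1) x2).
  split=> [z|z|z r z']; try lin.
  by rewrite smash_eps_r !wtlE srcM // umulA.
move: x; apply: tens_ext => [||r u]; try lin.
rewrite (lift_smash_cop hU hR hbc) //; under eq_lift do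
  rewrite wtlE (smash_epsE hU hR) smash_src_mul // (amul1r (A := R)) tens_bal wtlE.
by apply: (counitl hU (h := fun w => tens r w : RU)); lin.
Qed.

Lemma smash_counitr (x : H) : tlift (fun x1 x2 => wtr x1 (lb_eps x2)) (lb_cop x) = x.
Proof.
have B : Bal (@wtr k R H) (@wtl k R H) (fun x1 x2 => wtr x1 (lb_eps x2)).
  split=> [z|z|z r z']; try lin.
  by rewrite smash_eps_l !wtrE tgtM // umulA.
move: x; apply: tens_ext => [||r u]; try lin.
rewrite (lift_smash_cop hU hR hbc) //; under eq_lift do
  rewrite wtrE (smash_epsE hU hR) smash_tgt_one //.
by apply: (counitr hU (h := fun w => tens r w : RU)); lin.
Qed.

Lemma smash_eps_src (r : R) : lb_eps (src r : H) = r.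
Proof.
change (lb_eps (l := H) (tens r \1) = r).
by rewrite (smash_epsE hU hR) (lb_eps1 hU) ract1. Qed.

Lemma smash_eps_tgt (r : R) : lb_eps (tgt r : H) = r.
Proof. exact: rc_counit (yd_comodule (ydm_yd hR)) _. Qed.

(* Both axioms for [eps (x y)] follow, since the right-hand side depends on [y]
   only through [eps y]. *)
Lemma smash_eps_mul (r : R) u (y : H) :
  lb_eps ((tens r u : H) ** y) = r ** yd_act u (lb_eps y).
Proof.
move: y; apply: tens_ext => [||r' v]; try lin.
rewrite smash_mulE // (smash_epsE hU hR).
rewrite (lift_lin _ _ (h := fun x : H => lb_eps x)); last by lin.
under eq_lift do rewrite (smash_epsE hU hR) ract_mul // (lb_epsM_src hU).
rewrite -(cop_tak hU (f := fun u1 u2 => r ** yd_ract (yd_act u1 r') (lb_eps u2)));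
  last first.
  split=> [w|w|w a w']; try lin.
  by rewrite wtrE wtlE actM // act_tgt // eps_src_mul // ractM.
under eq_lift do rewrite actM // act_tgt // -act_tgt // -actM //.
by apply: (counitr hU (h := fun w => r ** yd_act w (yd_ract r' (lb_eps v)))); lin.
Qed.

Lemma lsmash_left_bialgebroid : is_left_bialgebroid H.
Proof.
split.
- exact: haeH.
- by apply: (linP (f := fun x : H => lb_cop x)); lin.
- exact: smash_cop_l.
- exact: smash_cop_r.
- by apply: (linP (f := fun x : H => lb_eps x)); lin.
- exact: smash_eps_l.
- exact: smash_eps_r.
- exact: smash_coassoc.
- exact: smash_counitl.
- exact: smash_counitr.
- exact: smash_takeuchi.
- change (lb_cop (l := H) (tens \1 \1) = tens (tens \1 \1) (tens \1 \1)).
  by rewrite (smash_copE hU hR hbc) cop_one //;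
    exact: (smash_bal_comp hU hR hbc \1 (bal_tens _ _)).
- exact: smash_copM.
- change (lb_eps (l := H) (tens \1 \1) = \1).
  by rewrite (smash_epsE hU hR) (lb_eps1 hU) ract1.
- move=> x y; move: x; apply: tens_ext => [||r u]; try lin.
  by rewrite !smash_eps_mul smash_eps_src.
- move=> x y; move: x; apply: tens_ext => [||r u]; try lin.
  by rewrite !smash_eps_mul smash_eps_tgt.
Qed.

Section DualBasis.
Variables (I : finType) (e : I -> U) (e' : I -> ldual U).

Definition smash_base (j : I) : H := tens \1 (e j).
Definition smash_cobase_fun (j : I) (x : H) : R :=
  tlift (fun r u => yd_ract r (e' j u)) (x : RU).

Lemma smash_cobase_bal j : Bal (@yd_ract k A U R) wtl (fun r (u : U) => yd_ract r (e' j u)).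
Proof.
split=> [u|r|r a u]; try lin.
by rewrite wtlE ldualP // ractM.
Qed.

Definition smash_cobase (j : I) : ldual H := to_lhom _ (smash_cobase_fun j).

Lemma smash_cobaseE j r u : smash_cobase j (tens r u) = yd_ract r (e' j u).
Proof.
have Bj := smash_cobase_bal j.
have L : Lin (smash_cobase_fun j) by apply: lin_lift; [|lin].
rewrite /smash_cobase to_lhomE; first by rewrite /smash_cobase_fun lift_tens.
apply: lhomI => // r' x.
move: x; apply: tens_ext => [||r'' v].
- by apply: (lin_comp L); lin.
- by apply: lin_mulr => //; lin.
by rewrite wtlE smash_src_mul // /smash_cobase_fun !lift_tens // ract_mul.
Qed.

Lemma smash_dual_basis : dual_basis e e' -> dual_basis smash_base smash_cobase.
Proof.
move=> hdb x; move: x; apply: tens_ext => [||r u]; try lin.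
rewrite {1}[u]hdb (Lin_sum (f := fun w => tens r w : RU)); last by lin.
by apply: eq_bigr => j _; rewrite smash_cobaseE smash_src_mul // (amul1r (A := R)) tens_bal.
Qed.
End DualBasis.

End LeftSmashBialgebroid.

(** * The Galois map of the smash product *)

Section LeftSmashHopf.
Variables (k : comPzRingType) (A : algebra k) (U : left_bialgebroid_data A).
Variables (R : yd_monoid_data U).
Hypotheses (hU : is_left_bialgebroid U) (hR : is_yd_monoid R) (hbc : braided_commutative R).
Let hae : is_aering U := hU.
Let ha : is_algebra U := lb_is_algebra hU.
Notation RU := (tensor (@yd_ract k A U R) (@wtl k A U)).
Notation H := (lsmash R).
Let hH : is_left_bialgebroid H := lsmash_left_bialgebroid hU hR hbc.
Let haeH : is_aering H := hH.
Let haH : is_algebra H := smash_is_algebra hU hR.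
Notation UU := (tensor (@wtr k A U) (@wtl k A U)).
Notation UW := (tensor (@btr k A U) (@wtl k A U)).
Notation HH := (tensor (@wtr k R H) (@wtl k R H)).
Notation HW := (tensor (@btr k R H) (@wtl k R H)).

Lemma smash_mul_onel r u v : (tens r u : H) ** (tens \1 v : H) = tens r (u ** v).
Proof.
by rewrite -[X in tens X u](amul1r (A := R)) -smash_src_mul // -umulA // smash_mul_one //
  smash_src_mul // (amul1r (A := R)).
Qed.

Lemma smash_mul_src_one r u a :
  (tens r u : H) ** (src (yd_ract \1 a) : H) = tens r (u ** src a).
Proof.
rewrite -[RHS](umul1r haeH) [LHS]smash_mul_tens1 // [RHS]smash_mul_tens1 // cop_mul_src //.
  by apply: eq_lift => u1 u2; rewrite ract_one // actM.
split=> [w|w|w b w']; try lin.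
by rewrite wtrE actM // act_tgt // -ract_mul // tens_bal.
Qed.

Lemma smash_galois_dom_bal r :
  Bal (@btr k A U) (@wtl k A U) (fun u v => tens (tens r u : H) (tens \1 v : H) : HW).
Proof.
split=> [w|w|u a v]; try lin.
rewrite btrE wtlE smash_tens_src // -smash_mul_src_one.
exact: (tens_bal (@btr k R H) (@wtl k R H)).
Qed.

Lemma smash_galois_cod_bal r :
  Bal (@wtr k A U) (@wtl k A U) (fun u v => tens (tens r u : H) (tens \1 v : H) : HH).
Proof. exact: (smash_bal_comp hU hR hbc r (bal_tens (@wtr k R H) (@wtl k R H))). Qed.

(** With [smash_cod], the comparison of R (x)_A of the domain and codomain of the Galois map of [U]
    with those for [R # U], keeping [r] as a parameter. *)
Definition smash_dom r (z : UW) : HW :=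
  tlift (fun u v => tens (tens r u : H) (tens \1 v : H) : HW) z.
Definition smash_cod r (z : UU) : HH :=
  tlift (fun u v => tens (tens r u : H) (tens \1 v : H) : HH) z.

Lemma lin_smash_dom (M : lmodType k) (f : M -> UW) r : Lin f -> Lin (fun x => smash_dom r
  (f x)).
Proof. by apply: lin_lift; exact: smash_galois_dom_bal. Qed.

Lemma lin_smash_cod (M : lmodType k) (f : M -> UU) r : Lin f -> Lin (fun x => smash_cod r
  (f x)).
Proof. by apply: lin_lift; exact: smash_galois_cod_bal. Qed.

Lemma lin_smash_dom_l (M : lmodType k) (f : M -> R) z : Lin f -> Lin (fun x => smash_dom
  (f x) z).
Proof. by move=> fl; apply: lin_lift_fun => u v; lin. Qed.

#[local] Hint Opaque smash_dom smash_cod alpha_r : lin.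
#[local] Hint Resolve lin_alpha_r lin_smash_dom lin_smash_cod lin_smash_dom_l : lin.

Lemma smash_domE r u v : smash_dom r (tens u v) = tens (tens r u : H) (tens \1 v : H).
Proof. by rewrite /smash_dom lift_tens //; exact: smash_galois_dom_bal. Qed.

Lemma smash_codE r u v : smash_cod r (tens u v) = tens (tens r u : H) (tens \1 v : H).
Proof. by rewrite /smash_cod lift_tens //; exact: smash_galois_cod_bal. Qed.

Lemma alpha_r_smash r (z : UW) : alpha_r (smash_dom r z) = smash_cod r (alpha_r z).
Proof.
move: z; apply: tens_ext => [||u v]; try lin.
rewrite smash_domE [LHS](alpha_rE hH) (lift_smash_cop hU hR hbc);
  last exact: (alpha_r_inner_bal hH).
rewrite (alpha_rE hU) [RHS]lift_lift_tens; last exact: smash_galois_cod_bal.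
by apply: eq_lift => u1 u2; rewrite smash_mul_onel.
Qed.

Lemma lsmash_right_hopf : bijective (@alpha_r k A U) -> bijective (@alpha_r k R H).
Proof.
case=> g alphaK gK.
have gl : Lin g by apply: lin_can alphaK gK _; lin.
have gL (M : lmodType k) (f : M -> UU) : Lin f -> Lin (fun x => g (f x)) by apply: lin_comp.
have gs a x : g (tmap (wtl a) idfun x) = tmap (wtl a) idfun (g x).
  by apply: (can_inj alphaK); rewrite gK alpha_r_wtl // gK.
(* [G v h] is the future preimage of [tens h (tens \1 v)]. It is well defined in [h] because [g]
   commutes with sources on the first leg. *)
pose G (v : U) (h : H) : HW := tlift (fun r u => smash_dom r (g (tens u v))) (h : RU).
have GB v : Bal (@yd_ract k A U R) wtl (fun r u => smash_dom r (g (tens u v))).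
  split=> [u|r|r a u]; try lin.
  have -> : tens (wtl a u) v = tmap (wtl a) idfun (tens u v : UU) :> UU.
    by rewrite /tmap lift_tens //; exact: (wtr_wtl_mull_bal hU).
  rewrite gs /smash_dom lift_map; last exact: smash_galois_dom_bal.
  by apply: eq_lift => x y; rewrite (tens_bal (@yd_ract k A U R) (@wtl k A U)).
have GE v r u : G v (tens r u) = smash_dom r (g (tens u v)) by rewrite /G lift_tens.
have Gl v : Lin (G v) by apply: lin_lift; [|lin].
have GL (M : lmodType k) v (f : M -> H) : Lin f -> Lin (fun x => G v (f x)) by apply:
  lin_comp.
have Glv (M : lmodType k) (f : M -> U) h : Lin f -> Lin (fun v => G (f v) h).
  by move=> fl; apply: lin_lift_fun => r u; lin.
have alphaG v h : alpha_r (G v h) = tens h (tens \1 v : H).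
  move: h; apply: tens_ext => [||r u]; try lin.
  by rewrite GE alpha_r_smash gK smash_codE.
(* As r (x) v = s(r) (1 (x) v), the tensor over [R] replaces h (x) (r (x) v) by t(r) h (x) (1 (x)
   v), to which [G] applies. *)
pose F (h h' : H) : HW := tlift (fun r v => G v (tgt r ** h)) (h' : RU).
have FB1 h : Bal (@yd_ract k A U R) wtl (fun r v => G v (tgt r ** h)).
  split=> [v|r|r a v]; try lin.
  move: h; apply: tens_ext => [||r' u]; try lin.
  rewrite smash_tgt_ract // smash_tgtE // !(lift_lin _ _ (Gl _)).
  by apply: eq_lift => x0 x1; rewrite !GE -!umulA // -tens_bal.
have FE h r v : F h (tens r v) = G v (tgt r ** h) by rewrite /F lift_tens.
have FB2 : Bal (@wtr k R H) (@wtl k R H) F.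
  split=> [h'|h|h r h'].
  - by apply: lin_lift_fun => r v; lin.
  - by apply: lin_lift; [|lin].
  move: h'; apply: tens_ext => [||r' v].
  - by apply: lin_lift; [|lin].
  - by apply: (lin_comp (g := F h)); [apply: lin_lift; [|lin]|lin].
  by rewrite wtlE smash_src_mul // !FE wtrE tgtM // umulA.
exists (tlift F) => z.
  move: z; apply: tens_ext => [||h h'].
  - by apply: lin_lift => //; lin.
  - by lin.
  move: h'; apply: tens_ext => [||r v].
  - by apply: lin_lift => //; lin.
  - by lin.
  (* In the domain of the Galois map [src r] crosses to the right of [h], so the second leg may be
     taken to be [tens \1 v]. *)
  have -> : tens r v = src r ** (tens \1 v : H) :> H by rewrite smash_src_mul //
    (amul1r (A := R)).
  rewrite -(tens_bal (@btr k R H) (@wtl k R H)); move: (btr h r) => {}h.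
  move: h; apply: tens_ext => [||r' u].
  - by apply: lin_lift => //; lin.
  - by lin.
  rewrite -smash_domE alpha_r_smash -[in RHS](alphaK (tens u v)).
  move: (alpha_r _) => w; move: w; apply: tens_ext => [||x y]; try lin.
  by rewrite smash_codE lift_tens // FE tgt1 // umul1l // GE.
move: z; apply: tens_ext => [||h h'].
- by apply: lin_alpha_r => //; apply: lin_lift => //; lin.
- by lin.
rewrite lift_tens //; move: h'; apply: tens_ext => [||r v].
- by apply: lin_alpha_r => //; apply: lin_lift => //; lin.
- by lin.
rewrite FE alphaG -[tgt r ** h]/(wtr h r) (tens_bal (@wtr k R H) (@wtl k R H)).
by rewrite wtlE smash_src_mul // (amul1r (A := R)).
Qed.

Lemma lsmash_right_hopf_algebroid : is_right_hopf_algebroid U -> is_right_hopf_algebroid H.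
Proof. by case=> _ /lsmash_right_hopf. Qed.

End LeftSmashHopf.

(** * The inverse of eta *)

Section DualSmash.
Variables (k : comPzRingType) (A : algebra k) (U : left_bialgebroid_data A).
Variables (R : yd_monoid_data U).
Hypotheses (hU : is_left_bialgebroid U) (hR : is_yd_monoid R) (hbc : braided_commutative R).
Variables (I : finType) (e : I -> U) (e' : I -> ldual U).
Hypothesis hdb : dual_basis e e'.
Let hae : is_aering U := hU.
Let ha : is_algebra U := lb_is_algebra hU.
Notation RU := (tensor (@yd_ract k A U R) (@wtl k A U)).
Notation H := (lsmash R).
Let hH : is_left_bialgebroid H := lsmash_left_bialgebroid hU hR hbc.
Let haeH : is_aering H := hH.
Let haH : is_algebra H := smash_is_algebra hU hR.
Notation V := (ldual U).
Notation D := (ldual H).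
Notation W := (dual_rsmash R e e').
Notation VV := (tensor (@btr k A V) (@btl k A V)).
Notation VR := (tensor (@btr k A V) (@yd_lact k A U R)).
Let hV : is_right_bialgebroid V := ldual_right_bialgebroid hU hdb.
Let haeV : is_aering V := ldual_is_aering hU.
Let haV : is_algebra V := ldual_is_algebra hU.

Lemma yd_lactE a (r : R) : yd_lact a r = yd_act (src a) r.
Proof. by []. Qed.

Let lact_linl (n : R) : Lin (fun a => yd_lact a n).
Proof. by apply: lin_act_l => //; lin. Qed.
Let lact_linr a : Lin (yd_lact (R := R) a).
Proof. by lin. Qed.
Let lactM a b (n : R) : yd_lact (a ** b) n = yd_lact a (yd_lact b n).
Proof. by rewrite !yd_lactE srcM // actM. Qed.

Notation ev := (@hom_of_tensor k A U R (@yd_lact k A U R)).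

Let evE (psi : V) (r : R) u : ev (tens psi r) u = yd_act (src (psi u)) r.
Proof. exact: (hom_of_tensorE hU lact_linl lact_linr lactM). Qed.
Let ev_src x a u : ev x (src a ** u) = yd_act (src a) (ev x u).
Proof. exact: (hom_of_tensor_src lact_linr lactM). Qed.
Let lin_ev (M : lmodType k) (g : M -> VR) u : Lin g -> Lin (fun x => ev (g x) u).
Proof. exact: (lin_hom_of_tensor hU lact_linl lact_linr lactM). Qed.
Let lin_evr (M : lmodType k) x (g : M -> U) : Lin g -> Lin (fun m => ev x (g m)).
Proof. exact: (lin_hom_of_tensorr lact_linl). Qed.
Let ev_inj (x y : VR) : (forall u, ev x u = ev y u) -> x = y.
Proof. exact: (hom_of_tensor_inj hU lact_linl lact_linr lactM hdb). Qed.

#[local] Hint Opaque hom_of_tensor : lin.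
#[local] Hint Resolve lin_ev lin_evr : lin.

Definition theta_fun (x : VR) (h : H) : R := tlift (fun r u => r ** ev x u) (h : RU).

Lemma theta_bal x : Bal (@yd_ract k A U R) (@wtl k A U) (fun r u => r ** ev x u).
Proof.
split=> [u|r|r a u]; try lin.
by rewrite wtlE ev_src mul_ract.
Qed.

Lemma theta_hom x : is_lhom wtl (theta_fun x).
Proof.
have xB := theta_bal x.
have L : Lin (theta_fun x) by apply: lin_lift; [|lin].
apply: lhomI => // r h; move: h; apply: tens_ext => [||r' u].
- by apply: (lin_comp L); lin.
- by lin.
by rewrite wtlE smash_src_mul // /theta_fun !lift_tens // (amulA (A := R)).
Qed.

Definition theta (x : W) : D := to_lhom _ (theta_fun x).

Lemma thetaE (x : W) r u : theta x (tens r u) = r ** ev x u.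
Proof.
by rewrite /theta (to_lhomE (theta_hom x)) /theta_fun lift_tens //; exact: theta_bal.
Qed.

Lemma theta1E (x : W) u : theta x (tens \1 u) = ev x u.
Proof. by rewrite thetaE (amul1l (A := R)). Qed.

Lemma ldual_smash_ext (f g : D) : (forall u, f (tens \1 u) = g (tens \1 u)) -> f = g.
Proof.
move=> fg; apply: (@lhom_ext k R H wtl) => h; move: h; apply: tens_ext => [||r u]; try lin.
have -> : tens r u = src r ** (tens \1 u : H) :> H by rewrite smash_src_mul //
  (amul1r (A := R)).
by rewrite (ldualP f) (ldualP g) fg.
Qed.

Lemma lin_theta (M : lmodType k) (f : M -> W) : Lin f -> Lin (fun x => theta (f x)).
Proof.
apply: lin_comp; apply: lin_to_lhom => [x|h]; first exact: theta_hom.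
by apply: lin_lift_fun => r u; lin.
Qed.

Lemma ev_eta (f : D) u : ev (eta R e e' f) u = f (tens \1 u).
Proof.
apply: (hom_of_tensor_sum hU lact_linl lact_linr lactM hdb (F :=
  fun u => f (tens \1 u))); first by lin.
move=> a v; rewrite smash_tens_src // (ldualP f) mul_ract //.
by rewrite (amul1l (A := R)).
Qed.

Lemma etaK : cancel (eta R e e') theta.
Proof. by move=> f; apply: ldual_smash_ext => u; rewrite theta1E ev_eta. Qed.

Lemma thetaK : cancel theta (eta R e e').
Proof. by move=> x; apply: ev_inj => u; rewrite ev_eta theta1E. Qed.

Lemma dual_ract_bal (psi : V) :
  Bal (@yd_ract k A U R) (@wtl k A U) (fun x0 x1 => yd_ract x0 (psi x1)).
Proof.
split=> [u|r|r a u]; try lin.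
by rewrite wtlE ldualP // ractM.
Qed.

Lemma lin_dual_ract_l (M : lmodType k) (f : M -> R) (psi : V) :
  Lin f -> Lin (fun x => dual_ract (f x) psi).
Proof. by move=> fl; apply: lin_lift; [exact: dual_ract_bal | lin]. Qed.

Lemma lin_dual_ract_r (M : lmodType k) (f : M -> V) (r : R) :
  Lin f -> Lin (fun x => dual_ract r (f x)).
Proof. by move=> fl; apply: lin_lift_fun => x0 x1; lin. Qed.

#[local] Hint Opaque dual_ract : lin.
#[local] Hint Resolve lin_dual_ract_l lin_dual_ract_r : lin.

Lemma dual_ract_lact a (r : R) (psi : V) :
  dual_ract (yd_act (src a) r) psi = dual_ract r (wtr psi a).
Proof.
rewrite /dual_ract coact_lact //; last exact: dual_ract_bal.
by apply: eq_lift => x0 x1; rewrite wtrE ldual_wtrE.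
Qed.

(** The action of [src a] commutes with the right action of [A], so it meets only r_0; [coact_src]
    passes it to r_1 as a factor [src a] on the right, which is [btl a] on [psi]. *)
Lemma lact_dual_ract a (r : R) (psi : V) :
  yd_act (src a) (dual_ract r psi) = dual_ract r (btl a psi).
Proof.
rewrite /dual_ract (lift_lin _ _ (h := fun x : R => yd_act (src a) x)); last by lin.
under eq_lift do rewrite -act_tgt // -actM // src_tgt // actM // act_tgt //.
rewrite (coact_src hU hR a r (dual_ract_bal psi)).
by apply: eq_lift => x0 x1; rewrite btlE ldual_btlE.
Qed.

Lemma dual_ract_btr a (r : R) (psi : V) :
  dual_ract r (btr psi a) = yd_ract (dual_ract r psi) a.
Proof.
rewrite /dual_ract (lift_lin _ _ (h := fun x : R => yd_ract x a)); last by lin.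
by apply: eq_lift => x0 x1; rewrite btrE ldual_btrE // ractM.
Qed.

Lemma rsmash_inner_bal (psi : V) (r r' : R) : Bal (@btr k A V) (@btl k A V)
  (fun w1 w2 => tens (psi ** w1) (dual_ract r w2 ** r') : VR).
Proof.
split=> [w|w|w a w']; try lin.
by rewrite btrE (umulA haeV) tens_bal yd_lactE lact_mul // lact_dual_ract.
Qed.

Lemma lin_rb_cop (M : lmodType k) (f : M -> V) : Lin f -> Lin (fun x => rb_cop (f x)).
Proof. by apply: lin_comp; split; exact: rb_cop_linear hV. Qed.

#[local] Hint Resolve lin_rb_cop : lin.

Lemma rsmash_mid_bal (psi : V) (r : R) : Bal (@btr k A V) (@yd_lact k A U R)
  (fun phi r' => tlift (fun w1 w2 => tens (psi ** w1) (dual_ract r w2 ** r') : VR)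
    (rb_cop phi)).
Proof.
have B r' := rsmash_inner_bal psi r r'.
split=> [r'|phi|phi a r']; try lin.
rewrite (rb_cop_r hV) lift_map //; apply: eq_lift => w1 w2.
by rewrite dual_ract_btr mul_ract.
Qed.

(** The Takeuchi condition of [V] at [phi] moves [a] from the first leg to the second, where
    [dual_ract_lact] absorbs it into [r]. *)
Lemma rsmash_outer_bal (y : VR) : Bal (@btr k A V) (@yd_lact k A U R)
  (fun psi r => tlift (fun phi r' =>
     tlift (fun w1 w2 => tens (psi ** w1) (dual_ract r w2 ** r') : VR) (rb_cop phi)) y).
Proof.
split=> [r|psi|psi a r]; try lin.
apply: eq_lift => phi r'.
have B := rsmash_inner_bal psi r r'.
have := congr1 (tlift (fun w1 w2 => tens (psi ** w1) (dual_ract r w2 ** r') : VR))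
  (rb_takeuchi hV a phi).
rewrite !lift_map //.
under eq_lift do rewrite wtlE (umulA haeV) -btrE.
by under [X in _ = X -> _]eq_lift do rewrite -dual_ract_lact.
Qed.

Lemma rsmash_mulE (psi phi : V) (r r' : R) : (tens psi r : W) ** (tens phi r' : W) =
  tlift (fun w1 w2 => tens (psi ** w1) (dual_ract r w2 ** r') : VR) (rb_cop phi).
Proof.
change (rsmash_mul (@dual_ract k A U R) (tens psi r) (tens phi r') = 
  tlift (fun w1 w2 => tens (psi ** w1) (dual_ract r w2 ** r') : VR) (rb_cop phi)).
rewrite /rsmash_mul lift_tens; last exact: rsmash_outer_bal.
by rewrite lift_tens //; exact: rsmash_mid_bal.
Qed.

Lemma lin_rsmash_mull (M : lmodType k) (f : M -> W) (y : W) :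
  Lin f -> Lin (fun x => f x ** y).
Proof. by apply: lin_lift; exact: rsmash_outer_bal. Qed.

Lemma lin_rsmash_mulr (M : lmodType k) (f : M -> W) (x : W) :
  Lin f -> Lin (fun m => x ** f m).
Proof.
by move=> fl; apply: lin_lift_fun => r u; apply: lin_lift fl; exact: rsmash_mid_bal.
Qed.

#[local] Hint Resolve lin_rsmash_mull lin_rsmash_mulr lin_theta : lin.

Lemma ev_mull_bal (y : VR) u : Bal (@yd_ract k A U R) (@wtl k A U)
  (fun x0 x1 => x0 ** ev y (x1 ** u)).
Proof.
split=> [v|x|x a v]; try lin.
by rewrite mul_ract // wtlE -umulA // ev_src.
Qed.

(* In Sweedler notation, [(x y)(u) = x(u_2)_[0] . y(x(u_2)_[1] u_1)], which is
   the product of the dual of [R # U]. *)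
Lemma ev_mul (x y : W) u : ev (x ** y) u =
  tlift (fun u1 u2 => tlift (fun x0 x1 => x0 ** ev y (x1 ** u1)) (yd_coact (ev x u2)))
    (lb_cop u).
Proof.
have B := ev_mull_bal.
move: x; apply: tens_ext => [||psi r]; try lin.
move: y; apply: tens_ext => [||phi r']; try lin.
rewrite rsmash_mulE (lift_lin _ _ (h := fun z : VR => ev z u)); last by lin.
under eq_lift => w1 w2.
  rewrite evE lact_mul // lact_dual_ract btlE ldual_mulE //.
  rewrite (lift_lin _ _ (h := fun b : A => dual_ract r (w2 ** tgt b) ** r')); last by lin.
  under eq_lift => u1 u2.
    rewrite /dual_ract (lift_lin _ _ (h := fun z : R => z ** r')); last by lin.
    under eq_lift do rewrite ldual_btlE //.
    over.
  over.
rewrite lift_exch; apply: eq_lift => u1 u2; rewrite lift_exch evE.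
rewrite coact_lact //; apply: eq_lift => x0 x1.
rewrite -(lift_lin _ _ (h := fun b : A => yd_ract x0 b ** r')); last by lin.
by rewrite -/(pairing _ _ _) (ldual_copE hU hdb) mul_ract // evE -!umulA.
Qed.

Lemma theta_mul (x y : W) : theta (x ** y) = theta x ** theta y.
Proof.
apply: ldual_smash_ext => u; rewrite theta1E ev_mul ldual_mulE //.
rewrite (lift_smash_cop hU hR hbc); last exact: ldual_mul_bal1.
apply: eq_lift => u1 u2; rewrite theta1E smash_tgtE //.
rewrite (lift_lin _ _ (h := fun z : H => theta y z)); last by lin.
by apply: eq_lift => x0 x1; rewrite thetaE (amul1l (A := R)).
Qed.

Lemma theta_one : theta \1 = \1.
Proof.
apply: ldual_smash_ext => u; rewrite theta1E ldual_oneE // (smash_epsE hU hR).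
change (ev (tens \1 \1) u = yd_ract \1 (lb_eps u)).
by rewrite evE ldual_oneE // ract_one.
Qed.

Lemma theta_src (r : R) : theta (src r) = src r.
Proof.
apply: ldual_smash_ext => u; rewrite theta1E ldual_srcE // (smash_epsE hU hR).
change (ev (tens \1 r) u = yd_ract \1 (lb_eps u) ** r).
by rewrite evE ldual_oneE // mul_ract // (amul1l (A := R)).
Qed.

(** Both sides send 1 (x) u to u r: on the left by the dual basis, on the right by the counit of (1
    (x) u) t(r). *)
Lemma theta_tgt (r : R) : theta (tgt r) = tgt r.
Proof.
apply: ldual_smash_ext => u; rewrite theta1E ldual_tgtE //.
rewrite smash_eps_mul // smash_eps_tgt // (amul1l (A := R)).
apply: (hom_of_tensor_sum hU lact_linl lact_linr lactM hdb (F := fun u => yd_act u r));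
  first by lin.
by move=> a v; rewrite actM.
Qed.

Let theta_inj (x y : W) : theta x = theta y -> x = y.
Proof. exact: (can_inj thetaK). Qed.

Notation DD := (tensor (@btr k R D) (@btl k R D)).
Notation WW := (tensor (@btr k R W) (@btl k R W)).

Lemma theta_bal2 : Bal (@btr k R W) (@btl k R W) (fun x y => tens (theta x) (theta y) : DD).
Proof.
split=> [x|x|x r y]; try lin.
by rewrite btrE btlE !theta_mul theta_src theta_tgt -btrE -btlE (tens_bal (@btr k R D)
  (@btl k R D)).
Qed.

(** Here and in the next lemma the identity is checked after [theta], whose codomain is a known
    bialgebroid. Both are needed before the coproduct of [V # R] can be computed on pure tensors. *)
Lemma rsmash_mul_tgt_one (psi : V) r a :
  (tens psi r : W) ** tgt (yd_ract (\1 : R) a) = tens (btl a psi) r.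
Proof.
apply: theta_inj; rewrite theta_mul theta_tgt; apply: ldual_smash_ext => u.
rewrite ldual_btlE // smash_mul_src_one // !theta1E evE [RHS]evE.
by rewrite btlE ldual_btlE.
Qed.

Lemma rsmash_mul_src (psi : V) r r' :
  (tens psi r : W) ** src (r' : R) = tens psi (r ** r').
Proof.
apply: theta_inj; rewrite theta_mul theta_src; apply: ldual_smash_ext => u.
by rewrite ldual_btrE // !theta1E evE [RHS]evE lact_mul.
Qed.

Lemma rsmash_cop_inner_bal (r : R) : Bal (@btr k A V) (@btl k A V)
  (fun w1 w2 => tens (tens w1 \1 : W) (tens w2 r : W) : WW).
Proof.
split=> [w|w|w a w']; try lin.
rewrite tens_bal yd_lactE -ract_one // -[yd_ract \1 a](amul1l (A := R)) -rsmash_mul_src.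
by rewrite -btrE (tens_bal (@btr k R W) (@btl k R W)) btlE rsmash_mul_tgt_one.
Qed.

Lemma rsmash_cop_bal : Bal (@btr k A V) (@yd_lact k A U R)
  (fun psi r => tlift (fun w1 w2 => tens (tens w1 \1 : W) (tens w2 r : W) : WW) (rb_cop
    psi)).
Proof.
have B := rsmash_cop_inner_bal.
split=> [r|psi|psi a r]; try lin.
rewrite (rb_cop_r hV) lift_map //; apply: eq_lift => w1 w2.
by rewrite tens_bal.
Qed.

Lemma rsmash_copE (psi : V) (r : R) : rb_cop (r := W) (tens psi r) =
  tlift (fun w1 w2 => tens (tens w1 \1 : W) (tens w2 r : W) : WW) (rb_cop psi).
Proof.
by rewrite [LHS]/(rsmash_cop _) /rsmash_cop lift_tens //; exact: rsmash_cop_bal.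
Qed.

Lemma theta_cop (x : W) : rb_cop (theta x) = tmap theta theta (rb_cop x).
Proof.
have B := theta_bal2.
have hdbH := smash_dual_basis hU hR hbc hdb.
apply: (pairing_inj hH hdbH) => h h'; rewrite (ldual_copE hH hdbH).
have L : Lin (fun x : W => rb_cop x) by apply: lin_lift; [exact: rsmash_cop_bal|lin].
have P : Lin (fun x : W => pairing (tmap theta theta (rb_cop x)) h h').
  by apply: lin_pairing => //; apply: lin_map => //; exact: L.
move: x; apply: tens_ext => [||psi r]; [by lin | exact: P|].
rewrite rsmash_copE /tmap lift_lift_tens //.
rewrite (lift_lin _ _ (h := fun z : DD => pairing z h h')); last first.
  by apply: lin_pairing => //; lin.
under [RHS]eq_lift do rewrite pairingE //.
move: h' {P}; apply: tens_ext => [||q v]; try lin.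
under [RHS]eq_lift do rewrite thetaE evE -ract_one // srcM // umulA //.
have -> : tens q v = src q ** (tens \1 v : H) :> H by rewrite smash_src_mul //
  (amul1r (A := R)).
(* The coefficient [q] is absorbed into the left argument, which may then be an arbitrary [h1]; the
   right one is reduced to [tens \1 v]. *)
rewrite umulA //; move: (h ** src q) => h1.
move: h1; apply: tens_ext => [||p u]; try lin.
rewrite smash_mul_onel // thetaE evE.
(* The value [w1 v] in [A] enters as the source of 1_R (w1 v), hence as [src (w1 v)] behind [u]: the
   shape of the pairing over [U], which gives psi(u v). *)
under [RHS]eq_lift do rewrite smash_mul_src_one // thetaE evE.
rewrite -(lift_lin _ _ (h := fun b : A => p ** yd_act (src b) r)); last by lin.
by rewrite -/(pairing _ _ _) (ldual_copE hU hdb).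
Qed.

Lemma theta_eps (x : W) : rb_eps (theta x) = rb_eps x.
Proof.
change (theta x (tens \1 \1) = ev x \1).
by rewrite theta1E.
Qed.

Lemma theta_iso : is_right_bialgebroid_iso theta.
Proof.
split.
- exact: Bijective thetaK etaK.
- split; [apply: (linP (f := theta)); lin | exact: theta_one | exact: theta_mul].
- exact: theta_src.
- exact: theta_tgt.
- exact: theta_cop.
- exact: theta_eps.
Qed.

End DualSmash.

(** * Transport along isomorphisms of right bialgebroids *)

Section RightBialgebroid.
Variables (k : comPzRingType) (B : algebra k) (V : right_bialgebroid_data B).
Hypothesis hV : is_aering V.
Let haV := ae_algebra hV.
Notation VV := (tensor (@btr k B V) (@btl k B V)).

Lemma rb_bal_btl b : Bal (@btr k B V) (@btl k B V) (fun x y => tens (btl b x) y : VV).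
Proof.
split=> [x|x|x a y]; try lin.
by rewrite -(tens_bal (@btr k B V) (@btl k B V)) !btlE !btrE -!umulA // src_tgt.
Qed.

Lemma rb_bal_btr b : Bal (@btr k B V) (@btl k B V) (fun x y => tens x (btr y b) : VV).
Proof.
split=> [x|x|x a y]; try lin.
by rewrite (tens_bal (@btr k B V) (@btl k B V)) !btlE !btrE -!umulA // src_tgt.
Qed.

Lemma rb_bal_wtl b : Bal (@btr k B V) (@btl k B V) (fun x y => tens (wtl b x) y : VV).
Proof.
split=> [x|x|x a y]; try lin.
by rewrite -(tens_bal (@btr k B V) (@btl k B V)) !wtlE !btrE umulA.
Qed.

Lemma rb_bal_wtr b : Bal (@btr k B V) (@btl k B V) (fun x y => tens x (wtr y b) : VV).
Proof.
split=> [x|x|x a y]; try lin.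
by rewrite (tens_bal (@btr k B V) (@btl k B V)) !wtrE !btlE umulA.
Qed.
End RightBialgebroid.

Section Iso.
Variables (k : comPzRingType) (B : algebra k) (V W : right_bialgebroid_data B).
Variables (f : V -> W) (g : W -> V).
Hypotheses (fP : is_right_bialgebroid_iso f) (fK : cancel f g) (gK : cancel g f).
Notation VV := (tensor (@btr k B V) (@btl k B V)).
Notation WW := (tensor (@btr k B W) (@btl k B W)).

Lemma lin_iso (M : lmodType k) (h : M -> V) : Lin h -> Lin (fun x => f (h x)).
Proof. by apply: lin_comp; split; exact: alg_map_linear (rbi_alg fP). Qed.

Let fM x y : f (x ** y) = f x ** f y.
Proof. exact: alg_mapM (rbi_alg fP) _ _. Qed.

#[local] Hint Resolve lin_iso : lin.

Lemma bal_iso : Bal (@btr k B V) (@btl k B V) (fun x y => tens (f x) (f y) : WW).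
Proof.
split=> [x|x|x a y]; try lin.
by rewrite btrE btlE !fM (rbi_src fP) (rbi_tgt fP) -btrE -btlE (tens_bal (@btr k B W)
  (@btl k B W)).
Qed.

Lemma bal_iso_wtl : Bal (@btr k B V) (@wtl k B V)
  (fun x y => tens (f x) (f y) : tensor (@btr k B W) (@wtl k B W)).
Proof.
split=> [x|x|x a y]; try lin.
by rewrite btrE wtlE !fM !(rbi_src fP) -btrE -wtlE (tens_bal (@btr k B W) (@wtl k B W)).
Qed.

Lemma lin_iso_inv : Lin g.
Proof. by apply: lin_can fK gK _; lin. Qed.

Lemma right_bialgebroid_iso_inv : is_right_bialgebroid_iso g.
Proof.
have gM x y : g (x ** y) = g x ** g y by apply: (can_inj fK); rewrite fM !gK.
have gs b : g (src b) = src b by rewrite -(rbi_src fP) fK.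
have gt b : g (tgt b) = tgt b by rewrite -(rbi_tgt fP) fK.
have gL (M : lmodType k) (h : M -> W) : Lin h -> Lin (fun x => g (h x)).
  by apply: lin_comp; exact: lin_iso_inv.
have gB : Bal (@btr k B W) (@btl k B W) (fun x y => tens (g x) (g y) : VV).
  split=> [x|x|x a y]; try lin.
  by rewrite btrE btlE !gM gs gt -btrE -btlE (tens_bal (@btr k B V) (@btl k B V)).
split=> //.
- exact: Bijective gK fK.
- split=> //; first exact: (linP lin_iso_inv).
  by rewrite -(alg_map1 (rbi_alg fP)) fK.
- move=> w; rewrite -[in RHS](gK w) (rbi_cop fP) /tmap lift_lift_tens //.
  by under [RHS]eq_lift do rewrite !fK; rewrite lift_id.
- by move=> w; rewrite -(rbi_eps fP) gK.
Qed.
End Iso.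

Section Transport.
Variables (k : comPzRingType) (B : algebra k) (V W : right_bialgebroid_data B).
Variables (f : V -> W).
Hypotheses (hV : is_right_bialgebroid V) (fP : is_right_bialgebroid_iso f).
Notation VV := (tensor (@btr k B V) (@btl k B V)).
Notation WW := (tensor (@btr k B W) (@btl k B W)).
Notation VVV := (tensor (@tens_ract k B B V V btr btl btr) (@btl k B V)).
Notation WWW := (tensor (@tens_ract k B B W W btr btl btr) (@btl k B W)).

#[local] Hint Resolve lin_iso : lin.

(** Every element of [W] is [f (g w)], so each axiom is the image of one for [V]. The algebra part
    [haeW] comes first because the lifts in the coalgebra axioms of [W] are balanced only by virtue
    of it. *)
Lemma right_bialgebroid_transport : is_right_bialgebroid W.
Proof.
case: (rbi_bij fP) => g fK gK.
have gP := right_bialgebroid_iso_inv fP fK gK.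
have fM x y : f (x ** y) = f x ** f y by exact: alg_mapM (rbi_alg fP) _ _.
have f1 : f \1 = \1 by exact: alg_map1 (rbi_alg fP).
have fs b : f (src b) = src b by exact: (rbi_src fP).
have ft b : f (tgt b) = tgt b by exact: (rbi_tgt fP).
have haeV := rb_aering hV; have haV := ae_algebra haeV.
have haeW : is_aering W.
  split.
  - split=> [x y z|x|x|y|x].
    + by rewrite -(gK x) -(gK y) -(gK z) -!fM umulA.
    + by rewrite -(gK x) -f1 -fM umul1l.
    + by rewrite -(gK x) -f1 -fM umul1r.
    + apply: linP; rewrite (_ : (fun x => x ** y) = (fun x => f (g x ** g y)));
      first by lin.
      by apply: funext => x; rewrite fM !gK.
    + apply: linP; rewrite (_ : (fun y => x ** y) = (fun y => f (g x ** g y)));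
      first by lin.
      by apply: funext => y; rewrite fM !gK.
  - split=> [||x y].
    + apply: linP; rewrite (_ : src = (fun x => f (src x))); first by lin.
      by apply: funext => x; rewrite fs.
    + by rewrite -fs src1.
    + by rewrite -!fs srcM // fM.
  - split=> [||x y].
    + apply: linP; rewrite (_ : tgt = (fun x => f (tgt x))); first by lin.
      by apply: funext => x; rewrite ft.
    + by rewrite -ft tgt1.
    + by rewrite -!ft tgtM // fM.
  - by move=> a b; rewrite -fs -ft -!fM src_tgt.
have haW := ae_algebra haeW.
have fB := bal_iso fP.
have lV (M : lmodType k) (h : M -> V) : Lin h -> Lin (fun x => rb_cop (h x)).
  by apply: lin_comp; split; exact: rb_cop_linear hV.
have eV (M : lmodType k) (h : M -> V) : Lin h -> Lin (fun x => rb_eps (h x)).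
  by apply: lin_comp; split; exact: rb_eps_linear hV.
have copE w : rb_cop w = tmap f f (rb_cop (g w)) by rewrite -(rbi_cop fP) gK.
have epsE w : rb_eps w = rb_eps (g w) by rewrite -(rbi_eps fP) gK.
have lW (M : lmodType k) (h : M -> W) : Lin h -> Lin (fun x => rb_cop (h x)).
  apply: lin_comp; rewrite (_ : @rb_cop k B W = (fun w => tmap f f (rb_cop (g w))));
    first by lin.
  exact: funext.
have eW (M : lmodType k) (h : M -> W) : Lin h -> Lin (fun x => rb_eps (h x)).
  apply: lin_comp; rewrite (_ : @rb_eps k B W = (fun w => rb_eps (g w))); first by lin.
  exact: funext.
have fbtl b x : f (btl b x) = btl b (f x) by rewrite !btlE fM ft.
have fbtr b x : f (btr x b) = btr (f x) b by rewrite !btrE fM fs.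
have fwtl b x : f (wtl b x) = wtl b (f x) by rewrite !wtlE fM fs.
have fwtr b x : f (wtr x b) = wtr (f x) b by rewrite !wtrE fM ft.
have liftW (P : lmodType k) (F : W -> W -> P) v : Bal (@btr k B W) (@btl k B W) F ->
    tlift F (rb_cop (f v)) = tlift (fun v1 v2 => F (f v1) (f v2)) (rb_cop v).
  by move=> FB; rewrite (rbi_cop fP) lift_map.
have B1 := rb_bal_btl haeW; have B2 := rb_bal_btr haeW.
have B3 := rb_bal_wtl haeW; have B4 := rb_bal_wtr haeW.
have C1 := rb_bal_btl haeV; have C2 := rb_bal_btr haeV.
have C3 := rb_bal_wtl haeV; have C4 := rb_bal_wtr haeV.
have el b (w : W) : rb_eps (btl b w) = b ** rb_eps w.
  by rewrite -(gK w) -fbtl !(rbi_eps fP) (rb_eps_l hV).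
have er b (w : W) : rb_eps (btr w b) = rb_eps w ** b.
  by rewrite -(gK w) -fbtr !(rbi_eps fP) (rb_eps_r hV).
have cl b (w : W) : rb_cop (btl b w) = tmap (btl b) idfun (rb_cop w).
  rewrite -(gK w) -fbtl !(rbi_cop fP) (rb_cop_l hV).
  rewrite {1}/tmap lift_map // [RHS]lift_map //; apply: eq_lift => v1 v2.
  by rewrite fbtl.
have cr b (w : W) : rb_cop (btr w b) = tmap idfun (btr^~ b) (rb_cop w).
  rewrite -(gK w) -fbtr !(rbi_cop fP) (rb_cop_r hV).
  rewrite {1}/tmap lift_map // [RHS]lift_map //; apply: eq_lift => v1 v2.
  by rewrite fbtr.
have tk b (w : W) : tmap (wtl b) idfun (rb_cop w) = tmap idfun (wtr^~ b) (rb_cop w) :> WW.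
  have := congr1 (tmap f f : VV -> WW) (rb_takeuchi hV b (g w)).
  rewrite /tmap !lift_map // -(gK w) !liftW //.
  under eq_lift do rewrite fwtl.
  by under [X in _ = X -> _]eq_lift do rewrite fwtr; rewrite !fK.
split=> //.
- by apply: (linP (f := fun w : W => rb_cop w)); lin.
- by apply: (linP (f := fun w : W => rb_eps w)); lin.
- move=> w; rewrite -(gK w); set v := g w.
  have T1 : Bal (@btr k B W) (@btl k B W) (fun w1 w2 => tens (rb_cop w1) w2 : WWW).
    split=> [z|z|z r z']; try lin.
    by rewrite cr (tens_bal (@tens_ract k B B W W btr btl btr) (@btl k B W)).
  have T2 z : Bal (@btr k B W) (@btl k B W) (fun y1 y2 => tens (tens z y1) y2 : WWW).
    split=> [y|y|y r y']; try lin.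
    by rewrite -(tens_bal (@tens_ract k B B W W btr btl btr) (@btl k B W)) /tens_ract
      /tmap lift_tens.
  have T3 : Bal (@btr k B W) (@btl k B W)
     (fun w1 w2 => tlift (fun y1 y2 => tens (tens w1 y1) y2 : WWW) (rb_cop w2)).
    split=> [y|y|y r y']; try lin.
    rewrite cl lift_map //; apply: eq_lift => y1 y2.
    by rewrite (tens_bal (@btr k B W) (@btl k B W)).
  (* The threefold tensor power of [f], through which the coassociativity of [V] is pushed to
     [W]. *)
  have T4 : Bal (@tens_ract k B B V V btr btl btr) (@btl k B V)
      (fun xx z => tens (tmap f f xx : WW) (f z) : WWW).
    split=> [y|y|y r y']; try lin.
    rewrite fbtl -(tens_bal (@tens_ract k B B W W btr btl btr) (@btl k B W)).
    congr tens; rewrite /tens_ract {1}/tmap lift_map // [RHS]lift_map //.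
    by apply: eq_lift => y1 y2; rewrite fbtr.
  have := congr1 (tlift (fun xx z => tens (tmap f f xx : WW) (f z) : WWW)) (rb_coassoc hV
    v).
  rewrite lift_lift_tens // lift_lift // !liftW // => E.
  under eq_lift do rewrite (rbi_cop fP).
  rewrite E; apply: eq_lift => v1 v2; rewrite lift_lift_tens // liftW //.
  by apply: eq_lift => v3 v4; rewrite /tmap lift_tens.
- move=> w; rewrite -(gK w) liftW.
    by rewrite -[in RHS](rb_counitl hV (g w)) (lift_lin _ _ (h := f));
      [apply: eq_lift => v1 v2; rewrite (rbi_eps fP) fbtl | lin].
  split=> [y|y|y r y']; try lin.
    by rewrite /btl; lin.
  by rewrite er !btlE tgtM // umulA.
- move=> w; rewrite -(gK w) liftW.
    by rewrite -[in RHS](rb_counitr hV (g w)) (lift_lin _ _ (h := f));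
      [apply: eq_lift => v1 v2; rewrite (rbi_eps fP) fbtr | lin].
  split=> [y|y|y r y']; try lin.
    by rewrite /btr; lin.
  by rewrite el !btrE srcM // umulA.
- by rewrite -f1 (rbi_cop fP) (rb_cop1 hV) /tmap lift_tens.
- move=> x y.
  have T1 (v1 v2 : W) : Bal (@btr k B W) (@btl k B W) (fun w1 w2 => tens (v1 ** w1) (v2
    ** w2) : WW).
    split=> [z|z|z r z']; try lin.
    by rewrite btrE btlE !umulA // -btrE -btlE (tens_bal (@btr k B W) (@btl k B W)).
  have T2 : Bal (@btr k B W) (@btl k B W)
      (fun v1 v2 => tlift (fun w1 w2 => tens (v1 ** w1) (v2 ** w2) : WW) (rb_cop y)).
    split=> [z|z|z r z']; try lin.
    have := congr1 (tlift (fun w1 w2 => tens (z ** w1) (z' ** w2) : WW)) (tk r y).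
    rewrite !lift_map // btrE btlE.
    under eq_lift do rewrite wtlE umulA //.
    by under [X in _ = X -> _]eq_lift do rewrite wtrE umulA //.
  rewrite -[in LHS](gK x) -[in LHS](gK y) -fM (rbi_cop fP) (rb_copM hV).
  rewrite /tmap lift_lift // -[in RHS](gK x) liftW //; apply: eq_lift => v1 v2.
  rewrite lift_lift_tens // -[in RHS](gK y) liftW //.
  by apply: eq_lift => w1 w2; rewrite !fM.
- by rewrite -f1 (rbi_eps fP) (rb_eps1 hV).
- move=> x y; rewrite -(gK x) -(gK y) !(rbi_eps fP) -fs -!fM !(rbi_eps fP).
  exact: (rb_epsM_src hV).
- move=> x y; rewrite -(gK x) -(gK y) !(rbi_eps fP) -ft -!fM !(rbi_eps fP).
  exact: (rb_epsM_tgt hV).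
Qed.

(* The hypothesis says that [beta_l] is well defined on [V]; it makes [beta_l]
   compute on pure tensors. *)
Lemma left_hopf_transport :
  Bal (@btr k B V) (@wtl k B V)
    (fun w v : V => tlift (fun v1 v2 => tens v1 (w ** v2) : VV) (rb_cop v)) ->
  bijective (@beta_l k B V) -> bijective (@beta_l k B W).
Proof.
move=> VB bij; case: (rbi_bij fP) => g fK gK.
have gP := right_bialgebroid_iso_inv fP fK gK.
have haeW := rb_aering right_bialgebroid_transport; have haW := ae_algebra haeW.
have fB := bal_iso fP; have gB := bal_iso gP.
have fB' := bal_iso_wtl fP; have gB' := bal_iso_wtl gP.
(* The Galois map of [W] is that of [V] conjugated by f (x) f, with different balancing on the two
   sides. *)
have E : @beta_l k B W =1 tmap f f \o @beta_l k B V \o tmap g g.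
  move=> x /=; rewrite [in RHS]/beta_l lift_map // /tmap lift_lift //.
  apply: eq_lift => w v; rewrite -[in LHS](gK v) (rbi_cop fP) lift_map.
    by rewrite lift_lift_tens //; apply: eq_lift => v1 v2;
      rewrite (alg_mapM (rbi_alg fP)) gK.
  split=> [y|y|y r y']; try lin.
  by rewrite (tens_bal (@btr k B W) (@btl k B W)) !btlE umulA.
apply: eq_bij (bij_comp (bij_comp _ bij) _) _ _; last by move=> x; rewrite E.
- exists (tmap g g : WW -> VV) => x; rewrite /tmap lift_lift_tens //.
    by under eq_lift do rewrite !fK; rewrite lift_id.
  by under eq_lift do rewrite !gK; rewrite lift_id.
- exists (tmap f f : tensor (@btr k B V) (@wtl k B V) -> tensor (@btr k B W) (@wtl k B
  W)) => x;
    rewrite /tmap lift_lift_tens //.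
    by under eq_lift do rewrite !gK; rewrite lift_id.
  by under eq_lift do rewrite !fK; rewrite lift_id.
Qed.

End Transport.

Theorem theorem2p7 (k : comPzRingType) (A : algebra k)
    (U : left_bialgebroid_data A) (R : yd_monoid_data U)
    (I : finType) (e : I -> U) (e' : I -> ldual U)
    (hU : is_left_bialgebroid U)
    (hUproj : fg_projective (@wtl k A U))
    (hR : is_yd_monoid R)
    (hRbc : braided_commutative R)
    (hdb : dual_basis e e') :
  [/\ is_right_bialgebroid (ldual (lsmash R)),
      is_right_bialgebroid (dual_rsmash R e e'),
      is_right_bialgebroid_iso (eta R e e')
    & is_right_hopf_algebroid U ->
        is_left_hopf_algebroid (ldual (lsmash R)) /\
        is_left_hopf_algebroid (dual_rsmash R e e')].
Proof.
have hH := lsmash_left_bialgebroid hU hR hRbc.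
have hdbH := smash_dual_basis hU hR hRbc hdb.
have hD := ldual_right_bialgebroid hH hdbH.
(* [eta] is handled as the inverse of [theta], whose values can be tested on 1 (x) u. *)
have etaP : is_right_bialgebroid_iso (eta R e e').
  apply: (right_bialgebroid_iso_inv (theta_iso hU hR hRbc hdb)).
    exact: thetaK.
  exact: etaK.
have hW := right_bialgebroid_transport hD etaP.
split=> // /(lsmash_right_hopf_algebroid hU hR hRbc) hopfH.
have hopfD := ldual_left_hopf_algebroid hH hdbH hopfH.
split=> //; split=> //; apply: (left_hopf_transport hD etaP); last by case: hopfD.
exact: (beta_l_bal hH hdbH).
Qed.
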